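(* Let $\mathcal H_1,\mathcal H_2$ be Hilbert spaces, $A$ a self-adjoint operator in $\mathcal H_1$ bounded from below, $B$ a densely defined closable operator from $\mathcal H_2$ to $\mathcal H_1$, and $D$ a self-adjoint operator in $\mathcal H_2$ bounded from above; let $\mathfrak a$, $\mathfrak d$ be the closed quadratic forms associated with $A$, $D$. Assume that $\mathrm{dom}(\mathfrak a)\subset\mathrm{dom}(B^* )$ and that either (I) $\mathrm{dom}(B)\subset\mathrm{dom}(D)$ and $\mathrm{dom}(B)$ is a core for $D$, or (II) $\mathrm{dom}(\mathfrak d)\subset\mathrm{dom}(B)$. Let $\mathcal M$ be the closure of $\mathcal M_0=\begin{pmatrix}A&B\\-B^*&D\end{pmatrix}$ with $\mathrm{dom}(\mathcal M_0)=(\mathrm{dom}(A)\cap\mathrm{dom}(B^* ))\times(\mathrm{dom}(B)\cap\mathrm{dom}(D))$ in $\mathcal H_1\oplus\mathcal H_2$. Assume that $A$ has compact resolvent. Then $\mathcal M$ is definitisable (in the Krein space $\mathcal K=\mathcal H_1\oplus\mathcal H_2$ with inner product $[\cdot,\cdot]$), and hence the non-real spectrum of $\mathcal M$ is finite.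
   Context: Hilbert spaces are non-zero and complex. $\mathfrak a$ has domain $\mathrm{dom}(|A|^{1/2})$ and $\mathfrak d$ has domain $\mathrm{dom}(|D|^{1/2})$. Under the stated assumptions $\mathcal M_0$ is closable. The Krein space inner product is $\bigl[\binom{x}{y},\binom{\hat x}{\hat y}\bigr]=\langle x,\hat x\rangle-\langle y,\hat y\rangle$; the operator $\mathcal M$ is self-adjoint with respect to it (i.e. $J\mathcal M$ is self-adjoint in the Hilbert space $\mathcal H_1\oplus\mathcal H_2$, $J=\begin{pmatrix}I&0\\0&-I\end{pmatrix}$). A self-adjoint operator $T$ in a Krein space is called definitisable if $\rho(T)\neq\varnothing$ and there exists a non-zero real polynomial $p$ such that $[p(T)x,x]\ge0$ for all $x\in\mathrm{dom}(T^{\deg p})$. *)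

(* Defs.v *)
From HB Require Import structures.
From mathcomp Require Import all_boot all_order all_algebra.
From mathcomp Require Import sesquilinear complex.
From mathcomp Require Import all_classical all_reals all_analysis.

Set Implicit Arguments.
Unset Strict Implicit.
Unset Printing Implicit Defensive.

Import Order.TTheory GRing.Theory Num.Theory.
Import numFieldNormedType.Exports.

Local Open Scope classical_set_scope.
Local Open Scope ring_scope.
Local Open Scope complex_scope.

(** A complex Hilbert space is a complete normed module over [R[i]] together
    with an inner product (linear in its first argument) inducing the norm. *)
Definition hilbert_dot (R : realType) (H : completeNormedModType R[i])
    (f : {dot H for (@Num.conj R[i])}) : Prop :=
  forall x : H, `|x| ^+ 2 = f x x.

(** An operator from [V] to [W] is identified with its graph, a subset of
    [V * W].  The constructions below make sense for arbitrary linear relations;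
    [is_operator] singles out the graphs of linear operators. *)

Section Graphs.
Context {R : realType}.
Implicit Types U V W : lmodType R[i].

Definition subspace V (E : set V) : Prop :=
  E 0 /\ forall (c : R[i]) x y, E x -> E y -> E (c *: x + y).

Definition is_operator V W (T : set (V * W)) : Prop :=
  subspace T /\ forall x y y', T (x, y) -> T (x, y') -> y = y'.

Definition dom V W (T : set (V * W)) : set V := fst @` T.

Definition restrict V W (T : set (V * W)) (E : set V) : set (V * W) :=
  [set p | T p /\ E p.1].

Definition op_opp V W (T : set (V * W)) : set (V * W) :=
  [set p | T (p.1, - p.2)].

Definition op_comp U V W (S : set (V * W)) (T : set (U * V)) : set (U * W) :=
  [set p | exists2 y, T (p.1, y) & S (y, p.2)].

Fixpoint op_pow V (T : set (V * V)) (n : nat) : set (V * V) :=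
  if n is m.+1 then op_comp T (op_pow T m) else [set p | p.2 = p.1].

(** The graph of [p(T)], where [u i] is the value of [T ^ i]. *)
Definition op_horner V (p : {poly R}) (T : set (V * V)) : set (V * V) :=
  [set z | dom (op_pow T (size p).-1) z.1 /\
    exists2 u : nat -> V,
      (forall i, (i < size p)%N -> op_pow T i (z.1, u i)) &
      z.2 = \sum_(i < size p) (p`_i)%:C *: u i].

Definition adjoint V W (f : V -> V -> R[i]) (g : W -> W -> R[i])
    (T : set (V * W)) : set (W * V) :=
  [set p | forall x y, T (x, y) -> g y p.1 = f x p.2].

Definition block_op V W (A : set (V * V)) (B : set (W * V))
    (C : set (V * W)) (D : set (W * W)) : set ((V * W) * (V * W)) :=
  [set p | exists a b c d,
    [/\ A (p.1.1, a), B (p.1.2, b), C (p.1.1, c), D (p.1.2, d) &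
        p.2 = (a + b, c + d)]].

Definition op_bounded_below V (f : V -> V -> R[i]) (T : set (V * V)) : Prop :=
  exists c : R, forall x y, T (x, y) -> c%:C * f x x <= f y x.

Definition op_bounded_above V (f : V -> V -> R[i]) (T : set (V * V)) : Prop :=
  exists c : R, forall x y, T (x, y) -> f y x <= c%:C * f x x.

Definition op_nonneg V (f : V -> V -> R[i]) (T : set (V * V)) : Prop :=
  forall x y, T (x, y) -> 0 <= f y x.

End Graphs.

(** The topology of a product [H1 * H2] of normed modules is the product
    topology, i.e. that of the Hilbert space [H1 (+) H2]; only the topology of
    the product is used, its (supremum) norm is not the one induced by
    [dsum_dot]. *)

Section Operators.
Context {R : realType}.
Implicit Types V W : normedModType R[i].

Definition densely_defined V W (T : set (V * W)) : Prop := dense (dom T).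

Definition closable V W (T : set (V * W)) : Prop := is_operator (closure T).

Definition core V W (T : set (V * W)) (E : set V) : Prop :=
  E `<=` dom T /\ closure (restrict T E) = closure T.

Definition self_adjoint V (f : V -> V -> R[i]) (T : set (V * V)) : Prop :=
  [/\ is_operator T, densely_defined T & adjoint f f T = T].

(** [S = (T - l)^-1] is an everywhere defined bounded operator. *)
Definition is_resolvent V (T : set (V * V)) (l : R[i]) (S : {linear V -> V}) :
    Prop :=
  continuous S /\
  forall x z, S z = x <-> exists2 y, T (x, y) & z = y - l *: x.

Definition resolvent_set V (T : set (V * V)) : set R[i] :=
  [set l | exists S : {linear V -> V}, is_resolvent T l S].

Definition spectrum V (T : set (V * V)) : set R[i] := ~` resolvent_set T.

Definition compact_op V W (S : {linear V -> W}) : Prop :=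
  precompact (S @` [set x | `|x| <= 1]).

Definition compact_resolvent V (T : set (V * V)) : Prop :=
  exists l, exists2 S : {linear V -> V}, is_resolvent T l S & compact_op S.

(** [S = T ^ (1/2)], for a nonnegative self-adjoint [T]. *)
Definition is_sqrt V (f : V -> V -> R[i]) (T S : set (V * V)) : Prop :=
  [/\ self_adjoint f S, op_nonneg f S & op_comp S S = T].

(** [S = |T| ^ (1/2)], where [|T| = (T^* T) ^ (1/2)]. *)
Definition is_sqrt_modulus V (f : V -> V -> R[i]) (T S : set (V * V)) : Prop :=
  exists2 P, is_sqrt f (op_comp (adjoint f f T) T) P & is_sqrt f P S.

End Operators.

(** A form is given by its domain and by the sesquilinear form obtained by
    polarisation; the values of the latter outside of the domain are
    irrelevant. *)

Record qform (R : realType) (V : lmodType R[i]) := QForm {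
  fdom : set V;
  fval :> V -> V -> R[i] }.

Section Forms.
Context {R : realType} {V : normedModType R[i]}.
Implicit Types (f : V -> V -> R[i]) (a : qform V).

Definition hermitian_form a : Prop :=
  [/\ subspace (fdom a),
      forall c x y z, fdom a x -> fdom a y -> fdom a z ->
        a (c *: x + y) z = c * a x z + a y z &
      forall x y, fdom a x -> fdom a y -> a y x = (a x y)^*%R].

Definition form_semibounded f a : Prop :=
  (exists c : R, forall x, fdom a x -> c%:C * f x x <= a x x) \/
  (exists c : R, forall x, fdom a x -> a x x <= c%:C * f x x).

Definition form_closed a : Prop :=
  forall (u : nat -> V) (x : V),
    (forall n, fdom a (u n)) ->
    u @ \oo --> x ->
    (fun nm : nat * nat => a (u nm.1 - u nm.2) (u nm.1 - u nm.2) : R[i]^o)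
      @ (\oo, \oo) --> (0 : R[i]^o) ->
    fdom a x /\
    (fun n => a (u n - x) (u n - x) : R[i]^o) @ \oo --> (0 : R[i]^o).

(** [a] is the closed form associated with the semibounded self-adjoint
    operator [T]: it is defined on [dom (|T| ^ (1/2))] and extends
    [x, y |-> <T x, y>]. *)
Definition associated_form f (T : set (V * V)) a : Prop :=
  [/\ hermitian_form a,
      form_semibounded f a,
      form_closed a,
      exists2 S, is_sqrt_modulus f T S & fdom a = dom S &
      forall x y z, T (x, z) -> fdom a y -> a x y = f z y].

End Forms.

Section Krein.
Context {R : realType} {H1 H2 : normedModType R[i]}.
Variables (f1 : H1 -> H1 -> R[i]) (f2 : H2 -> H2 -> R[i]).
Implicit Types T : set ((H1 * H2) * (H1 * H2)).

Definition dsum_dot (x y : H1 * H2) : R[i] := f1 x.1 y.1 + f2 x.2 y.2.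

Definition krein_dot (x y : H1 * H2) : R[i] := f1 x.1 y.1 - f2 x.2 y.2.

(** The graph of [J T], where [J (x, y) = (x, - y)]. *)
Definition fund_sym T : set ((H1 * H2) * (H1 * H2)) :=
  [set p | T (p.1, (p.2.1, - p.2.2))].

Definition krein_self_adjoint T : Prop := self_adjoint dsum_dot (fund_sym T).

Definition definitisable T : Prop :=
  [/\ krein_self_adjoint T,
      resolvent_set T !=set0 &
      exists2 p : {poly R}, p != 0 &
        forall x y, op_horner p T (x, y) -> 0 <= krein_dot y x].

End Krein.

(* Main.v *)
Require Import Defs.
From HB Require Import structures.
From mathcomp Require Import all_boot all_order all_algebra.
From mathcomp Require Import sesquilinear complex.
From mathcomp Require Import all_classical all_reals all_analysis.
From mathcomp Require Import ring lra zify finmap.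

Set Implicit Arguments.
Unset Strict Implicit.
Unset Printing Implicit Defensive.

Import Order.TTheory GRing.Theory Num.Theory.
Import numFieldNormedType.Exports.
Import Normc.

Local Open Scope classical_set_scope.
Local Open Scope ring_scope.
Local Open Scope complex_scope.

(** Write [k] for the Krein space inner product and [J] for the sign flip of the
    second component, so that [k x y = <J x, y>].  Since [dom a] is contained in
    [dom B^*], the uniform boundedness principle shows that [B^*] is bounded with
    respect to the form norm of [A].  Hence, for a large real [l0], the form
    [k ((M - l0) z) z] is uniformly positive up to a multiple of the norm of the
    first component of [z], and, as [A] has compact resolvent, up to a form of
    finite rank: [W = J (M - l0) + F] is self-adjoint and uniformly positive, with
    [F >= 0] of finite rank [kappa].

    In particular [M] is symmetric for the form [h x y = k ((M - l0) x) y], which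
    has at most [kappa] negative squares.  For finitely many orbits of [M],
    compress [M] to the finite dimensional space spanned by them and by the range
    of [W^-1 F]; there a polynomial [q] of degree at most [kappa], a product of
    linear factors found by splitting off eigenvectors one at a time, makes
    [h (q(M) x) (q(M) x)] nonnegative.  The coefficient vectors of [q * conj q],
    normalised, live in a compact sphere of fixed dimension, so one polynomial
    works for all orbits at once, and [(X - l0)] times it is definitising up to
    an even power of [X] that makes up for its possibly smaller degree.

    For nonreal [l], [M - l] is a finite rank perturbation of the invertible
    [J W - (l - l0)], so [l] is in the spectrum only if it is an eigenvalue.
    Eigenvectors for eigenvalues in one open half plane span an [h]-neutral
    subspace, whose dimension is at most [kappa]. *)

(** * Complex numbers and sesquilinear forms *)

(** The form [h] can be degenerate on a finite dimensional span, so that a compression of [M] need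
    not exist. With the range of [W^-1 F] added to the span, the radical of [h] falls into the
    kernel of [M - l0], and this is exactly what makes the compression solvable. The spans have
    unbounded dimension, but the degree of the polynomial is bounded by [kappa] alone; this is why
    the coefficient sphere can be fixed in advance. Orbits enter only through their real moments
    [h(M^i x, x)]. [W] is the closure of [J (M0 - l0) + F]. Coercivity gives it closed range; dense
    range comes from a Schur complement argument, the only place where (I) or (II) matters, through
    their common consequence that [D] is the closure of its restriction to the domain of [B]. The
    form norm of [A] is carried to the whole space by [(A + c)^-1], which avoids completions, and
    eigenvector expansions of [A] are replaced by a finite net for the image of the unit ball under
    the resolvent. *)

Section ComplexFacts.
Context {R : realType}.
Implicit Types z w : R[i].
Local Notation Re := (@complex.Re R).
Local Notation Im := (@complex.Im R).

Lemma ReD z w : Re (z + w) = Re z + Re w. Proof. by case: z; case: w. Qed.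

Lemma ReN z : Re (- z) = - Re z. Proof. by case: z. Qed.

Lemma ReZ (r : R) z : Re (r%:C * z) = r * Re z.
Proof. by case: z => a b /=; rewrite mul0r subr0. Qed.

Lemma Re_sum (I : Type) (r : seq I) (P : pred I) (F : I -> R[i]) :
  Re (\sum_(i <- r | P i) F i) = \sum_(i <- r | P i) Re (F i).
Proof. exact: (big_morph _ ReD erefl). Qed.

Lemma Re_conj z : Re (Num.conj z) = Re z. Proof. by case: z. Qed.

Lemma normc_sqr z : normc z ^+ 2 = Re z ^+ 2 + Im z ^+ 2.
Proof. by case: z => a b /=; rewrite sqr_sqrtr // addr_ge0 // sqr_ge0. Qed.

Lemma mulcJ z : z * Num.conj z = (normc z ^+ 2)%:C.
Proof.
rewrite normc_sqr; case: z => a b /=.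
by apply/eqP; rewrite eq_complex /=; apply/andP; split; apply/eqP; ring.
Qed.

Lemma normr_normc z : `|z| = (normc z)%:C. Proof. by []. Qed.

Lemma normc_ge0 z : 0 <= normc z.
Proof. by case: z => a b /=; rewrite sqrtr_ge0. Qed.

Lemma Re_le_normc z : Re z <= normc z.
Proof.
case: z => a b /=; rewrite (le_trans (ler_norm a))// -sqrtr_sqr.
by rewrite ler_wsqrtr // lerDl sqr_ge0.
Qed.

Lemma normc_Re_le z : `|Re z| <= normc z.
Proof. by case: z => a b /=; rewrite -sqrtr_sqr ler_wsqrtr // lerDl sqr_ge0. Qed.

Lemma normc_Im_le z : `|Im z| <= normc z.
Proof. by case: z => a b /=; rewrite -sqrtr_sqr ler_wsqrtr // lerDr sqr_ge0. Qed.

Lemma normc_conj z : normc (Num.conj z) = normc z.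
Proof. by case: z => a b /=; rewrite sqrrN. Qed.

Lemma normc_real (r : R) : normc r%:C = `|r|.
Proof. by rewrite /= expr0n addr0 sqrtr_sqr. Qed.

Lemma normc_add z w : normc (z + w) <= normc z + normc w.
Proof. exact: le_normcD. Qed.

Lemma normc_opp z : normc (- z) = normc z. Proof. exact: normcN. Qed.

Lemma normc_sum (I : Type) (r : seq I) (P : pred I) (F : I -> R[i]) :
  normc (\sum_(i <- r | P i) F i) <= \sum_(i <- r | P i) normc (F i).
Proof.
elim/big_rec2: _ => [|i y x _ h]; first by rewrite normc0.
by rewrite (le_trans (normc_add _ _)) // lerD2l.
Qed.

Lemma complex_ge0 z : 0 <= z -> z = (Re z)%:C.
Proof. by move=> /ger0_Im; case: z => a b /= ->. Qed.

Lemma le0c_Re z : 0 <= z -> 0 <= Re z.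
Proof. by rewrite lecE => /andP[]. Qed.

Lemma conjR (r : R) : Num.conj r%:C = r%:C.
Proof. exact: conjc_real. Qed.

Lemma conjM z w : Num.conj (z * w) = Num.conj z * Num.conj w.
Proof. exact: rmorphM. Qed.

Lemma conjD z w : Num.conj (z + w) = Num.conj z + Num.conj w.
Proof. exact: rmorphD. Qed.

Lemma conjN z : Num.conj (- z) = - Num.conj z.
Proof. exact: rmorphN. Qed.

Lemma conjZ0 : Num.conj (0 : R[i]) = 0.
Proof. exact: rmorph0. Qed.

Lemma conj_sum (I : Type) (r : seq I) (P : pred I) (F : I -> R[i]) :
  Num.conj (\sum_(i <- r | P i) F i) = \sum_(i <- r | P i) Num.conj (F i).
Proof. exact: (big_morph _ conjD conjZ0). Qed.

Lemma conjK z : Num.conj (Num.conj z) = z.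
Proof. exact: conjcK. Qed.

Lemma conj_self z : Num.conj z = z -> z = (Re z)%:C.
Proof.
case: z => a b /= [] /eqP; rewrite eq_sym -subr_eq0 opprK => /eqP b0.
by congr Complex; lra.
Qed.

End ComplexFacts.

(** * Hermitian and nonnegative, possibly degenerate, forms *)

Section Forms.
Context {R : realType}.
Local Notation C := R[i].
Local Notation Re := (@complex.Re R).
Implicit Types V : lmodType C.

Record hermitian_sesq V (f : V -> V -> C) : Prop := HermitianSesq {
  sesqP : forall c x y z, f (c *: x + y) z = c * f x z + f y z;
  sesqC : forall x y, f y x = Num.conj (f x y) }.

Section Herm.
Variables (V : lmodType C) (f : V -> V -> C).
Hypothesis fh : hermitian_sesq f.

Lemma herm0l z : f 0 z = 0.
Proof.
have := sesqP fh 1 0 0 z; rewrite scaler0 addr0 mul1r => /eqP.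
by rewrite -subr_eq subrr eq_sym => /eqP.
Qed.

Lemma hermDl x y z : f (x + y) z = f x z + f y z.
Proof. by rewrite -[x in LHS]scale1r (sesqP fh) mul1r. Qed.

Lemma hermZl c x z : f (c *: x) z = c * f x z.
Proof. by rewrite -[c *: x]addr0 (sesqP fh) herm0l addr0. Qed.

Lemma hermNl x z : f (- x) z = - f x z.
Proof. by rewrite -scaleN1r hermZl mulN1r. Qed.

Lemma hermBl x y z : f (x - y) z = f x z - f y z.
Proof. by rewrite hermDl hermNl. Qed.

Lemma hermDr x y z : f z (x + y) = f z x + f z y.
Proof. by rewrite (sesqC fh (x + y)) hermDl conjD (sesqC fh x z) (sesqC fh y z). Qed.

Lemma hermZr c x z : f z (c *: x) = Num.conj c * f z x.
Proof. by rewrite (sesqC fh (c *: x)) hermZl conjM (sesqC fh x z). Qed.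

Lemma hermNr x z : f z (- x) = - f z x.
Proof. by rewrite (sesqC fh (- x)) hermNl conjN (sesqC fh x z). Qed.

Lemma hermBr x y z : f z (x - y) = f z x - f z y.
Proof. by rewrite hermDr hermNr. Qed.

Lemma herm0r z : f z 0 = 0.
Proof. by rewrite (sesqC fh 0) herm0l conjZ0. Qed.

Lemma herm_suml (I : Type) (r : seq I) (P : pred I) (F : I -> V) z :
  f (\sum_(i <- r | P i) F i) z = \sum_(i <- r | P i) f (F i) z.
Proof. by apply: (big_morph (fun x => f x z)) => [x y|]; rewrite ?hermDl ?herm0l. Qed.

Lemma herm_sumr (I : Type) (r : seq I) (P : pred I) (F : I -> V) z :
  f z (\sum_(i <- r | P i) F i) = \sum_(i <- r | P i) f z (F i).
Proof. by apply: (big_morph (f z)) => [x y|]; rewrite ?hermDr ?herm0r. Qed.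

Lemma Re_hermC x y : Re (f x y) = Re (f y x).
Proof. by rewrite (sesqC fh y x) Re_conj. Qed.

Lemma Re_hermD x y : Re (f (x + y) (x + y)) = Re (f x x) + 2 * Re (f x y) + Re (f y y).
Proof. by rewrite hermDl !hermDr !ReD (Re_hermC y x); ring. Qed.

Lemma Re_hermB x y : Re (f (x - y) (x - y)) = Re (f x x) - 2 * Re (f x y) + Re (f y y).
Proof. by rewrite Re_hermD hermNl !hermNr !ReN opprK; ring. Qed.

Lemma Re_hermZ c x : Re (f (c *: x) (c *: x)) = normc c ^+ 2 * Re (f x x).
Proof. by rewrite hermZl hermZr mulrA mulcJ ReZ. Qed.

End Herm.

Definition nm V (f : V -> V -> C) (x : V) : R := Num.sqrt (Re (f x x)).

Record nonneg_sesq V (f : V -> V -> C) : Prop := NonnegSesq {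
  nonneg_herm :> hermitian_sesq f;
  nonneg_ge0 : forall x, 0 <= Re (f x x) }.

Section Nonneg.
Variables (V : lmodType C) (f : V -> V -> C).
Hypothesis fp : nonneg_sesq f.
Let fh : hermitian_sesq f := fp.

Lemma nm_sqr x : nm f x ^+ 2 = Re (f x x).
Proof. by rewrite sqr_sqrtr // (nonneg_ge0 fp). Qed.

Lemma nm_ge0 x : 0 <= nm f x. Proof. exact: sqrtr_ge0. Qed.

Lemma cauchy_schwarz x y : normc (f x y) <= nm f x * nm f y.
Proof.
rewrite -ler_sqr ?nnegrE ?normc_ge0 ?mulr_ge0 ?nm_ge0 // exprMn !nm_sqr.
have key (s : R) : 0 <= Re (f x x) - 2 * s * normc (f x y) ^+ 2
    + s ^+ 2 * normc (f x y) ^+ 2 * Re (f y y).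
  have := nonneg_ge0 fp (x - (s%:C * f x y) *: y).
  rewrite (Re_hermB fh) (hermZr fh) conjM conjR -mulrA.
  rewrite [Num.conj (f x y) * _]mulrC mulcJ ReZ /=.
  by rewrite (Re_hermZ fh) normcM normc_real exprMn real_normK ?num_real // !mulrA.
have n1 := nonneg_ge0 fp x; have n2 := nonneg_ge0 fp y.
set F := normc _ ^+ 2 in key *; have F0 : 0 <= F by exact: sqr_ge0.
(* If [f y y] vanishes, [key] is affine in [s], and for nonzero [F] the [s] chosen here violates
   it. *)
have [y0|y0] := eqVneq (Re (f y y)) 0.
  rewrite y0 mulr0; rewrite leNgt; apply/negP => Fp.
  have := key ((Re (f x x) + 1) / F); rewrite y0 mulr0 addr0.
  rewrite -[X in _ - X]mulrA divfK ?gt_eqF //; lra.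
have yp : 0 < Re (f y y) by rewrite lt_def y0.
have := key (Re (f y y))^-1.
set n := Re (f y y) in yp y0 *.
have -> : n^-1 ^+ 2 * F * n = F / n by field.
rewrite -ler_pdivrMr //; have -> : 2 * n^-1 * F = 2 * (F / n) by ring.
lra.
Qed.

(** Cauchy-Schwarz and division by the norm of [x]. Coercivity of an operator thus becomes the norm
    bound from which surjectivity is derived. *)
Lemma form_lower_bound (delta : R) x y :
  delta * Re (f x x) <= Re (f y x) -> delta * nm f x <= nm f y.
Proof.
rewrite -nm_sqr => h.
have h2 := le_trans h (le_trans (Re_le_normc _) (cauchy_schwarz _ _)).
have [x0|x0] := eqVneq (nm f x) 0; first by rewrite x0 mulr0 nm_ge0.
have xp : 0 < nm f x by rewrite lt_def x0 nm_ge0.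
by move: h2; rewrite expr2 mulrA ler_pM2r.
Qed.

Lemma nmD x y : nm f (x + y) <= nm f x + nm f y.
Proof.
rewrite -ler_sqr ?nnegrE ?addr_ge0 ?nm_ge0 // nm_sqr (Re_hermD fh) sqrrD !nm_sqr.
by have := cauchy_schwarz x y; have := Re_le_normc (f x y); lra.
Qed.

Lemma nmZ c x : nm f (c *: x) = normc c * nm f x.
Proof. by rewrite /nm (Re_hermZ fh) sqrtrM ?sqr_ge0 // sqrtr_sqr ger0_norm ?normc_ge0. Qed.

Lemma nmN x : nm f (- x) = nm f x.
Proof. by rewrite /nm (hermNl fh) (hermNr fh) opprK. Qed.

Lemma nmB x y : nm f (x - y) = nm f (y - x).
Proof. by rewrite -opprB nmN. Qed.

Lemma nm0 : nm f 0 = 0.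
Proof. by rewrite /nm (herm0l fh) sqrtr0. Qed.

Lemma nm_triangle x y z : nm f (x - z) <= nm f (x - y) + nm f (y - z).
Proof. by rewrite (le_trans _ (nmD _ _)) // addrA subrK. Qed.

Lemma nm_sub_le x y : nm f x <= nm f (x - y) + nm f y.
Proof. by rewrite (le_trans _ (nmD _ _)) // subrK. Qed.

Lemma nm_sum (I : Type) (r : seq I) (P : pred I) (F : I -> V) :
  nm f (\sum_(i <- r | P i) F i) <= \sum_(i <- r | P i) nm f (F i).
Proof.
elim/big_rec2: _ => [|i y x _ h]; first by rewrite nm0.
by rewrite (le_trans (nmD _ _)) // lerD2l.
Qed.

End Nonneg.
End Forms.

(** * Symmetric matrices with finitely many negative squares *)

Section FinitePontryagin.
Variable C : numClosedFieldType.
Local Notation adj M := (map_mx Num.conj (trmx M)).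

(** Vectors are rows and operators act on the right: this is [x] times the product of the [S - a]
    over [s]. *)
Definition mxact n (S : 'M[C]_n) (s : seq C) (x : 'rV[C]_n) : 'rV[C]_n :=
  foldl (fun y a => y *m S - a *: y) x s.

Lemma adj_mul m n p (A : 'M[C]_(m, n)) (B : 'M[C]_(n, p)) :
  adj (A *m B) = adj B *m adj A.
Proof. by rewrite trmx_mul map_mxM. Qed.

Lemma adjD m n (A B : 'M[C]_(m, n)) : adj (A + B) = adj A + adj B.
Proof. by rewrite linearD map_mxD. Qed.

Lemma adjZ m n a (A : 'M[C]_(m, n)) : adj (a *: A) = Num.conj a *: adj A.
Proof. by rewrite linearZ map_mxZ. Qed.

Lemma adjK m n (A : 'M[C]_(m, n)) : adj (adj A) = A.
Proof. by apply/matrixP => i j; rewrite !mxE conjCK. Qed.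

Let hf n (H : 'M[C]_n) (x y : 'rV_n) : C := (x *m H *m adj y) 0 0.

Let hfC n (H : 'M[C]_n) x y : adj H = H -> hf H y x = Num.conj (hf H x y).
Proof.
move=> Hh; rewrite /hf -[RHS](_ : (adj (x *m H *m adj y)) 0 0 = _); last first.
  by rewrite !mxE.
by rewrite !adj_mul adjK Hh mulmxA.
Qed.

Let hfDl n (H : 'M[C]_n) x y z : hf H (x + y) z = hf H x z + hf H y z.
Proof. by rewrite /hf !mulmxDl mxE. Qed.

Let hfZl n (H : 'M[C]_n) a x z : hf H (a *: x) z = a * hf H x z.
Proof. by rewrite /hf -!scalemxAl mxE. Qed.

Let hfDr n (H : 'M[C]_n) x y z : hf H z (x + y) = hf H z x + hf H z y.
Proof. by rewrite /hf adjD mulmxDr mxE. Qed.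

Let hfZr n (H : 'M[C]_n) a x z : hf H z (a *: x) = Num.conj a * hf H z x.
Proof. by rewrite /hf adjZ -scalemxAr mxE. Qed.

Let hf_sub n (H : 'M[C]_n) m (W : 'M[C]_(m, n)) x y :
  hf H (x *m W) (y *m W) = hf (W *m H *m adj W) x y.
Proof. by rewrite /hf adj_mul !mulmxA. Qed.

(* Splitting off an eigenvector [v] with [<v, v> >= 0]. *)
Let split_case n (H S : 'M[C]_n) (v : 'rV_n) (lam : C) m (W : 'M[C]_(m, n)) :
  adj H = H -> S *m H = H *m adj S -> v *m S = lam *: v -> 0 <= hf H v v ->
  v *m H *m adj W = 0 -> row_full (v + W)%MS ->
  forall k p (L : 'M[C]_(p, n)), (n <= \rank L + k)%N -> \rank W = m ->
  (forall x : 'rV_n, (x <= L)%MS -> 0 <= hf H x x) ->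
  exists S' : 'M[C]_m, let H' := W *m H *m adj W in
  [/\ adj H' = H', S' *m H' = H' *m adj S',
    exists p' (L' : 'M[C]_(p', m)), (m <= \rank L' + k)%N /\
      forall x : 'rV_m, (x <= L')%MS -> 0 <= hf H' x x &
    forall s, (forall x, 0 <= hf H' (mxact S' s x) (mxact S' s x)) ->
      forall x, 0 <= hf H (mxact S s x) (mxact S s x)].
Proof.
move=> Hh SH vS v0 vW full k p L nL rW Lp.
have dec q (A : 'M[C]_(q, n)) : exists c, A = c.1 *m v + c.2 *m W.
  by apply/sub_addsmxP; rewrite submx_full.
have Wv : W *m H *m adj v = 0.
  have : adj (v *m H *m adj W) = 0 by rewrite vW trmx0 map_mx0.
  by rewrite !adj_mul adjK Hh mulmxA.
have [[c S'] /= WS] := dec _ (W *m S).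
exists S'; set H' := W *m H *m adj W; split.
- by rewrite /H' !adj_mul adjK Hh mulmxA.
- have -> : S' *m H' = W *m S *m H *m adj W.
    rewrite WS /H' !mulmxDl !mulmxA [X in X + _](_ : _ = 0) ?add0r //.
    by rewrite -!mulmxA [v *m _]mulmxA vW mulmx0.
  rewrite -[W *m S *m H]mulmxA SH /H' mulmxA -[W *m H *m adj S *m _]mulmxA.
  rewrite -adj_mul WS adjD adj_mul mulmxDr mulmxA Wv mul0mx add0r adj_mul.
  by rewrite !mulmxA.
(* Coordinates of the part of [L] inside [W]; cutting with [W] does not increase the codimension. *)
- exists _, ((L :&: W)%MS *m pinvmx W).
  have e : (L :&: W)%MS *m pinvmx W *m W = (L :&: W)%MS.
    by rewrite mulmxKpV // capmxSr.
  split.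
    have := mxrank_sum_cap L W; have := rank_leq_col (L + W)%MS.
    have := mxrankM_maxl ((L :&: W)%MS *m pinvmx W) W; rewrite e rW; lia.
  move=> x xL; rewrite -hf_sub; apply: Lp.
  by rewrite (submx_trans (submxMr _ xL)) // e capmxSl.
move=> s hs x.
have [[a y] /= ->] := dec _ x.
(* The value of [b] is irrelevant: [v] spans an invariant line orthogonal to [W] and contributes the
   nonnegative term [|b|^2 <v, v>]. *)
have mxact_split (a' : 'M[C]_1) (y' : 'rV_m) :
    exists b : 'M[C]_1, mxact S s (a' *m v + y' *m W) = b *m v + mxact S' s y' *m W.
  elim: s {hs} a' y' => [|t s IH] a' y' /=; first by exists a'.
  have := IH (lam *: a' + y' *m c - t *: a') (y' *m S' - t *: y').
  move=> [b bE]; exists b; apply: etrans bE; rewrite /mxact /=; congr foldl.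
  rewrite !mulmxDl -!mulmxA vS WS !(mulmxDr, mulNmx, scalerDr, opprD, mulmxA).
  rewrite -!scalemxAl -!scalemxAr.
  apply/matrixP => i j; rewrite !mxE; ring.
have [b ->] := mxact_split a y.
rewrite (mx11_scalar b) mul_scalar_mx.
rewrite hfDl !hfDr !hfZl !hfZr hf_sub -/H'.
have -> : hf H v (mxact S' s y *m W) = 0.
  by rewrite /hf adj_mul mulmxA vW mul0mx mxE.
have -> : hf H (mxact S' s y *m W) v = 0.
  by rewrite /hf -!mulmxA [W *m _]mulmxA Wv mulmx0 mxE.
by rewrite !mulr0 addr0 add0r addr_ge0 // mulrA mulr_ge0 // mul_conjC_ge0.
Qed.

(* An eigenvector [v] with [<v, v> <= 0] lowers the number of negative squares
   on its orthogonal complement, which contains the range of [S - conj lam]. *)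
Let drop_case n (H S : 'M[C]_n) (v : 'rV_n) (lam : C) m (W : 'M[C]_(m, n)) :
  adj H = H -> S *m H = H *m adj S -> v *m S = lam *: v -> hf H v v <= 0 ->
  v != 0 -> (W :=: kermx (H *m adj v))%MS -> \rank W = m -> n = m.+1 ->
  forall p (L : 'M[C]_(p, n)),
  (forall x : 'rV_n, (x <= L)%MS -> 0 <= hf H x x) ->
  exists S' : 'M[C]_m, let H' := W *m H *m adj W in
  [/\ adj H' = H', S' *m H' = H' *m adj S',
    exists p' (L' : 'M[C]_(p', m)), (\rank L <= \rank L')%N /\
      forall x : 'rV_m, (x <= L')%MS -> 0 <= hf H' x x &
    forall s, (forall x, 0 <= hf H' (mxact S' s x) (mxact S' s x)) ->
      forall x, 0 <= hf H (mxact S (Num.conj lam :: s) x)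
                          (mxact S (Num.conj lam :: s) x)].
Proof.
move=> Hh SH vS v0 vn0 Wker rW nm p L Lp.
have Wv x : (x <= W)%MS -> hf H x v = 0.
  rewrite Wker => /sub_kermxP; rewrite mulmxA => h.
  by rewrite /hf h mxE.
have vW x : hf H x v = 0 -> (x <= W)%MS.
  move=> h; rewrite Wker; apply/sub_kermxP; rewrite mulmxA.
  by apply/matrixP => i j; rewrite !ord1 [LHS]h mxE.
have WSW : (W *m S <= W)%MS.
  rewrite Wker; apply/sub_kermxP.
  rewrite -mulmxA [S *m _]mulmxA SH -[H *m _ *m _]mulmxA -adj_mul vS adjZ.
  by rewrite -!scalemxAr; have /sub_kermxP -> : (W <= kermx (H *m adj v))%MS;
    rewrite ?Wker ?scaler0.
pose S' := W *m S *m pinvmx W.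
have WS : W *m S = S' *m W by rewrite mulmxKpV.
exists S'; set H' := W *m H *m adj W; split.
- by rewrite /H' !adj_mul adjK Hh mulmxA.
- rewrite /H' !mulmxA -WS -[W *m S *m H]mulmxA SH mulmxA -[W *m H *m adj S *m _]mulmxA.
  by rewrite -adj_mul WS adj_mul !mulmxA.
(* Adding [v] before cutting with the hyperplane [W] keeps the dimension. If [v] already lies in
   [L], it is neutral and [L] is contained in [W]. *)
- exists _, (((L + v) :&: W)%MS *m pinvmx W).
  have e : ((L + v) :&: W)%MS *m pinvmx W *m W = ((L + v) :&: W)%MS.
    by rewrite mulmxKpV // capmxSr.
  split.
    have rk := mxrankM_maxl (((L + v) :&: W)%MS *m pinvmx W) W; rewrite e in rk.
    rewrite (leq_trans _ rk) //.
    have [vL|vL] := boolP (v <= L)%MS; last first.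
      have := mxrank_sum_cap (L + v)%MS W; have := rank_leq_col (L + v + W)%MS.
      have : (\rank L < \rank (L + v))%N.
        by apply: rank_ltmx; rewrite ltmxE addsmxSl /= addsmx_sub submx_refl.
      rewrite rW; move: nm; lia.
    suff LW : (L <= W)%MS by apply: mxrankS; rewrite sub_capmx addsmxSl.
    have hv : hf H v v = 0 by apply/le_anti; rewrite v0 Lp.
    apply/row_subP => i; apply: vW; set l := row i L.
    have lL : (l <= L)%MS by rewrite row_sub.
    apply/eqP/negPn/negP => h0.
    (* For neutral [v] not orthogonal to [l], this [t] gives the vector [l - t h v] of [L] the form
       value -1. *)
    pose h := hf H l v; pose t := (hf H l l + 1) / (2 * (h * Num.conj h)).
    have hp : 0 < h * Num.conj h by rewrite -normCK exprn_gt0 // normr_gt0.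
    have t0 : Num.conj t = t.
      apply/CrealP; rewrite realE divr_ge0 // ?addr_ge0 ?Lp //.
      by rewrite mulr_ge0 // ltW.
    have := Lp (l - (t * h) *: v) _; rewrite addmx_sub ?eqmx_opp ?scalemx_sub //.
    move=> /(_ isT); rewrite -scaleNr hfDl !hfDr !hfZl !hfZr hv !mulr0 addr0.
    rewrite (hfC l v Hh) -/h rmorphN /= rmorphM /= t0.
    have -> : hf H l l + - (t * Num.conj h) * h + - (t * h) * Num.conj h
        = hf H l l - t * (2 * (h * Num.conj h)) by ring.
    rewrite divfK; last by rewrite gt_eqF // (mulr_gt0 _ hp) ?ltr0n.
    have -> : hf H l l - (hf H l l + 1) = - 1 by ring.
    by rewrite oppr_ge0 ler10.
  (* Here [y = l + b v] is orthogonal to [v], so [0 <= <l, l> = <y, y> + |b|^2 <v, v> <= <y, y>]. *)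
  move=> x xL; rewrite -hf_sub; set y := x *m W.
  have : (y <= (L + v) :&: W)%MS by rewrite -e submxMr.
  rewrite sub_capmx => /andP[/sub_addsmxP [[l b] /= yE] /Wv yv].
  have vy : hf H v y = 0 by rewrite (hfC y v Hh) yv rmorph0.
  have : (y - b *m v <= L)%MS by rewrite yE addrK submxMl.
  rewrite (mx11_scalar b) mul_scalar_mx -scaleNr => /Lp.
  rewrite hfDl !hfDr !hfZl !hfZr yv vy !mulr0 addr0 add0r.
  move=> /le_trans; apply; rewrite mulrA rmorphN /= mulrNN gerDl.
  by rewrite mulr_ge0_le0 // mul_conjC_ge0.
move=> s hs x /=; set y := _ - _.
have : (y <= W)%MS.
  apply: vW; rewrite /y -scaleNr hfDl hfZl mulNr.
  have -> : hf H (x *m S) v = Num.conj lam * hf H x v; last by rewrite subrr.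
  by rewrite -hfZr -vS /hf adj_mul !mulmxA -[x *m S *m H]mulmxA SH mulmxA.
move=> /submxP[z ->].
have -> : mxact S s (z *m W) = mxact S' s z *m W; last by rewrite hf_sub.
elim: s z {hs} => [//|t s IH] z /=; rewrite -IH /mxact /=; congr foldl.
by rewrite mulmxBl -mulmxA WS -scalemxAl mulmxA.
Qed.

(** Induction on the dimension through an eigenvector [v] of [S]. If [v] is in the radical of [H] or
    [<v, v> > 0], it splits off at no cost; otherwise passing to its orthogonal complement costs one
    linear factor and lowers [k] by one. *)
Lemma finite_pontryagin n k p (H S : 'M[C]_n) (L : 'M[C]_(p, n)) :
  adj H = H -> S *m H = H *m adj S -> (n <= \rank L + k)%N ->
  (forall x : 'rV_n, (x <= L)%MS -> 0 <= (x *m H *m adj x) 0 0) ->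
  exists2 s : seq C, (size s <= k)%N &
    forall x, 0 <= (mxact S s x *m H *m adj (mxact S s x)) 0 0.
Proof.
have [N] := ubnP n; elim: N n k p H S L => // N IH n k p H S L nN Hh SH nL Lp.
have [n0|n0] := posnP n.
  by subst n; exists [::] => // x; rewrite (thinmx0 x) !mul0mx mxE.
have [lam /eigenvalueP [v vS vn0]] : exists a, eigenvalue S a.
  have /closed_rootP[a] : size (char_poly S) != 1 by rewrite size_char_poly eqSS -lt0n.
  by rewrite -eigenvalue_root_char => ?; exists a.
have rv : \rank v = 1%N by rewrite rank_rV vn0.
have split_ind (W0 : 'M[C]_n) : 0 <= hf H v v -> v *m H *m adj W0 = 0 ->
    row_full (v + W0)%MS -> (\rank W0 < n)%N -> exists2 s : seq C, (size s <= k)%N &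
    forall x, 0 <= (mxact S s x *m H *m adj (mxact S s x)) 0 0.
  move=> v0 vW full rW.
  have vW' : v *m H *m adj (row_base W0) = 0.
    have /submxP[Z ->] : (row_base W0 <= W0)%MS by rewrite eq_row_base.
    by rewrite adj_mul mulmxA vW mul0mx.
  have full' : row_full (v + row_base W0)%MS.
    by rewrite -sub1mx (submx_trans (submx_full _ full)) // addsmxS ?eq_row_base.
  have rWb : \rank (row_base W0) = \rank W0 by rewrite eq_row_base.
  have [S' [H'h S'H' [p' [L' [mL Lp']]] tr]] :=
    split_case Hh SH vS v0 vW' full' nL rWb Lp.
  have [|s ss sp] := IH _ k p' _ _ _ _ H'h S'H' mL Lp'; first by lia.
  by exists s => //; apply: tr.
have [vH|vH] := eqVneq (v *m H) 0.
  apply: (split_ind (v^C)%MS).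
  - by rewrite /hf vH mul0mx mxE.
  - by rewrite vH mul0mx.
  - exact: addsmx_compl_full.
  - by rewrite mxrank_compl rv; lia.
have Hv : H *m adj v != 0.
  apply: contra vH => /eqP h; have : adj (H *m adj v) = 0 by rewrite h trmx0 map_mx0.
  by rewrite adj_mul adjK Hh => ->.
have rHv : \rank (H *m adj v) = 1%N.
  by apply/eqP; rewrite eqn_leq rank_leq_col lt0n mxrank_eq0.
have rK : \rank (kermx (H *m adj v)) = n.-1 by rewrite mxrank_ker rHv subn1.
have vvE : hf H v v = Num.conj (hf H v v) by apply: hfC.
have [v0|v0] : 0 < hf H v v \/ hf H v v <= 0.
  have : hf H v v \is Num.real by apply/CrealP; rewrite -vvE.
  by rewrite realE le_eqVlt eq_sym => /orP[/orP[/eqP->|]|]; auto.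
- apply: (split_ind (kermx (H *m adj v))).
  + exact: ltW.
  + rewrite -[LHS]adjK [adj (_ *m _ *m _)](_ : _ = 0) ?trmx0 ?map_mx0 //.
    move: (mulmx_ker (H *m adj v)); move: (kermx _) => K KH.
    by rewrite !adj_mul adjK Hh.
  + rewrite -col_leq_rank.
    have vK : \rank (v :&: kermx (H *m adj v))%MS = 0%N.
      apply/eqP; rewrite mxrank_eq0 -submx0; apply/rV_subP => u.
      rewrite sub_capmx => /andP[/sub_rVP[a ->] /sub_kermxP h]; rewrite submx0.
      have := congr1 (fun M : 'M[C]_1 => M 0 0) h; rewrite mulmxA -[LHS]/(hf H _ _) hfZl mxE.
      by move=> /eqP; rewrite mulf_eq0 (gt_eqF v0) orbF => /eqP ->; rewrite scale0r.
    have := mxrank_sum_cap v (kermx (H *m adj v)); rewrite vK rv rK; lia.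
  + by rewrite rK; lia.
have rW : \rank (row_base (kermx (H *m adj v))) = \rank (kermx (H *m adj v)).
  by rewrite eq_row_base.
have [|S' [H'h S'H' [p' [L' [mL Lp']]] tr]] :=
    drop_case Hh SH vS v0 vn0 (eq_row_base _) rW _ Lp.
  by rewrite rK; lia.
have rL' := rank_leq_col L'.
(* For [k = 0] the subspace [L] is the whole space, which is too large for the rank of [L'] in
   dimension [n - 1]. *)
case: k nL {split_ind} => [|k] nL.
  by have := leq_trans mL rL'; rewrite rK -ltnS prednK // ltnNge; rewrite addn0 in nL; rewrite nL.
have [||s ss sp] := IH _ k p' _ _ _ _ H'h S'H' _ Lp'.
- by rewrite rK; lia.
- by rewrite [leqLHS]rK -ltnS prednK // -addnS (leq_trans nL) // leq_add2r.
by exists (Num.conj lam :: s) => //; apply: tr.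
Qed.

End FinitePontryagin.

(** * Definitising polynomials *)

Section Chains.
Context {R : realType}.
Local Notation C := R[i].
Local Notation Re := (@complex.Re R).
Local Notation adj M := (map_mx Num.conj (trmx M)).
Variable V : lmodType C.
Variables (k f : V -> V -> C) (M : set (V * V)) (l0 : R).
Hypotheses (kh : hermitian_sesq k) (fh : hermitian_sesq f).
Hypothesis Msub : Defs.subspace M.
Hypothesis Mfun : forall y, M (0, y) -> y = 0.
Hypothesis Msym : forall x y x' y', M (x, y) -> M (x', y') -> k y x' = k x y'.

Lemma subspace0 : M (0, 0). Proof. by have [h _] := Msub. Qed.

Lemma subspace_lin c x y x' y' :
  M (x, y) -> M (x', y') -> M (c *: x + x', c *: y + y').
Proof. by move=> h h'; have [_ h2] := Msub; exact: (h2 c _ _ h h'). Qed.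

Lemma subspace_sub x y x' y' : M (x, y) -> M (x', y') -> M (x - x', y - y').
Proof.
move=> h h'; have := subspace_lin (-1) h' h.
by rewrite !scaleN1r ![- _ + _]addrC.
Qed.

Lemma subspace_scale c x y : M (x, y) -> M (c *: x, c *: y).
Proof. by move=> h; have := subspace_lin c h subspace0; rewrite !addr0. Qed.

Lemma subspace_sum n (c : 'I_n -> C) (x y : 'I_n -> V) :
  (forall i, M (x i, y i)) -> M (\sum_i c i *: x i, \sum_i c i *: y i).
Proof.
move=> h; elim/big_rec2: _ => [|i a b _ ab]; first exact: subspace0.
exact: subspace_lin.
Qed.

Lemma graph_unique x y y' : M (x, y) -> M (x, y') -> y = y'.
Proof.
by move=> h h'; have := subspace_sub h h'; rewrite subrr => /Mfun/subr0_eq.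
Qed.

(* [moment u i = [(M - l0) M^i x, x]] for the orbit [u i = M^i x] of [x]. *)
Definition moment (u : nat -> V) (i : nat) : R :=
  Re (k (u i.+1 - l0%:C *: u i) (u 0%N)).

Definition chain (n : nat) (u : nat -> V) : Prop :=
  forall i, (i < n)%N -> M (u i, u i.+1).

Definition shift_chain (a : C) (u : nat -> V) (i : nat) : V := u i.+1 - a *: u i.

Definition shift_chains (s : seq C) (u : nat -> V) : nat -> V :=
  foldl (fun w a => shift_chain a w) u s.

Lemma chain_shift a n u : chain n.+1 u -> chain n (shift_chain a u).
Proof.
move=> h i ni; apply: subspace_sub; first exact: h.
by apply: subspace_scale; apply: h; rewrite ltnS ltnW.
Qed.

Lemma Msym_shift x y x' y' : M (x, y) -> M (x', y') ->
  k (y - l0%:C *: x) x' = k x (y' - l0%:C *: x').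
Proof.
move=> h h'; rewrite (hermBl kh) (hermBr kh) (hermZl kh) (hermZr kh) conjR.
by rewrite (Msym h h').
Qed.

Lemma chain_sym n u i j : chain n u -> (i + j < n)%N ->
  k (u i.+1 - l0%:C *: u i) (u j) =
  k (u (i + j).+1 - l0%:C *: u (i + j)%N) (u 0%N).
Proof.
elim: j i => [|j IH] i h ij; first by rewrite addn0.
rewrite addnS -addSn -IH //; last by rewrite addSn -addnS.
have hi : M (u i, u i.+1) by apply: h; lia.
have hi1 : M (u i.+1, u i.+2) by apply: h; lia.
have hj : M (u j, u j.+1) by apply: h; lia.
rewrite (hermBl kh) (hermZl kh) (hermBl kh) (hermZl kh) -(Msym hi1 hj).
by rewrite -(Msym hi hj).
Qed.

(** Symmetry of [M] turns [h((M - a) M^i x, (M - a) x)] into moments of [x], all real, weighted by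
    the coefficients of [(X - a) (X - conj a)]. *)
Lemma moment_shift a n u i : chain n u -> (i.+2 < n)%N ->
  moment (shift_chain a u) i = moment u i.+2 - 2 * Re a * moment u i.+1
     + normc a ^+ 2 * moment u i.
Proof.
move=> h hi.
pose T j := u j.+1 - l0%:C *: u j.
have e j : shift_chain a u j.+1 - l0%:C *: shift_chain a u j = T j.+1 - a *: T j.
  rewrite /shift_chain /T !scalerBr !scalerA [a * _]mulrC !opprB !addrA.
  by rewrite addrAC [in RHS]addrAC; congr (_ + _); rewrite addrAC.
have r j : (j < n)%N -> k (T j) (u 0%N) = (moment u j)%:C.
  move=> jn; apply: conj_self.
  have h0 : M (u 0%N, u 1%N) by apply: h; lia.
  have hj : M (u j, u j.+1) by apply: h.
  rewrite -(sesqC kh) /T -(Msym_shift h0 hj).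
  by rewrite (chain_sym (i := 0) (j := j) h).
have r2 : k (T i.+1) (u 1%N) = (moment u i.+2)%:C.
  by rewrite -r // /T (chain_sym h) ?addn1.
have r1 : k (T i) (u 1%N) = (moment u i.+1)%:C.
  by rewrite -r ?(ltnW hi) // /T (chain_sym h) ?addn1 // ltnW.
have r1' : k (T i.+1) (u 0%N) = (moment u i.+1)%:C by rewrite r // ltnW.
have r0 : k (T i) (u 0%N) = (moment u i)%:C by rewrite r // ltnW // ltnW.
rewrite {1}/moment e; move: T {e r} r2 r1 r1' r0 => T r2 r1 r1' r0.
rewrite /shift_chain (hermBr kh) !(hermBl kh) !(hermZr kh) !(hermZl kh).
rewrite r2 r1 r1' r0; case: a => a b; rewrite normc_sqr /=; ring.
Qed.

(** The linear functional on polynomials sending [X^i] to [mu i]. For [moment u] it is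
    [p |-> h(p(M) x, x)]. *)
Definition Lambda (mu : nat -> R) (p : {poly R}) : R :=
  \sum_(i < size p) p`_i * mu i.

Lemma LambdaE mu (p : {poly R}) n : (size p <= n)%N -> Lambda mu p = \sum_(i < n) p`_i * mu i.
Proof.
move=> pn; rewrite /Lambda (big_ord_widen n (fun i => p`_i * mu i) pn) big_mkcond /=.
by apply: eq_bigr => i _; case: ltnP => // pi; rewrite nth_default // mul0r.
Qed.

(* [quad a = (X - a) (X - conj a)] has real coefficients. *)
Definition quad (a : C) : {poly R} := 'X^2 - (2 * Re a) *: 'X + (normc a ^+ 2)%:P.

Lemma size_quad a : size (quad a) = 3%N.
Proof.
rewrite /quad -addrA size_polyDl ?size_polyXn // (leq_ltn_trans (size_polyD _ _)) //.
rewrite gtn_max size_polyN (leq_ltn_trans (size_scale_leq _ _)) ?size_polyX //=.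
by rewrite (leq_ltn_trans (size_polyC_leq1 _)).
Qed.

Lemma quad_monic a : quad a \is monic.
Proof.
rewrite monicE /lead_coef size_quad /quad !coefE /=.
by rewrite mulr0 subr0 addr0.
Qed.

Definition quads (s : seq C) : {poly R} := \prod_(a <- s) quad a.

Lemma quads_monic s : quads s \is monic.
Proof. by apply: monic_prod => a _; exact: quad_monic. Qed.

Lemma size_quads s : size (quads s) = (2 * size s).+1.
Proof.
elim: s => [|a s IH]; rewrite /quads ?big_nil ?size_poly1 // big_cons.
rewrite size_monicM ?quad_monic ?monic_neq0 ?quads_monic // -/(quads s) IH size_quad /=.
by lia.
Qed.

Lemma Lambda_quad a mu (p : {poly R}) :
  Lambda mu (quad a * p) =
  Lambda (fun i => mu i.+2 - 2 * Re a * mu i.+1 + normc a ^+ 2 * mu i) p.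
Proof.
rewrite (@LambdaE _ _ (size p).+2); last first.
  by rewrite (leq_trans (size_polyMleq _ _)) // size_quad.
have c i : (quad a * p)`_i = ('X^2 * p)`_i - 2 * Re a * ('X * p)`_i
    + normc a ^+ 2 * p`_i.
  by rewrite /quad mulrDl mulrBl -scalerAl coefD coefB coefZ coefCM.
rewrite (eq_bigr (fun i : 'I_(size p).+2 => ('X^2 * p)`_i * mu i
   - 2 * Re a * (('X * p)`_i * mu i) + normc a ^+ 2 * (p`_i * mu i))); last first.
  by move=> i _; rewrite c; ring.
rewrite big_split sumrB -!mulr_sumr /= /Lambda.
rewrite [X in X - _ + _](_ : _ = \sum_(i < size p) p`_i * mu i.+2); last first.
  rewrite 2!big_ord_recl !coefXnM /= !mul0r !add0r; apply: eq_bigr => i _.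
  by rewrite coefXnM /= subn2.
rewrite [X in _ - _ * X](_ : _ = \sum_(i < size p) p`_i * mu i.+1); last first.
  rewrite big_ord_recl big_ord_recr /= !coefXM /= mul0r add0r nth_default // mul0r addr0.
  by apply: eq_bigr => i _; rewrite coefXM.
rewrite [X in _ + _ * X](_ : _ = \sum_(i < size p) p`_i * mu i); last first.
  rewrite 2!big_ord_recr /= ![p`_(_)]nth_default ?leqnSn // !mul0r !addr0 //.
rewrite !mulr_sumr -sumrB -big_split; apply: eq_bigr => i _ /=; ring.
Qed.

(** With [q] the product of the [X - a] over [s], the left side is [h(q(M) x, q(M) x)], while the
    right side is linear in the coefficients of [q conj q], as the compactness argument needs. *)
Lemma Lambda_shift s n u : chain n u -> (2 * size s < n)%N ->
  moment (shift_chains s u) 0 = Lambda (moment u) (quads s).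
Proof.
elim: s n u => [|a s IH] n u h hn.
  by rewrite /quads big_nil /Lambda size_poly1 big_ord1 coef1 mul1r.
rewrite [quads _]big_cons -/(quads s) Lambda_quad /=.
have h' : chain n.-1 (shift_chain a u) by apply: chain_shift; rewrite prednK //; lia.
rewrite (IH n.-1) //; last by move: hn; rewrite /=; lia.
rewrite /Lambda; apply: eq_bigr => -[i ip] _ /=; congr (_ * _).
apply: moment_shift h _; move: ip hn; rewrite size_quads /=; lia.
Qed.

Variables (kappa : nat) (e : 'I_kappa -> V) (g g' : 'I_kappa -> V) (delta : R).
Hypothesis delta0 : 0 < delta.
Hypothesis pos : forall x y, M (x, y) -> delta * Re (f x x) <=
  Re (k (y - l0%:C *: x) x) + \sum_l normc (f x (e l)) ^+ 2.
Hypothesis fdef : forall x, Re (f x x) = 0 -> x = 0.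
Hypothesis fge0 : forall x, 0 <= Re (f x x).
Hypothesis gM : forall l, M (g l, g' l).
(** The equation [W (g l) = e l] paired with [z], with [W = J (M - l0) + F] written out. *)
Hypothesis gW : forall l z, f z (e l) =
  k z (g' l - l0%:C *: g l) + \sum_j f z (e j) * Num.conj (f (g l) (e j)).

(* A vector of a subspace containing the [g l] that is orthogonal to it for
   [<(M - l0) . , . >] is in the kernel of [M - l0]. *)
Lemma radical_kernel n (E E' : 'I_n -> V) (c : 'I_n -> C) :
  (forall i, M (E i, E' i)) -> (forall l, exists i, E i = g l) ->
  forall t, t = \sum_i c i *: E' i - l0%:C *: (\sum_i c i *: E i) ->
  (forall i, k (E i) t = 0) -> forall z, k z t = 0.
Proof.
move=> EM gE t td tE.
pose x := \sum_i c i *: E i; pose x' := \sum_i c i *: E' i.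
have xM : M (x, x') by exact: subspace_sum.
pose al l := f x (e l).
(* [y = x - W^-1 F x], hence [W y = J (M - l0) x = J t]. As [y] stays in the span, [<W y, y> = 0],
   and positivity of [W] gives [y = 0]. *)
pose y := x - \sum_l al l *: g l; pose y' := x' - \sum_l al l *: g' l.
have yM : M (y, y') by apply: subspace_sub xM _; exact: subspace_sum.
have key z : k z t = k z (y' - l0%:C *: y) + \sum_j f z (e j) * Num.conj (f y (e j)).
  have -> : y' - l0%:C *: y = t - \sum_l al l *: (g' l - l0%:C *: g l).
    have -> : \sum_l al l *: (g' l - l0%:C *: g l) =
        \sum_l al l *: g' l - l0%:C *: \sum_l al l *: g l.
      rewrite scaler_sumr -sumrB; apply: eq_bigr => l _.
      by rewrite scalerBr !scalerA mulrC.
    rewrite /y' /y td -/x -/x' scalerBr !opprB addrACA [RHS]addrACA.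
    by congr (_ + _); exact: addrC.
  have gW' l : k z (al l *: (g' l - l0%:C *: g l)) = f z (e l) * Num.conj (al l)
      - \sum_j f z (e j) * (Num.conj (al l) * Num.conj (f (g l) (e j))).
    rewrite (hermZr kh); have := gW l z => /eqP; rewrite -subr_eq => /eqP <-.
    rewrite mulrBr mulrC mulr_sumr; congr (_ - _); apply: eq_bigr => j _.
    by rewrite mulrCA.
  rewrite (hermBr kh) (herm_sumr kh) -addrA -[LHS]addr0; congr (_ + _).
  apply/eqP; rewrite eq_sym addrC subr_eq0; apply/eqP.
  under [RHS]eq_bigr => l _ do rewrite gW'.
  rewrite sumrB exchange_big /= -sumrB; apply: eq_bigr => j _.
  rewrite -mulr_sumr -mulrBr; congr (_ * _).
  rewrite /y (hermBl fh) conjD conjN; congr (_ - _).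
  rewrite (herm_suml fh) conj_sum; apply: eq_bigr => l _.
  by rewrite (hermZl fh) conjM.
have yt : k y t = 0.
  rewrite /y (hermBl kh) (herm_suml kh) /x (herm_suml kh).
  rewrite !big1 ?subrr // => i _; rewrite (hermZl kh).
    by have [j <-] := gE i; rewrite tE mulr0.
  by rewrite tE mulr0.
have y0 : y = 0.
  apply: fdef; apply/le_anti; rewrite fge0 andbT -(pmulr_rle0 _ delta0).
  rewrite (le_trans (pos yM)) // (Re_hermC kh).
  have := congr1 Re (key y); rewrite yt ReD Re_sum => h; rewrite [leRHS]h.
  by rewrite lerD2l; apply: ler_sum => j _; rewrite mulcJ.
have y'0 : y' = 0 by apply: Mfun; rewrite -y0.
move=> z; rewrite key y0 y'0 scaler0 subr0 (herm0r kh) add0r.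
by rewrite big1 // => j _; rewrite (herm0l fh) conjZ0 mulr0.
Qed.

(** * Compression to a finite dimensional span *)

Section Compression.
Variables (n : nat) (E E' : 'I_n -> V).
Hypothesis EM : forall i, M (E i, E' i).
Hypothesis gE : forall l, exists i, E i = g l.

Let comb (F : 'I_n -> V) (x : 'rV[C]_n) := \sum_i x 0 i *: F i.
Let t i := E' i - l0%:C *: E i.
Let H : 'M[C]_n := \matrix_(i, j) k (t i) (E j).
(** The form [h(M E_i, E_j)], with [M - l0] on the other argument because [E' i] need not lie in the
    domain of [M]. *)
Let K : 'M[C]_n := \matrix_(i, j) k (E' i) (t j).

Let combM x : M (comb E x, comb E' x).
Proof. exact: subspace_sum. Qed.

Let comb_t x : comb t x = comb E' x - l0%:C *: comb E x.
Proof.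
rewrite /comb scaler_sumr -sumrB; apply: eq_bigr => i _.
by rewrite scalerBr !scalerA mulrC.
Qed.

Let rowH (x : 'rV_n) j : (x *m H) 0 j = k (comb t x) (E j).
Proof.
rewrite mxE /comb (herm_suml kh); apply: eq_bigr => i _.
by rewrite mxE (hermZl kh).
Qed.

Let rowK (x : 'rV_n) j : (x *m K) 0 j = k (comb E' x) (t j).
Proof.
rewrite mxE /comb (herm_suml kh); apply: eq_bigr => i _.
by rewrite mxE (hermZl kh).
Qed.

Let formH (x y : 'rV_n) : (x *m H *m adj y) 0 0 = k (comb t x) (comb E y).
Proof.
rewrite mxE /comb (herm_sumr kh); apply: eq_bigr => j _.
by rewrite rowH !mxE (hermZr kh) mulrC.
Qed.

Let adjH : adj H = H.
Proof.
apply/matrixP => i j; rewrite !mxE -(sesqC kh).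
by rewrite /t (Msym_shift (EM i) (EM j)).
Qed.

Let adj_K : adj K = K.
Proof.
apply/matrixP => i j; rewrite !mxE -(sesqC kh) /t.
rewrite (hermBl kh) (hermBr kh) (hermZl kh) (hermZr kh) conjR.
by rewrite (Msym (EM i) (EM j)).
Qed.

(** A compression must satisfy [h(S x, y) = h(M x, y)], that is [S H = K], where [H] may be
    singular. By [radical_kernel], a null vector of [H] comes from a vector killed by [M - l0],
    hence is a null vector of [K]. *)
Let solve : exists S : 'M[C]_n, S *m H = K.
Proof.
suff /submxP[S ->] : (K <= H)%MS by exists S.
rewrite submxE; apply/eqP/matrixP => i0 j0.
have -> : (K *m cokermx H) i0 j0 = col j0 (K *m cokermx H) i0 0 by rewrite [RHS]mxE.
rewrite colE -mulmxA -colE [RHS]mxE.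
set c := col j0 _; have Hc : H *m c = 0.
  by rewrite /c colE mulmxA mulmx_coker mul0mx.
move: c Hc => c Hc.
pose tc := \sum_i Num.conj (c i 0) *: E' i - l0%:C *: (\sum_i Num.conj (c i 0) *: E i).
have tcE : tc = \sum_i Num.conj (c i 0) *: t i.
  rewrite /tc scaler_sumr -sumrB; apply: eq_bigr => i _.
  by rewrite scalerBr !scalerA mulrC.
have h i : k (E i) tc = 0.
  have := congr1 (fun Z : 'cV[C]_n => Z i 0) Hc; rewrite !mxE => <-.
  rewrite tcE (herm_sumr kh); apply: eq_bigr => j _.
  by rewrite (hermZr kh) conjK mxE mulrC /t (Msym_shift (EM i) (EM j)).
rewrite mxE; move: i0 => i.
transitivity (k (E' i) tc); last exact: (radical_kernel EM gE erefl h).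
rewrite tcE (herm_sumr kh); apply: eq_bigr => j1 _.
by rewrite (hermZr kh) conjK mxE mulrC.
Qed.

Lemma compressed_polynomial : exists2 s : seq C, (size s <= kappa)%N &
  forall u, chain kappa.+1 u ->
    (forall i, (i <= kappa)%N -> exists j, E j = u i) ->
    0 <= moment (shift_chains s u) 0.
Proof.
have [S SH] := solve.
have SHa : S *m H = H *m adj S by rewrite -{2}adjH -adj_mul SH adj_K.
(* On the kernel of [Phi], of codimension at most [kappa], the finite rank form vanishes and [pos]
   makes [h] nonnegative. *)
pose Phi : 'M[C]_(n, kappa) := \matrix_(i, l) f (E i) (e l).
have rL : (n <= \rank (kermx Phi) + kappa)%N.
  by rewrite mxrank_ker; have := rank_leq_col Phi; lia.
have [|s ss sp] := finite_pontryagin adjH SHa rL.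
  move=> x /sub_kermxP xPhi; rewrite formH comb_t.
  have fx l : f (comb E x) (e l) = 0.
    have := congr1 (fun Z : 'rV[C]_kappa => Z 0 l) xPhi; rewrite !mxE => <-.
    rewrite /comb (herm_suml fh); apply: eq_bigr => i _.
    by rewrite (hermZl fh) mxE.
  have := pos (combM x); rewrite big1 => [|l _]; last by rewrite fx normc0 expr0n.
  rewrite addr0 => h.
  rewrite [k _ _]conj_self; first by rewrite lecR (le_trans _ h) // mulr_ge0 // ltW.
  by rewrite -(sesqC kh) (Msym_shift (combM x) (combM x)).
exists s => // u uM uE.
(* [S] follows [M] along an orbit only up to the kernel of [H], so vectors are compared after
   multiplication by [H], which is all that the form sees. *)
have act_chain s' (w : nat -> V) (x : nat -> 'rV[C]_n) y :
    (forall i, (i <= size s')%N -> comb E (x i) = w i) -> chain (size s').+1 w ->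
    y *m H = x 0%N *m H ->
    exists2 z : 'rV[C]_n, z *m H = mxact S s' y *m H & comb E z = shift_chains s' w 0.
  elim: s' w x y => [|a s' IH] w x y xE wM yH /=.
    by exists (x 0%N); [rewrite yH|exact: xE].
  have w1 : comb E' (x 0%N) = w 1%N.
    by apply: (graph_unique (combM _)); rewrite xE //; exact: wM.
  have w2 : comb E' (x 1%N) = w 2%N.
    by apply: (graph_unique (combM _)); rewrite xE //; exact: wM.
  apply: (IH _ (fun i => x i.+1 - a *: x i)).
  - move=> i is'; rewrite /shift_chain -!xE //; last by rewrite /= leqW.
    rewrite /comb scaler_sumr -sumrB; apply: eq_bigr => j _.
    by rewrite !mxE scalerBl scalerA.
  - exact: chain_shift.
  rewrite !mulmxBl -!scalemxAl yH; congr (_ - _).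
  rewrite -mulmxA SHa mulmxA yH -mulmxA -SHa SH; apply/rowP => j.
  rewrite rowK rowH comb_t w1 w2 xE // /t.
  by rewrite -(Msym_shift (wM 1%N isT) (EM j)).
(* Coordinates of [u i]; the default 0 does not occur for [i <= size s], where [u i] is one of the
   [E j]. *)
pose x i : 'rV[C]_n := if [pick j | E j == u i] is Some j then delta_mx 0 j else 0.
have xE i : (i <= size s)%N -> comb E (x i) = u i.
  move=> si; rewrite /x; case: pickP => [j /eqP <-|]; last first.
    by have [j uj] := uE i (leq_trans si ss) => /(_ j); rewrite uj eqxx.
  rewrite /comb (bigD1 j) //= mxE !eqxx scale1r big1 ?addr0 // => l lj.
  by rewrite mxE (negPf lj) andbF scale0r.
have uM' : chain (size s).+1 u.
  by move=> i si; apply: uM; rewrite (leq_trans si).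
have [z zH zu] := act_chain s u x (x 0%N) xE uM' erefl.
have uM1 : M (shift_chains s u 0%N, shift_chains s u 1%N).
  have: chain 1 (shift_chains s u); last exact.
  elim: s u uM' {ss sp x xE z zH zu uE uM} => [//|a s IH] u uM.
  by apply: IH; exact: chain_shift.
have := sp (x 0%N); rewrite -zH -mulmxA.
have -> : H *m adj (mxact S s (x 0%N)) = H *m adj z.
  by rewrite -{1 2}adjH -!adj_mul zH.
rewrite mulmxA formH comb_t zu.
rewrite -(graph_unique uM1 (_ : M (_, comb E' z))) -?zu //.
by move/le0c_Re; rewrite zu.
Qed.

End Compression.

(** The span is that of the first [kappa + 1] vectors of each orbit and of the [g l]. The orbits are
    longer, because [q conj q] involves moments up to order [2 kappa]. *)
Lemma finite_definitising m (U : 'I_m -> nat -> V) :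
  (forall i, chain (2 * kappa).+1 (U i)) ->
  exists2 s : seq C, (size s <= kappa)%N &
    forall i, 0 <= Lambda (moment (U i)) (quads s).
Proof.
move=> UM.
pose I := ('I_m * 'I_kappa.+1 + 'I_kappa)%type.
pose E (i : 'I_#|{: I}|) := match enum_val i with
  | inl p => U p.1 p.2 | inr l => g l end.
pose E' (i : 'I_#|{: I}|) := match enum_val i with
  | inl p => U p.1 p.2.+1 | inr l => g' l end.
have EM i : M (E i, E' i).
  rewrite /E /E'; case: (enum_val i) => [[a b]|l] //=.
  by apply: UM; have := ltn_ord b; lia.
have gE l : exists i, E i = g l.
  by exists (enum_rank (inr l)); rewrite /E enum_rankK.
have [s ss sp] := compressed_polynomial EM gE.
exists s => // i; rewrite -(Lambda_shift (UM i)); last by lia.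
apply: sp => [j jk|j jk]; first by apply: UM; lia.
by exists (enum_rank (inl (i, Ordinal (jk : (j < kappa.+1)%N)))); rewrite /E enum_rankK.
Qed.

End Chains.

(** * From finitely many orbits to all, by compactness *)

Section CommonPolynomial.
Variable R : realType.

(** Each moment sequence cuts the unit sphere of coefficient vectors in a closed set, a half space
    section. The assumption is the finite intersection property of these sets. *)
Lemma common_polynomial (N : nat) (Ms : set (nat -> R)) :
  (forall m (mu : 'I_m -> nat -> R), (forall i, Ms (mu i)) ->
     exists p : {poly R}, [/\ p != 0, (size p <= N.+1)%N &
       forall i, 0 <= Lambda (mu i) p]) ->
  exists p : {poly R}, [/\ p != 0, (size p <= N.+1)%N &
    forall mu, Ms mu -> 0 <= Lambda mu p].
Proof.
move=> fin.
(* A member of [Ms] later places the common point on the sphere and so makes the polynomial nonzero;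
   if there is none, 1 serves. *)
have [[mu0 Mmu0]|no] := pselect (exists mu, Ms mu); last first.
  exists 1; split; rewrite ?oner_eq0 ?size_poly1 // => mu Mmu.
  by case: no; exists mu.
pose pair (c m : 'rV[R]_N.+1) : R := \sum_i c 0 i * m 0 i.
pose rowm (mu : nat -> R) : 'rV[R]_N.+1 := \row_i mu i.
pose S := [set c : 'rV[R]_N.+1 | `|c| = 1].
have Scpt : compact S.
  apply: bounded_closed_compact.
    by exists 1; split; [exact: num_real|move=> x x1 c /= ->; exact: ltW].
  rewrite (_ : S = (fun c : 'rV[R]_N.+1 => `|c|) @^-1` [set 1]) //.
  by apply: preimage_closed => [c _|]; [exact: norm_continuous|exact: closed_eq].
move: Scpt; rewrite compact_In0 => /(_ 'rV[R]_N.+1 (rowm @` Ms)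
  (fun m => S `&` [set c | 0 <= pair c m])) [].
- exists (fun m => [set c | 0 <= pair c m]) => // m _.
  rewrite (_ : mkset _ = (pair^~ m) @^-1` [set x | 0 <= x]) //.
  apply: preimage_closed; last exact: closed_ge.
  move=> c _; move: c; apply: continuous_big => [|i _ c]; first exact: add_continuous.
  have h := @coord_continuous R 1 N.+1 0 i c.
  exact: (cvgM h (cvg_cst (m 0 i))).
- move=> D' D'sub.
  have /choice[mu muE] (m : 'rV[R]_N.+1) :
      exists u, m \in D' -> Ms u /\ rowm u = m.
    have [mD|mD] := boolP (m \in D'); last by exists (fun=> 0).
    by have /set_mem [u Mu <-] := D'sub m mD; exists u.
  pose s : seq 'rV[R]_N.+1 := D'.
  have [|p [p0 sp pp]] := fin (size s) (fun i => mu (nth 0 s i)).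
    by move=> i; apply: (muE _ _).1; rewrite mem_nth.
  pose c : 'rV[R]_N.+1 := \row_i p`_i.
  have c0 : 0 < `|c|.
    rewrite normr_gt0; apply: contra p0 => /eqP c0; apply/eqP/polyP => i.
    rewrite coef0; have [iN|Ni] := ltnP i N.+1; last first.
      by rewrite nth_default // (leq_trans sp).
    by have := congr1 (fun z : 'rV[R]_N.+1 => z 0 (Ordinal iN)) c0; rewrite !mxE.
  exists (`|c|^-1 *: c) => m /= mD; split.
    by rewrite /S /= normrZ ger0_norm ?invr_ge0 ?ltW // mulVf // gt_eqF.
  have im : (index m s < size s)%N by rewrite index_mem.
  have /= := pp (Ordinal im).
  rewrite nth_index // (LambdaE _ sp) => h; rewrite /pair /=.
  rewrite (eq_bigr (fun i : 'I_N.+1 => `|c|^-1 * (p`_i * mu m i))); last first.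
    move=> i _; rewrite -[in LHS](muE m mD).2 !mxE mulrA; congr (_ * _ * _).
  by rewrite -mulr_sumr mulr_ge0 ?invr_ge0 // ltW.
move=> c cP; pose p := \poly_(i < N.+1) (if insub i is Some j then c 0 j else 0).
have pE (j : 'I_N.+1) : p`_j = c 0 j.
  rewrite coef_poly ltn_ord; case: insubP => [k _ kj|]; last by rewrite ltn_ord.
  by congr (c _ _); apply: val_inj.
have sp : (size p <= N.+1)%N by exact: size_poly.
exists p; split => //.
  have [nc _] := cP (rowm mu0) (ex_intro2 _ _ mu0 Mmu0 erefl).
  apply/eqP => p0; move: nc; rewrite /S /= (_ : c = 0) ?normr0 => [/eqP|].
    by rewrite eq_sym oner_eq0.
  by apply/rowP => j; rewrite -pE p0 coef0 mxE.
move=> mu Mmu; have [_ /=] := cP (rowm mu) (ex_intro2 _ _ mu Mmu erefl).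
rewrite (LambdaE _ sp) /pair; congr (0 <= _); apply: eq_bigr => i _.
by rewrite pE mxE.
Qed.

End CommonPolynomial.

(** * Operators in a Hilbert space *)

Section Hilbert.
Context {R : realType}.
Local Notation C := R[i].
Local Notation Re := (@complex.Re R).
Implicit Types V W : lmodType C.

Lemma small_le0 (r c : R) : (forall eps : R, 0 < eps -> r <= c * eps) -> r <= 0.
Proof.
move=> h; rewrite leNgt; apply/negP => r0.
have c0 : 0 < `|c| + 1 by rewrite ltr_wpDl.
have e0 : 0 < r / (2 * (`|c| + 1)) by rewrite divr_gt0 // mulr_gt0.
have := h _ e0; apply/negP; rewrite -ltNge mulrCA gtr_pMr //.
rewrite ltr_pdivrMr ?mulr_gt0 // mul1r.
by have := ler_norm c; have := normr_ge0 c; lra.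
Qed.

Definition seq_cvg V (f : V -> V -> C) (u : nat -> V) (x : V) : Prop :=
  forall eps : R, 0 < eps -> exists N, forall n, (N <= n)%N -> nm f (u n - x) < eps.

Definition seq_cauchy V (f : V -> V -> C) (u : nat -> V) : Prop :=
  forall eps : R, 0 < eps ->
    exists N, forall m n, (N <= m)%N -> (N <= n)%N -> nm f (u m - u n) < eps.

(** Completeness, closure and density are phrased by the form alone, so that the same lemmas apply
    to both spaces and to their sum, whose product norm is not the one of its inner product. *)
Record hilbert_sesq V (f : V -> V -> C) : Prop := HilbertSesq {
  hilbert_nonneg :> nonneg_sesq f;
  hilbert_def : forall x, Re (f x x) = 0 -> x = 0;
  hilbert_complete : forall u, seq_cauchy f u -> exists x, seq_cvg f u x }.

Definition adherent V W (f : V -> V -> C) (g : W -> W -> C) (T : set (V * W)) :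
    set (V * W) :=
  [set p | forall eps : R, 0 < eps -> exists x y,
    [/\ T (x, y), nm f (p.1 - x) < eps & nm g (p.2 - y) < eps]].

Definition adherent_in V (f : V -> V -> C) (E : set V) : set V :=
  [set x | forall eps : R, 0 < eps -> exists2 y, E y & nm f (x - y) < eps].

Lemma cvg_cauchy V (f : V -> V -> C) (fp : nonneg_sesq f) u x :
  seq_cvg f u x -> seq_cauchy f u.
Proof.
move=> h eps e0; have [N hN] := h (eps / 2) ltac:(lra).
exists N => m n Nm Nn; have := nm_triangle fp (u m) x (u n).
by have := hN m Nm; have := hN n Nn; rewrite (nmB fp x); lra.
Qed.

Lemma adherent_sub V W (f : V -> V -> C) (g : W -> W -> C) (T : set (V * W)) :
  nonneg_sesq f -> nonneg_sesq g -> T `<=` adherent f g T.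
Proof.
move=> fp gp [x y] Txy eps e0; exists x, y; split => //=.
  by rewrite subrr (nm0 fp).
by rewrite subrr (nm0 gp).
Qed.

Lemma adherent_mono V W (f : V -> V -> C) (g : W -> W -> C) (T T' : set (V * W)) :
  T `<=` T' -> adherent f g T `<=` adherent f g T'.
Proof. by move=> TT p h e /h[x [y [/TT]]]; exists x, y. Qed.

Lemma adherent_adherent V W (f : V -> V -> C) (g : W -> W -> C) (T : set (V * W)) :
  nonneg_sesq f -> nonneg_sesq g ->
  adherent f g (adherent f g T) `<=` adherent f g T.
Proof.
move=> fp gp p h eps e0.
have [x [y [Txy px py]]] := h (eps / 2) ltac:(lra).
have [x' [y' [Txy' px' py']]] := Txy (eps / 2) ltac:(lra).
exists x', y'; split => //.
  by have := nm_triangle fp p.1 x x'; rewrite /= in px' *; lra.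
by have := nm_triangle gp p.2 y y'; rewrite /= in py' *; lra.
Qed.

Lemma adherent_cvg V W (f : V -> V -> C) (g : W -> W -> C) (T : set (V * W))
    (fp : nonneg_sesq f) (gp : nonneg_sesq g) u v x y :
  (forall n : nat, T (u n, v n)) -> seq_cvg f u x -> seq_cvg g v y ->
  adherent f g T (x, y).
Proof.
move=> Tuv ux vy eps e0.
have [N1 h1] := ux eps e0; have [N2 h2] := vy eps e0.
exists (u (maxn N1 N2)), (v (maxn N1 N2)); split => //=.
  by rewrite (nmB fp) h1 // leq_maxl.
by rewrite (nmB gp) h2 // leq_maxr.
Qed.

Lemma adherent_subspace V W (f : V -> V -> C) (g : W -> W -> C) (T : set (V * W)) :
  nonneg_sesq f -> nonneg_sesq g -> Defs.subspace T ->
  Defs.subspace (adherent f g T).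
Proof.
move=> fp gp [T0 TD]; split; first exact: adherent_sub.
move=> c p q hp hq eps e0.
have c0 : 0 < normc c + 1 by have := normc_ge0 c; lra.
have [x [y [Txy px py]]] := hp (eps / 2 / (normc c + 1)) ltac:(by rewrite !divr_gt0).
have [x' [y' [Txy' px' py']]] := hq (eps / 2) ltac:(lra).
exists (c *: x + x'), (c *: y + y'); split; first exact: (TD c _ _ Txy Txy').
  rewrite /= opprD addrACA -scalerBr; have := nmD fp (c *: (p.1 - x)) (q.1 - x').
  rewrite (nmZ fp); move: px; rewrite ltr_pdivlMr // mulrC => px.
  have := nm_ge0 f (p.1 - x); lra.
rewrite /= opprD addrACA -scalerBr; have := nmD gp (c *: (p.2 - y)) (q.2 - y').
rewrite (nmZ gp); move: py; rewrite ltr_pdivlMr // mulrC => py.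
have := nm_ge0 g (p.2 - y); lra.
Qed.

Lemma orth_adherent V (f : V -> V -> C) (fp : hilbert_sesq f) (E : set V) z :
  (forall x, adherent_in f E x) -> (forall e, E e -> f e z = 0) -> z = 0.
Proof.
move=> Ed Ez; apply: (hilbert_def fp); apply/le_anti.
rewrite (nonneg_ge0 fp) andbT; apply: (@small_le0 _ (nm f z)) => eps e0.
have [e Ee ze] := Ed z eps e0.
have -> : f z z = f (z - e) z by rewrite (hermBl fp) (Ez _ Ee) subr0.
rewrite (le_trans (Re_le_normc _)) // (le_trans (cauchy_schwarz fp _ _)) // mulrC.
by rewrite ler_wpM2l ?nm_ge0 // ltW.
Qed.

Lemma cvg_form V (f : V -> V -> C) (fp : nonneg_sesq f) u x z eps :
  seq_cvg f u x -> 0 < eps ->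
  exists N, forall n, (N <= n)%N -> normc (f (u n) z - f x z) < eps.
Proof.
move=> ux e0; have c0 : 0 < nm f z + 1 by have := nm_ge0 f z; lra.
have [N hN] := ux (eps / (nm f z + 1)) (divr_gt0 e0 c0).
exists N => n /hN; rewrite ltr_pdivlMr // => h; rewrite -(hermBl fp).
have := cauchy_schwarz fp (u n - x) z; have := nm_ge0 f (u n - x); lra.
Qed.

(* The minimising sequence of the distance from [x] to [E] is Cauchy by the
   parallelogram law, and [x] minus its limit is orthogonal to [E]. *)
Lemma adherent_orth V (f : V -> V -> C) (fp : hilbert_sesq f) (E : set V) :
  Defs.subspace E -> (forall z, (forall e, E e -> f e z = 0) -> z = 0) ->
  forall x, adherent_in f E x.
Proof.
move=> [E0 ED] Eo x.
have Ehalf a b : E a -> E b -> E (2^-1 *: (a + b)).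
  move=> Ea Eb; rewrite scalerDr; apply: (ED) => //.
  by rewrite -[_ *: b]addr0; apply: (ED).
pose D := [set nm f (x - e) | e in E].
have D0 : D !=set0 by exists (nm f (x - 0)), 0.
have Dlb : has_lbound D by exists 0 => _ [e _ <-]; exact: nm_ge0.
pose d := inf D.
have d_le e : E e -> d <= nm f (x - e) by move=> Ee; apply: ge_inf => //; exists e.
have d0 : 0 <= d by apply: lb_le_inf => // _ [e _ <-]; exact: nm_ge0.
have seqE : forall n : nat, exists e, E e /\ nm f (x - e) < d + n.+1%:R^-1.
  move=> n; have [|_ [e Ee <-] h] := @inf_adherent _ D n.+1%:R^-1 _ (conj D0 Dlb).
    by rewrite invr_gt0.
  by exists e.
have [e /all_and2[eE ed]] := choice seqE.
have para m n : nm f (e m - e n) ^+ 2 <=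
    2 * nm f (x - e m) ^+ 2 + 2 * nm f (x - e n) ^+ 2 - 4 * d ^+ 2.
  have := d_le _ (Ehalf _ _ (eE m) (eE n)).
  rewrite -ler_sqr ?nnegrE ?nm_ge0 //.
  have -> : x - 2^-1 *: (e m + e n) = 2^-1 *: ((x - e m) + (x - e n)).
    rewrite addrACA -opprD scalerBr; congr (_ - _).
    by rewrite -[x + x]mulr2n -[x *+ 2]scaler_nat scalerA mulVf ?scale1r // pnatr_eq0.
  have -> : e m - e n = (x - e n) - (x - e m) by rewrite opprB [RHS]addrC addrA subrK.
  rewrite !(nm_sqr fp) (Re_hermZ fp) (Re_hermB fp) (Re_hermD fp).
  have -> : normc (2^-1 : C) ^+ 2 = 4^-1.
    rewrite normcV -[2 : C]/(2%:R) -(rmorph_nat (real_complex R)) normc_real.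
    by rewrite ger0_norm //; field.
  by rewrite (Re_hermC fp (x - e n) (x - e m)); lra.
have small (eps : R) : 0 < eps -> exists N, forall n, (N <= n)%N ->
    nm f (x - e n) ^+ 2 <= d ^+ 2 + eps.
  move=> e0; pose c := 2 * d + 1; have c0 : 0 < c by rewrite /c; lra.
  have [N hN] : exists N : nat, c / eps < N%:R.
    by exists (Num.truncn (c / eps)).+1; rewrite Num.Theory.truncnS_gt.
  exists N => n Nn; have h := ed n.
  have n0 : 0 < n.+1%:R^-1 :> R by rewrite invr_gt0.
  have n1 : n.+1%:R^-1 <= 1 :> R by rewrite invf_le1 // ler1n.
  have n2 : c * n.+1%:R^-1 <= eps.
    rewrite ler_pdivrMr // -ler_pdivrMl // mulrC (le_trans (ltW hN)) // ler_nat.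
    exact: leqW.
  have h2 : nm f (x - e n) ^+ 2 <= (d + n.+1%:R^-1) ^+ 2.
    by rewrite ler_sqr ?nnegrE ?nm_ge0 ?(ltW h) // addr_ge0 // ltW.
  rewrite (le_trans h2) // sqrrD; move: n2; rewrite /c.
  set t := n.+1%:R^-1 in n0 n1 *; nra.
have [y ey] : exists y, seq_cvg f e y.
  apply: (hilbert_complete fp) => eps e0.
  have e4 : 0 < eps ^+ 2 / 8 by rewrite divr_gt0 // exprn_gt0.
  have [N hN] := small _ e4; exists N => m n Nm Nn.
  rewrite -ltr_sqr ?nnegrE ?nm_ge0 ?ltW //; have := para m n.
  have e2 : 0 < eps ^+ 2 by rewrite exprn_gt0.
  by have := hN m Nm; have := hN n Nn; lra.
have dy z : E z -> d <= nm f (x - y - z).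
  move=> Ez; rewrite -subr_le0; apply: (@small_le0 _ 1) => eps e0.
  have [N hN] := ey eps e0; have := hN N (leqnn N).
  have Eez : E (e N + z) by rewrite -[e N]scale1r; apply: (ED).
  have := d_le _ Eez; have := nmD fp (x - y - z) (y - e N).
  by rewrite (nmB fp y) addrACA subrK -opprD [z + _]addrC; lra.
have yd : nm f (x - y) <= d.
  rewrite -subr_le0; apply: (@small_le0 _ 2) => eps e0.
  have [N hN] := ey eps e0.
  have [N2 hN2] : exists N : nat, eps^-1 < N%:R.
    by exists (Num.truncn (eps^-1)).+1; rewrite Num.Theory.truncnS_gt.
  have [n [nN nN2]] : exists n, (N <= n)%N /\ (N2 <= n)%N.
    by exists (maxn N N2); rewrite leq_maxl leq_maxr.
  have h1 := hN n nN; have h2 := ed n.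
  have h3 : n.+1%:R^-1 <= eps.
    rewrite -[eps]invrK lef_pV2 ?posrE ?invr_gt0 // (le_trans (ltW hN2)) // ler_nat.
    by rewrite leqW.
  have h4 := nm_triangle fp x (e n) y.
  by move: h1 h2 h3 h4; set t := _^-1; lra.
have xy : x - y = 0.
  move: (x - y) yd dy => w yd dy.
  apply: Eo => z Ez; apply: (@eq0_normc R); apply/eqP; rewrite -sqrf_eq0.
  have key (s : R) : 0 <= - 2 * s * normc (f z w) ^+ 2
      + s ^+ 2 * (normc (f z w) ^+ 2 * Re (f z z)).
    have Esz : E ((s%:C * Num.conj (f z w)) *: z).
      by rewrite -[_ *: z]addr0; apply: (ED).
    have := le_trans yd (dy _ Esz).
    rewrite -ler_sqr ?nnegrE ?nm_ge0 // !(nm_sqr fp) (Re_hermB fp) (hermZr fp).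
    rewrite conjM conjR conjK (sesqC fp z w) -mulrA mulcJ ReZ /=.
    rewrite (Re_hermZ fp) normcM normc_conj normc_real exprMn real_normK ?num_real //.
    by lra.
  have zz := nonneg_ge0 fp z; set F := normc _ ^+ 2 in key *.
  have F0 : 0 <= F by exact: sqr_ge0.
  rewrite eq_le F0 andbT leNgt; apply/negP => Fp.
  (* Dividing by [c + 1] instead of [c] covers [z = 0] as well. *)
  have := key (Re (f z z) + 1)^-1; set c := Re (f z z) in zz *.
  have c1 : 0 < c + 1 by lra.
  have -> : - 2 * (c + 1)^-1 * F + (c + 1)^-1 ^+ 2 * (F * c)
     = - (F * (c + 2) / (c + 1) ^+ 2) by field; lra.
  by rewrite oppr_ge0 leNgt divr_gt0 // ?exprn_gt0 // mulr_gt0 //; lra.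
move=> eps e0; have [N hN] := ey eps e0; exists (e N) => //.
by rewrite (nmB fp) (subr0_eq xy); exact: hN.
Qed.

End Hilbert.

(** * Self-adjointness and surjectivity in terms of graphs *)

Section SelfAdjoint.
Context {R : realType} (V : lmodType R[i]) (f : V -> V -> R[i]).
Local Notation C := R[i].
Local Notation Re := (@complex.Re R).
Hypothesis fp : hilbert_sesq f.
Implicit Types T : set (V * V).

Record selfadj T : Prop := SelfAdj {
  sa_subspace : Defs.subspace T;
  sa_dense : forall x, adherent_in f (dom T) x;
  sa_adj : forall u v, (forall x y, T (x, y) -> f y u = f x v) <-> T (u, v) }.

Lemma sa_sym T : selfadj T ->
  forall x y u v, T (x, y) -> T (u, v) -> f y u = f x v.
Proof. by move=> Ts x y u v Txy /(sa_adj Ts) h; exact: h. Qed.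

Lemma sym_functional T :
  (forall x, adherent_in f (dom T) x) ->
  (forall x y u v, T (x, y) -> T (u, v) -> f y u = f x v) ->
  forall y, T (0, y) -> y = 0.
Proof.
move=> Td Ts y T0; apply: (orth_adherent fp Td) => e [[x z] Txz /= <-].
rewrite (sesqC fp y) -[RHS]conjZ0; congr Num.conj.
by rewrite (Ts _ _ _ _ T0 Txz) (herm0l fp).
Qed.

Lemma adjoint_closed T u v :
  adherent f f [set p | forall x y, T (x, y) -> f y p.1 = f x p.2] (u, v) ->
  forall x y, T (x, y) -> f y u = f x v.
Proof.
move=> h x y Txy; apply/eqP; rewrite -subr_eq0; apply/eqP/eq0_normc/le_anti.
rewrite normc_ge0 andbT; apply: (@small_le0 _ _ (nm f y + nm f x)) => eps e0.
have [u' [v' [/= uv uu vv]]] := h eps e0.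
have -> : f y u - f x v = f y (u - u') - f x (v - v').
  by rewrite !(hermBr fp) (uv _ _ Txy) opprB addrA subrK.
rewrite (le_trans (normc_add _ _)) // normc_opp mulrDl lerD //.
  rewrite (le_trans (cauchy_schwarz fp _ _)) // ler_wpM2l ?nm_ge0 //.
  by rewrite ltW.
rewrite (le_trans (cauchy_schwarz fp _ _)) // ler_wpM2l ?nm_ge0 //.
by rewrite ltW.
Qed.

Lemma sa_closed T : selfadj T -> adherent f f T `<=` T.
Proof.
move=> Ts [u v] h; apply/(sa_adj Ts); apply: adjoint_closed.
by apply: adherent_mono h => -[x y] /= /(sa_adj Ts).
Qed.

(** The lower bound makes preimages of a Cauchy sequence Cauchy, so the range of the closed graph is
    closed; it is dense because its orthogonal complement is trivial. *)
Lemma closed_onto T c : Defs.subspace T -> adherent f f T `<=` T ->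
  (forall x y, T (x, y) -> nm f x <= c * nm f y) ->
  (forall z, (forall x y, T (x, y) -> f y z = 0) -> z = 0) ->
  forall z, exists x, T (x, z).
Proof.
move=> [T0 TD] Tc Tb To z.
pose E := [set y | exists x, T (x, y)].
have Es : Defs.subspace E.
  split; first by exists 0.
  by move=> a y y' [x Txy] [x' Txy']; exists (a *: x + x'); exact: (TD a _ _ Txy Txy').
have Ed : forall x, adherent_in f E x.
  by apply: (adherent_orth fp Es) => w h; apply: To => x y Txy; apply: h; exists x.
have /choice[y yP] (n : nat) : exists y, E y /\ nm f (z - y) < n.+1%:R^-1.
  by have [|y Ey zy] := Ed z n.+1%:R^-1; [rewrite invr_gt0|exists y].
have /choice[x xy] (n : nat) : exists x, T (x, y n) by have [h _] := yP n.
have yz : seq_cvg f y z.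
  move=> eps e0; exists (Num.truncn eps^-1) => n Nn.
  rewrite (nmB fp) (lt_le_trans (yP n).2) // -[eps]invrK.
  rewrite lef_pV2 ?posrE ?invr_gt0 // (le_trans (ltW (Num.Theory.truncnS_gt _))) //.
  by rewrite ler_nat.
have [u xu] : exists u, seq_cvg f x u.
  apply: (hilbert_complete fp) => eps e0.
  have c0 : 0 < `|c| + 1 by rewrite ltr_wpDl.
  have [N hN] := cvg_cauchy fp yz (divr_gt0 e0 c0).
  exists N => m n Nm Nn; have := hN m n Nm Nn; rewrite ltr_pdivlMr // => h.
  have Tmn : T (x m - x n, y m - y n).
    have := TD (-1) _ _ (xy n) (xy m).
    rewrite /= -[-1 *: (_, _)]/(-1 *: x n, -1 *: y n) !scaleN1r.
    by rewrite -[_ + _]/(_ + _, _ + _) /= ![- _ + _]addrC.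
  have := Tb _ _ Tmn; have := nm_ge0 f (y m - y n); have := ler_norm c; nra.
exists u; apply: Tc; exact: (adherent_cvg fp fp xy xu yz).
Qed.

Lemma sa_onto T c : selfadj T ->
  (forall x y, T (x, y) -> nm f x <= c * nm f y) ->
  forall z, exists x, T (x, z).
Proof.
move=> Ts Tb; apply: (closed_onto (sa_subspace Ts) (sa_closed Ts) Tb) => z h.
have Tz : T (z, 0) by apply/(sa_adj Ts) => x y /h ->; rewrite (herm0r fp).
have := Tb _ _ Tz; rewrite (nm0 fp) mulr0 => z0.
apply: (hilbert_def fp); rewrite -(nm_sqr fp); apply/eqP; rewrite sqrf_eq0.
by rewrite eq_le z0 nm_ge0.
Qed.

(** The set is the graph of [T - F]. As [F] is defined everywhere and symmetric, adjoint pairs of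
    [T - F] are those of [T] shifted by [F]. *)
Lemma sa_perturb T (F : V -> V) : selfadj T ->
  (forall c x y, F (c *: x + y) = c *: F x + F y) ->
  (forall x y, f (F x) y = f x (F y)) ->
  selfadj [set p | T (p.1, p.2 + F p.1)].
Proof.
move=> Ts Fl Fs; split.
- have [T0 TD] := sa_subspace Ts; split => /=.
    have -> : F 0 = 0.
      have := Fl 1 0 0; rewrite scaler0 addr0 scale1r => /eqP.
      by rewrite -subr_eq subrr eq_sym => /eqP.
    by rewrite addr0.
  move=> c p q hp hq /=; rewrite Fl.
  rewrite addrACA -scalerDr; exact: (TD c _ _ hp hq).
- move=> x eps e0; have [_ [[y z] Tyz <-] xy] := sa_dense Ts x e0.
  by exists y => //; exists (y, z - F y) => //=; rewrite subrK.
- move=> u v /=; split=> [h|Tuv x y Txy]; last first.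
    by have := sa_sym Ts Txy Tuv; rewrite (hermDl fp) (hermDr fp) Fs => /addIr.
  apply/(sa_adj Ts) => x y Txy; have := h x (y - F x); rewrite subrK => /(_ Txy).
  rewrite (hermBl fp) (hermDr fp) -Fs => /eqP; rewrite subr_eq => /eqP; exact.
Qed.

(** The closure is onto by the lower bound and the dense range. If [(u, v)] is an adjoint pair and
    [z] a preimage of [v], then [u - z] is orthogonal to the range, so [u = z]. *)
Lemma closure_selfadj T c : Defs.subspace T ->
  (forall x, adherent_in f (dom T) x) ->
  (forall x y u v, T (x, y) -> T (u, v) -> f y u = f x v) ->
  (forall x y, T (x, y) -> nm f x <= c * nm f y) ->
  (forall z, (forall x y, T (x, y) -> f y z = 0) -> z = 0) ->
  selfadj (adherent f f T) /\
  forall x y, adherent f f T (x, y) -> nm f x <= c * nm f y.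
Proof.
move=> Tsub Td Ts Tb To.
have TA := adherent_sub fp fp (T := T).
have sw (S : set (V * V)) u v : (forall x y, S (x, y) -> f y u = f x v) ->
    forall x y, adherent f f S (x, y) -> f v x = f u y.
  move=> h x y hxy.
  have := @adjoint_closed [set (u, v)] x y _ u v erefl; apply.
  apply: adherent_mono hxy => -[a b] Sab _ _ [-> ->] /=.
  by rewrite (sesqC fp) (sesqC fp b) (h _ _ Sab).
have As1 u v x y : T (u, v) -> adherent f f T (x, y) -> f v x = f u y.
  by move=> Tuv; apply: sw => a b Tab; apply: Ts.
have As u v x y : adherent f f T (u, v) -> adherent f f T (x, y) -> f v x = f u y.
  by move=> Auv; apply: sw => a b Tab; apply: As1.
have Ab x y : adherent f f T (x, y) -> nm f x <= c * nm f y.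
  move=> h; rewrite -subr_le0; apply: (@small_le0 _ _ (1 + `|c|)) => eps e0.
  have [x' [y' [Txy /= xx yy]]] := h eps e0.
  have := Tb _ _ Txy; have := nm_sub_le fp x x'.
  have := nm_sub_le fp y' y; have := nm_sub_le fp y y'; rewrite (nmB fp y' y).
  have := nm_ge0 f (y - y'); have [c0|c0] := leP 0 c.
    rewrite ger0_norm //; nra.
  rewrite ltr0_norm //; nra.
have Asub := adherent_subspace fp fp Tsub.
split => //; split => //.
- move=> x eps e0; have [_ [[y z] Tyz <-] xy] := Td x eps e0.
  by exists y => //; exists (y, z) => //; exact: TA.
- move=> u v; split=> [h|Auv x y Axy]; last exact: As.
  have [|z Az] := closed_onto Asub (adherent_adherent fp fp) Ab _ v.
    by move=> w hw; apply: To => x y /TA; exact: hw.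
  suff -> : u = z by [].
  apply/eqP; rewrite -subr_eq0; apply/eqP/To => x y Txy.
  by rewrite (hermBr fp) (h _ _ (TA _ Txy)) (As _ _ _ _ (TA _ Txy) Az) subrr.
Qed.
End SelfAdjoint.

(** * Finite rank perturbations of positive operators in a Krein space *)

Section FinitelyManyNegativeSquares.
Context {R : realType} (V : lmodType R[i]) (f : V -> V -> R[i]) (J : V -> V).
Local Notation C := R[i].
Local Notation Re := (@complex.Re R).
Local Notation Im := (@complex.Im R).
Hypothesis fp : hilbert_sesq f.
Hypothesis Jlin : forall c x y, J (c *: x + y) = c *: J x + J y.
Hypothesis JK : forall x, J (J x) = x.
Hypothesis Jsym : forall x y, f (J x) y = f x (J y).
Variables (kappa : nat) (e : 'I_kappa -> V) (W : set (V * V)) (delta l0 : R).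
Hypothesis Wsa : selfadj f W.
Hypothesis delta0 : 0 < delta.
Hypothesis Wpos : forall x y, W (x, y) -> delta * Re (f x x) <= Re (f y x).

Definition frank (x : V) : V := \sum_l f x (e l) *: e l.

(* The operator [M] for which [W = J (M - l0) + F], with [F] of finite rank. *)
Definition krein_op : set (V * V) :=
  [set p | W (p.1, J (p.2 - l0%:C *: p.1) + frank p.1)].

Local Notation M := krein_op.
Let k x y := f (J x) y.

Let J0 : J 0 = 0.
Proof.
have := Jlin 1 0 0; rewrite scaler0 addr0 scale1r => /eqP.
by rewrite -subr_eq subrr eq_sym => /eqP.
Qed.

Let JD x y : J (x + y) = J x + J y.
Proof. by rewrite -[x in LHS]scale1r Jlin scale1r. Qed.

Let JZ c x : J (c *: x) = c *: J x.
Proof. by rewrite -[c *: x]addr0 Jlin J0 addr0. Qed.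

Let JB x y : J (x - y) = J x - J y.
Proof. by rewrite JD -scaleN1r JZ scaleN1r. Qed.

Let nmJ x : nm f (J x) = nm f x.
Proof. by rewrite /nm Jsym JK. Qed.

Lemma frank_lin c x y : frank (c *: x + y) = c *: frank x + frank y.
Proof.
rewrite /frank scaler_sumr -big_split; apply: eq_bigr => l _ /=.
by rewrite (sesqP fp) scalerDl scalerA.
Qed.

Lemma frank_form x y : f (frank x) y = \sum_l f x (e l) * Num.conj (f y (e l)).
Proof.
rewrite /frank (herm_suml fp); apply: eq_bigr => l _.
by rewrite (hermZl fp) (sesqC fp y).
Qed.

Lemma frank_sym x y : f (frank x) y = f x (frank y).
Proof.
rewrite frank_form (sesqC fp (frank y)) frank_form conj_sum; apply: eq_bigr => l _.
by rewrite conjM conjK mulrC.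
Qed.

Lemma krein_herm : hermitian_sesq k.
Proof.
split=> [c x y z|x y]; first by rewrite /k Jlin (sesqP fp).
by rewrite /k Jsym (sesqC fp (J x)).
Qed.

Let Mop x y : M (x, y) -> exists2 w, W (x, w) & y = J (w - frank x) + l0%:C *: x.
Proof. by move=> h; exists (J (y - l0%:C *: x) + frank x); rewrite // addrK JK subrK. Qed.

Let MopW x w : W (x, w) -> M (x, J (w - frank x) + l0%:C *: x).
Proof. by rewrite /krein_op /= addrK JK subrK. Qed.

Lemma krein_subspace : Defs.subspace M.
Proof.
have [W0 WD] := sa_subspace Wsa; split.
  rewrite /krein_op /= scaler0 subr0 J0 add0r.
  have := frank_lin 1 0 0; rewrite scaler0 addr0 scale1r => /eqP.
  by rewrite -subr_eq subrr eq_sym => /eqP ->.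
move=> c p q hp hq; rewrite /krein_op /=; have := WD c _ _ hp hq.
congr W; congr pair; rewrite /= frank_lin scalerDr addrACA; congr (_ + _).
rewrite -Jlin; congr J; rewrite scalerBr scalerDr !scalerA [c * _]mulrC opprD.
by rewrite addrACA.
Qed.

Lemma krein_sym x y x' y' : M (x, y) -> M (x', y') -> k y x' = k x y'.
Proof.
move=> /Mop [w hw ->] /Mop [w' hw' ->]; rewrite /k.
rewrite JD JK JZ (hermDr fp (J _)) (hermDl fp (w - _)) (hermZl fp) (hermZr fp) conjR.
rewrite !Jsym JK (hermBl fp) (hermBr fp) frank_sym.
by rewrite (sa_sym Wsa hw hw').
Qed.

Lemma krein_functional y : M (0, y) -> y = 0.
Proof.
have F0 : frank 0 = 0 by rewrite /frank big1 // => l _; rewrite (herm0l fp) scale0r.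
move=> /Mop [w h ->]; rewrite F0 subr0 scaler0 addr0.
by rewrite (sym_functional fp (sa_dense Wsa) (sa_sym Wsa) h) J0.
Qed.

Lemma krein_pos x y : M (x, y) -> delta * Re (f x x) <=
  Re (k (y - l0%:C *: x) x) + \sum_l normc (f x (e l)) ^+ 2.
Proof.
move=> /Mop [w h ->]; have := Wpos h; rewrite addrK /k JK.
rewrite (hermBl fp) frank_form ReD ReN Re_sum.
under [X in _ - X]eq_bigr => l _ do rewrite mulcJ /=.
by rewrite subrK.
Qed.

Lemma W_bounded x y : W (x, y) -> nm f x <= delta^-1 * nm f y.
Proof.
by move=> /Wpos/(form_lower_bound fp); rewrite ler_pdivlMl.
Qed.

Lemma W_onto z : exists x, W (x, z).
Proof. exact: (sa_onto fp Wsa W_bounded). Qed.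

Lemma krein_definitising : exists c : {poly R}, [/\ c != 0,
  (size c <= (2 * kappa).+1)%N & forall u, chain M (2 * kappa).+1 u ->
    0 <= Lambda (moment k l0 u) c].
Proof.
have /choice[g gP] (l : 'I_kappa) : exists g, W (g, e l) by exact: W_onto.
pose g' l := J (e l - frank (g l)) + l0%:C *: g l.
have gM l : M (g l, g' l) by exact: MopW.
have gW l z : f z (e l) = k z (g' l - l0%:C *: g l)
    + \sum_j f z (e j) * Num.conj (f (g l) (e j)).
  by rewrite /g' addrK -frank_form frank_sym /k Jsym JK (hermBr fp) subrK.
have [|c [c0 cs cp]] := @common_polynomial R (2 * kappa)
    [set mu | exists2 u, chain M (2 * kappa).+1 u & mu = moment k l0 u]; last first.
  by exists c; split => // u uM; apply: cp; exists u.
move=> m mu muP.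
have /choice[U UP] (i : 'I_m) : exists u, chain M (2 * kappa).+1 u /\ mu i = moment k l0 u.
  by have [u uM ->] := muP i; exists u.
have [s ss sp] := finite_definitising krein_herm fp krein_subspace krein_functional
  krein_sym delta0 krein_pos (hilbert_def fp) (nonneg_ge0 fp) gM gW
  (fun i => (UP i).1).
exists (quads s); split.
- exact: monic_neq0 (quads_monic s).
- by rewrite size_quads; lia.
- by move=> i; rewrite (UP i).2.
Qed.

Let kreinZl c x y : k (c *: x) y = c * k x y.
Proof. exact: (hermZl krein_herm). Qed.

Lemma krein_definitisable : exists2 p : {poly R}, p != 0 &
  forall x y, op_horner p M (x, y) -> 0 <= k y x.
Proof.
have [c [c0 cs cp]] := krein_definitising.
set N := (2 * kappa).+1 in cs cp.
(* The factor [X - l0] turns [k] into [h]. A vector in the domain of [M^(deg p)] has an orbit of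
   just that length, and [c] may have small degree; the factor [X^(2 N)] moves the argument to
   [M^N x], whose orbit is long enough for [c]. *)
pose q := ('X - l0%:P) * c; pose p := 'X^(2 * N) * q.
have q0 : q != 0 by rewrite mulf_neq0 ?polyXsubC_eq0.
have p0 : p != 0 by rewrite mulf_neq0 // monic_neq0 // monicXn.
have szq : size q = (size c).+1 by rewrite /q size_monicM ?monicXsubC // size_XsubC.
have szp : size p = (2 * N + (size c).+1)%N.
  by rewrite size_monicM ?monicXn // size_polyXn szq.
exists p => // x y [_ /= [u uP ->]].
have u0 : u 0%N = x by have := uP 0%N; rewrite szp addnS => /(_ isT).
have Mpow_fun i a b b' : op_pow M i (a, b) -> op_pow M i (a, b') -> b = b'.
  elim: i b b' => [b b' /= -> -> //|i IH b b' [z /= az zb] [z' /= az' zb']].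
  rewrite (IH _ _ az' az) in zb'.
  exact: (graph_unique krein_subspace krein_functional zb zb').
have uM : chain M (size p).-1 u.
  move=> i ip; have hi : (i < size p)%N by lia.
  have hi1 : (i.+1 < size p)%N by lia.
  have [z /= xz zu] := uP _ hi1.
  by rewrite (Mpow_fun _ _ _ _ (uP _ hi) xz).
have ksym n (v : nat -> V) i j : chain M n v -> (i + j <= n)%N ->
    k (v i) (v j) = k (v (i + j)%N) (v 0%N).
  move=> vM; elim: j i => [|j IH] i ij; first by rewrite addn0.
  rewrite addnS -addSn -IH //; last by rewrite addSn -addnS.
  by rewrite -(krein_sym (vM i _) (vM j _)) //; lia.
pose nu i := Re (k (u i) (u 0%N)).
have nuE i : (i <= (size p).-1)%N -> k (u i) x = (nu i)%:C.
  move=> ip; rewrite -u0; apply: conj_self; rewrite -(sesqC krein_herm).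
  by rewrite (ksym _ _ 0%N i uM).
have -> : k (\sum_(i < size p) (p`_i)%:C *: u i) x = (Lambda nu p)%:C.
  rewrite (herm_suml krein_herm) /Lambda rmorph_sum; apply: eq_bigr => i _.
  rewrite kreinZl nuE ?rmorphM //; have := ltn_ord i; lia.
rewrite ler0c.
have LX mu (r : {poly R}) m : Lambda mu ('X^m * r) = Lambda (fun i => mu (m + i)%N) r.
  rewrite (@LambdaE _ _ _ (m + size r)); last first.
    by rewrite (leq_trans (size_polyMleq _ _)) // size_polyXn.
  rewrite big_split_ord /= big1 ?add0r => [|i _]; last by rewrite coefXnM ltn_ord mul0r.
  by apply: eq_bigr => i _; rewrite coefXnM ltnNge leq_addr addKn.
have Lq mu : Lambda mu q = Lambda (fun i => mu i.+1 - l0 * mu i) c.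
  rewrite /Lambda szq.
  rewrite (eq_bigr (fun i : 'I_(size c).+1 => ('X * c)`_i * mu i - l0 * (c`_i * mu i))).
    rewrite sumrB -mulr_sumr big_ord_recl [X in _ - _ * X]big_ord_recr /=.
    rewrite coefXM /= mul0r add0r nth_default // mul0r addr0 mulr_sumr -sumrB.
    by apply: eq_bigr => i _; rewrite coefXM /=; ring.
  by move=> i _; rewrite /q mulrBl coefB coefCM; ring.
rewrite /p LX Lq; pose w i := u (N + i)%N.
have wM : chain M N w by move=> i iN; rewrite /w addnS; apply: uM; lia.
have := cp w wM; rewrite /Lambda; congr (_ <= _); apply: eq_bigr => -[i ic] _ /=.
congr (_ * _); rewrite /moment /w /nu.
rewrite (hermBl krein_herm) (hermZl krein_herm) ReD ReN ReZ addn0.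
rewrite (ksym _ _ (N + i.+1)%N _ uM); last by lia.
rewrite (ksym _ _ (N + i)%N _ uM); last by lia.
by congr (Re (k (u _) _) - _ * Re (k (u _) _)); lia.
Qed.

Lemma eigenvectors_free n (lam : 'I_n -> C) (z : 'I_n -> V) (c : 'I_n -> C) :
  injective lam -> (forall i, z i != 0) -> (forall i, M (z i, lam i *: z i)) ->
  \sum_i c i *: z i = 0 -> forall i, c i = 0.
Proof.
elim: n lam z c => [|n IH] lam z c li z0 zM s0 i; first by case: i.
have s1 : \sum_i c i *: (lam i *: z i) = 0.
  apply: krein_functional; rewrite -{1}s0.
  by apply: (subspace_sum krein_subspace c (y := fun j => lam j *: z j)).
have cw j : c (widen_ord (leqnSn n) j) = 0.
  have wi : injective (widen_ord (leqnSn n)) by move=> a b [] /val_inj.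
  have := IH (lam \o widen_ord (leqnSn n)) (z \o widen_ord (leqnSn n))
    (fun j => c (widen_ord (leqnSn n) j) * (lam (widen_ord (leqnSn n) j) - lam ord_max)).
  move=> /(_ (inj_comp li wi) (fun=> z0 _) (fun=> zM _)) h.
  have /eqP : c (widen_ord (leqnSn n) j)
      * (lam (widen_ord (leqnSn n) j) - lam ord_max) = 0.
    apply: h.
    have : \sum_i (c i * (lam i - lam ord_max)) *: z i = 0.
      under eq_bigr => a _ do rewrite mulrBr scalerBl -scalerA [c a * lam ord_max]mulrC -scalerA.
      by rewrite sumrB s1 -scaler_sumr s0 scaler0 subrr.
    by rewrite big_ord_recr /= subrr mulr0 scale0r addr0.
  rewrite mulf_eq0 subr_eq0 => /orP[/eqP //|/eqP/li/(congr1 val) /= jn].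
  by have := ltn_ord j; rewrite jn ltnn.
have clast : c ord_max = 0.
  move: s0; rewrite big_ord_recr /= big1 ?add0r => [|a _]; last by rewrite cw scale0r.
  by move/eqP; rewrite scaler_eq0 (negPf (z0 _)) orbF => /eqP.
have [i0|i0] := ltnP i n.
  have -> : i = widen_ord (leqnSn n) (Ordinal i0) by apply: val_inj.
  exact: cw.
have -> // : i = ord_max by apply: val_inj => /=; have := ltn_ord i; lia.
Qed.

(* Eigenvectors for eigenvalues that are pairwise not conjugate span a subspace
   on which both [k] and [k ((M - l0) . , .)] vanish. *)
Lemma few_nonreal_eigenvalues (lam : 'I_kappa.+1 -> C) (z : 'I_kappa.+1 -> V) :
  injective lam -> (forall i j, lam i != Num.conj (lam j)) ->
  (forall i, z i != 0) -> ~ (forall i, M (z i, lam i *: z i)).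
Proof.
move=> li lc z0 zM.
have k0 i j : k (z i) (z j) = 0.
  have := krein_sym (zM i) (zM j); rewrite kreinZl (hermZr krein_herm) => /eqP.
  rewrite -subr_eq0 -mulrBl mulf_eq0 subr_eq0 (negPf (lc i j)) /=; exact/eqP.
(* With [kappa + 1] vectors against [kappa] functionals, some nontrivial combination is orthogonal
   to all [e l], where the finite rank term of [krein_pos] vanishes. *)
pose Phi : 'M[C]_(kappa.+1, kappa) := \matrix_(i, l) f (z i) (e l).
have [c [cPhi cn0]] : exists c : 'rV[C]_kappa.+1, c *m Phi = 0 /\ c != 0.
  have K0 : kermx Phi != 0.
    rewrite kermx_eq0; apply/negP => /eqP rP.
    by have := rank_leq_col Phi; rewrite rP ltnn.
  exists (nz_row (kermx Phi)); rewrite nz_row_eq0; split=> //.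
  by apply/sub_kermxP; exact: nz_row_sub.
pose x := \sum_i c 0 i *: z i; pose y := \sum_i c 0 i *: (lam i *: z i).
have xM : M (x, y) by apply: (subspace_sum krein_subspace (c 0) (y := fun j => lam j *: z j)).
have fx l : f x (e l) = 0.
  have := congr1 (fun Z : 'rV[C]_kappa => Z 0 l) cPhi; rewrite !mxE => <-.
  rewrite /x (herm_suml fp); apply: eq_bigr => i _.
  by rewrite (hermZl fp) mxE.
have kz i : k (z i) x = 0.
  by rewrite /x (herm_sumr krein_herm) big1 // => j _; rewrite (hermZr krein_herm) k0 mulr0.
have kx : k x x = 0.
  by rewrite {1}/x (herm_suml krein_herm) big1 // => j _; rewrite kreinZl kz mulr0.
have ky : k y x = 0.
  rewrite /y (herm_suml krein_herm) big1 // => j _.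
  by rewrite !kreinZl kz !mulr0.
have x0 : x = 0.
  apply: (hilbert_def fp); apply/le_anti; rewrite (nonneg_ge0 fp) andbT.
  rewrite -(pmulr_rle0 _ delta0) (le_trans (krein_pos xM)) //.
  rewrite (hermBl krein_herm) kreinZl kx ky mulr0 subrr /= add0r big1 // => l _.
  by rewrite fx normc0 expr0n.
case/eqP: cn0; apply/rowP => i; rewrite mxE.
exact: (eigenvectors_free li z0 zM x0).
Qed.

Definition eigenvalue_of (l : C) : Prop := exists2 x, x != 0 & M (x, l *: x).

Lemma finite_nonreal_eigenvalues :
  finite_set [set l | eigenvalue_of l /\ Im l != 0].
Proof.
have half (P : set C) : (forall l l', P l -> P l' -> l != Num.conj l') ->
    finite_set [set l | eigenvalue_of l /\ P l].
  move=> Pc; apply: contrapT => /(infinite_set_fset kappa.+1) [B BP Bk].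
  pose s : seq C := B.
  have sz : (kappa.+1 <= size s)%N by [].
  pose lam (i : 'I_kappa.+1) := nth 0 s i.
  have lamP i : eigenvalue_of (lam i) /\ P (lam i).
    by apply: BP; apply: mem_nth; rewrite (leq_trans (ltn_ord i)).
  have /choice[z zP] i : exists z, z != 0 /\ M (z, lam i *: z).
    by have [[z z0 zM] _] := lamP i; exists z.
  apply: (@few_nonreal_eigenvalues lam z) => [i j|i j|i|i].
  - move=> /eqP; rewrite nth_uniq ?fset_uniq ?(leq_trans (ltn_ord _)) //.
    by move=> /eqP/val_inj.
  - by apply: Pc; [exact: (lamP i).2|exact: (lamP j).2].
  - exact: (zP i).1.
  - exact: (zP i).2.
have Im_conj l : Im (Num.conj l) = - Im l by case: l.
apply: (@sub_finite_set _ _ ([set l | eigenvalue_of l /\ 0 < Im l] `|`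
    [set l | eigenvalue_of l /\ Im l < 0])) => [l [le l0']|].
  by move: l0'; rewrite neq_lt => /orP[h|h]; [right|left].
rewrite finite_setU; split; apply: (half [set l | _]) => l l' /= h h'; apply/eqP.
  by move=> /(congr1 Im); rewrite Im_conj; lra.
by move=> /(congr1 Im); rewrite Im_conj; lra.
Qed.

(** * Resolvent at nonreal points that are not eigenvalues *)

Section Resolvent.
Variable l : C.
Hypothesis l_nonreal : Im l != 0.
Hypothesis l_not_eigen : ~ eigenvalue_of l.
Let mu : C := l - l0%:C.

Let Im_mu : Im mu = Im l.
Proof. by rewrite /mu; case: (l) => a b /=; rewrite oppr0 addr0. Qed.

(* The graph of [J W - m]. *)
Let T (m : C) : set (V * V) := [set p | W (p.1, J (p.2 + m *: p.1))].

(** Write [y = W x] and [z = (J W - m) x]. Both [<y, J y>] and [<y, x>] are real, so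
    [Im <y, z> = Im m <y, x>]. Positivity of [W] then bounds [|x|^2] by a multiple of [|y| |z|], and
    [|y| <= |z| + |m| |x|]. *)
Let T_bounded m : Im m != 0 -> exists2 c, 0 <= c &
  forall x z, T m (x, z) -> nm f x <= c * nm f z.
Proof.
move=> m0; pose a := `|Im m| * delta; pose b := normc m.
have a0 : 0 < a by rewrite mulr_gt0 // normr_gt0.
have b0 : 0 <= b by exact: normc_ge0.
(* The last summand makes [c >= 1], so that failure of the bound implies [|z| <= |x|]. *)
pose c := (b + 1) / a + 1.
have c1 : 1 <= c by rewrite lerDr divr_ge0 ?(ltW a0) // addr_ge0.
exists c => [|x z]; first exact: le_trans c1.
rewrite /T /=; set y := J _ => Wxy.
have Jy : J y = z + m *: x by rewrite /y JK.
have yy : f y (J y) = (Re (f y (J y)))%:C.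
  by apply: conj_self; rewrite -(sesqC fp) Jsym.
have yx : f y x = (Re (f y x))%:C.
  by apply: conj_self; rewrite -(sesqC fp) (sa_sym Wsa Wxy Wxy).
have e1 : Im (f y z) = Im m * Re (f y x).
  have : Im (f y (J y)) = 0 by rewrite yy.
  rewrite Jy (hermDr fp) (hermZr fp) yx; case: (f y z) => u v /=.
  by case: (m) => p q /=; lra.
have h1 : a * nm f x ^+ 2 <= nm f y * nm f z.
  rewrite (le_trans _ (cauchy_schwarz fp y z)) // (le_trans _ (normc_Im_le _)) //.
  rewrite e1 normrM /a -mulrA ler_wpM2l // (nm_sqr fp) (le_trans (Wpos Wxy)) //.
  exact: ler_norm.
have h2 : nm f y <= nm f z + b * nm f x.
  by rewrite -[nm f y]nmJ Jy (le_trans (nmD fp _ _)) // (nmZ fp).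
have x0 := nm_ge0 f x; have z0 := nm_ge0 f z.
rewrite leNgt; apply/negP => h.
have zx : nm f z <= nm f x by rewrite (le_trans _ (ltW h)) // ler_peMl.
have xp : 0 < nm f x by rewrite (le_lt_trans _ h) // mulr_ge0 // (le_trans _ c1).
have h3 : a * nm f x ^+ 2 <= (b + 1) * nm f z * nm f x.
  by have := ler_wpM2r z0 h2; have := ler_wpM2r z0 zx; lra.
move: h3; rewrite expr2 mulrA ler_pM2r // => h3.
have h4 : (b + 1) * nm f z = a * ((c - 1) * nm f z).
  by rewrite /c addrK [(b + 1) / a]mulrC !mulrA divff ?mul1r // gt_eqF.
move: h3; rewrite h4 ler_pM2l // => h3.
have : c * nm f z <= nm f x.
  exact: ltW.
by nra.
Qed.

Let T_closed m : adherent f f (T m) `<=` T m.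
Proof.
move=> [x z] h; apply: (sa_closed fp Wsa) => eps e0 /=.
have c0 : 0 < normc m + 2 by have := normc_ge0 m; lra.
have [x' [z' [T' /= xx zz]]] := h (eps / (normc m + 2)) (divr_gt0 e0 c0).
move: xx zz; rewrite !ltr_pdivlMr // => xx zz.
have p1 := nm_ge0 f (x - x'); have p2 := nm_ge0 f (z - z'); have p3 := normc_ge0 m.
exists x', (J (z' + m *: x')); split => //; first by nra.
rewrite -JB nmJ opprD addrACA -scalerBr (le_lt_trans (nmD fp _ _)) // (nmZ fp).
nra.
Qed.

Let T_subspace m : Defs.subspace (T m).
Proof.
have [W0 WD] := sa_subspace Wsa; split.
  by rewrite /T /= scaler0 addr0 J0.
move=> c p q hp hq; rewrite /T /=; have := WD c _ _ hp hq.
congr W; congr pair; rewrite /= -Jlin; congr J.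
by rewrite !scalerDr !scalerA [c * _]mulrC addrACA.
Qed.

(** If [u] is orthogonal to the range of [J W - m], then [J u] is in the kernel of [J W - conj m],
    which is trivial by the same bound. *)
Let T_onto m : Im m != 0 -> forall z, exists x, T m (x, z).
Proof.
move=> m0; have [c c0 Tb] := T_bounded m0.
apply: (closed_onto fp (T_subspace m) (T_closed (m := m)) Tb) => u h.
have Wu : W (J u, Num.conj m *: u).
  apply/(sa_adj Wsa) => x y Wxy.
  have : T m (x, J y - m *: x) by rewrite /T /= subrK JK.
  move=> /h; rewrite (hermBl fp) (hermZl fp) => /eqP; rewrite subr_eq0 => /eqP e1.
  by rewrite (hermZr fp) conjK -Jsym.
have m0' : Im (Num.conj m) != 0 by case: (m) m0 => p q /=; rewrite oppr_eq0.
have [c' c0' Tb'] := T_bounded m0'.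
have : T (Num.conj m) (J u, 0) by rewrite /T /= add0r JZ JK.
move=> /Tb'; rewrite (nm0 fp) mulr0 nmJ => u0.
apply: (hilbert_def fp); rewrite -(nm_sqr fp); apply/eqP; rewrite sqrf_eq0.
by rewrite eq_le u0 nm_ge0.
Qed.

(* [M - l = J W - mu - J F] is a finite rank perturbation of [J W - mu], so
   that it is invertible as soon as it is injective. *)
Lemma nonreal_resolvent : exists S : V -> V, (exists2 c, 0 <= c &
    forall z, nm f (S z) <= c * nm f z) /\
  forall x z, S z = x <-> exists2 y, M (x, y) & z = y - l *: x.
Proof.
have mu0 : Im mu != 0 by rewrite Im_mu.
have [c c0 Tb] := T_bounded mu0.
have /choice[Y YT] := T_onto mu0.
have Tu x z : T mu (x, z) -> x = Y z.
  move=> h; have [_ TD] := T_subspace mu.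
  have := TD (-1) _ _ (YT z) h; rewrite -[_ *: _ + _]/(_ *: _ + _, _ *: _ + _) /=.
  rewrite !scaleN1r addNr => /Tb; rewrite (nm0 fp) mulr0 => d0.
  apply/eqP; rewrite -subr_eq0 addrC; apply/eqP/(hilbert_def fp).
  by rewrite -(nm_sqr fp); apply/eqP; rewrite sqrf_eq0 eq_le d0 nm_ge0.
have Ylin a x z : Y (a *: x + z) = a *: Y x + Y z.
  by apply/esym/Tu; have [_ TD] := T_subspace mu; exact: (TD a _ _ (YT x) (YT z)).
have Y0 : Y 0 = 0.
  have := Ylin 1 0 0; rewrite scaler0 addr0 scale1r => /eqP.
  by rewrite -subr_eq subrr eq_sym => /eqP.
have YD x z : Y (x + z) = Y x + Y z by rewrite -[x in LHS]scale1r Ylin scale1r.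
have YZ a x : Y (a *: x) = a *: Y x by rewrite -[a *: x]addr0 Ylin Y0 addr0.
have Ysum (F : 'I_kappa -> V) : Y (\sum_i F i) = \sum_i Y (F i).
  exact: (big_morph Y YD Y0).
have Jsum (F : 'I_kappa -> V) : J (\sum_i F i) = \sum_i J (F i).
  exact: (big_morph J JD J0).
(* The equation [(M - l) x = z] becomes [x = Y (z + J F x)], in which only the finitely many numbers
   [<x, e_j>] are unknown. *)
have MY x z : (exists2 y, M (x, y) & z = y - l *: x) <-> x = Y (z + J (frank x)).
  have e1 y : z = y - l *: x -> y - l0%:C *: x = z + mu *: x.
    by move=> ->; rewrite /mu scalerBl addrA subrK.
  split=> [[y yM ze]|xY].
    by apply: Tu; rewrite /T /= addrAC JD JK; move: yM; rewrite /krein_op /= (e1 _ ze).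
  exists (z + l *: x); last by rewrite addrK.
  have hY := YT (z + J (frank x)); rewrite -xY /T /= addrAC JD JK in hY.
  by rewrite /krein_op /= -[z + _ - _]addrA -scalerBl.
pose h i := Y (J (e i)).
have YJF x : Y (J (frank x)) = \sum_i f x (e i) *: h i.
  by rewrite /frank Jsum Ysum; apply: eq_bigr => i _; rewrite JZ YZ.
pose Theta : 'M[C]_kappa := \matrix_(i, j) f (h i) (e j).
have ThetaE (al : 'rV[C]_kappa) j :
    f (\sum_i al 0 i *: h i) (e j) = (al *m Theta) 0 j.
  rewrite (herm_suml fp) mxE; apply: eq_bigr => i _.
  by rewrite (hermZl fp) mxE.
(* A null row [al] gives [x = \sum_i al_i h_i] with [x = Y J F x]: an eigenvector for [l], unless
   [x = 0] and hence [al = 0]. *)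
have Qu : 1%:M - Theta \in unitmx.
  rewrite -row_free_unit -kermx_eq0; apply/eqP/row_matrixP => i; rewrite row0.
  have := row_sub i (kermx (1%:M - Theta)); set al := row i _.
  move=> /sub_kermxP; rewrite mulmxBr mulmx1 => /eqP; rewrite subr_eq0 => /eqP alT.
  pose x := \sum_i al 0 i *: h i.
  have fx j : f x (e j) = al 0 j by rewrite ThetaE -alT.
  have x0 : x = 0.
    apply: contrapT => /eqP xn0; apply: l_not_eigen; exists x => //.
    have [|y yM /esym/eqP] := (MY x 0).2; last by rewrite subr_eq0 => /eqP <-.
    by rewrite add0r YJF /x; apply: eq_bigr => j _; rewrite fx.
  by apply/rowP => j; rewrite -fx x0 (herm0l fp) mxE.
pose Q := invmx (1%:M - Theta).
pose beta z : 'rV[C]_kappa := \row_j f (Y z) (e j).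
exists (fun z => Y z + \sum_i (beta z *m Q) 0 i *: h i); split; last first.
  move=> x z; rewrite MY YD YJF; split=> [<-|xE].
    congr (_ + _); apply: eq_bigr => j _; congr (_ *: _).
    have bj : f (Y z) (e j) = beta z 0 j by rewrite mxE.
    rewrite (hermDl fp) ThetaE bj.
    have : beta z *m Q *m (1%:M - Theta) = beta z by rewrite mulmxKV.
    rewrite mulmxBr mulmx1 => /eqP; rewrite subr_eq => /eqP h1.
    by rewrite [LHS](congr1 (fun Z : 'rV[C]_kappa => Z 0 j) h1) [LHS]mxE.
  pose al : 'rV[C]_kappa := \row_j f x (e j).
  have alE : al *m (1%:M - Theta) = beta z.
    rewrite mulmxBr mulmx1; apply/eqP; rewrite subr_eq; apply/eqP/rowP => j.
    rewrite [LHS]mxE [RHS]mxE -ThetaE [beta z _ _]mxE -(hermDl fp); congr f.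
    by rewrite {1}xE; congr (_ + _); apply: eq_bigr => i _; rewrite mxE.
  rewrite [RHS]xE; congr (_ + _); apply: eq_bigr => j _; congr (_ *: _).
  by rewrite -alE mulmxK // mxE.
exists (c + \sum_i (\sum_j c * nm f (e j) * normc (Q j i)) * nm f (h i)).
  rewrite addr_ge0 // sumr_ge0 // => i _; rewrite mulr_ge0 ?nm_ge0 //.
  by rewrite sumr_ge0 // => j _; rewrite !mulr_ge0 ?nm_ge0 ?normc_ge0.
move=> z; have Yz : nm f (Y z) <= c * nm f z by exact: Tb.
rewrite (le_trans (nmD fp _ _)) // mulrDl lerD // (le_trans (nm_sum fp _ _ _)) //.
rewrite mulr_suml; apply: ler_sum => i _; rewrite (nmZ fp) mulrAC.
rewrite ler_wpM2r ?nm_ge0 // mxE (le_trans (normc_sum _ _ _)) // mulr_suml.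
apply: ler_sum => j _; rewrite normcM mulrAC ler_wpM2r ?normc_ge0 // mxE.
rewrite (le_trans (cauchy_schwarz fp _ _)) // mulrAC.
by rewrite ler_wpM2r ?nm_ge0.
Qed.

End Resolvent.

End FinitelyManyNegativeSquares.

(** * Uniform boundedness *)

Section GlidingHump.
Context {R : realType} (V : lmodType R[i]) (I : Type).
Local Notation C := R[i].
Variables (N : V -> R) (p : I -> V -> R).
Hypothesis ND : forall x y, N (x + y) <= N x + N y.
Hypothesis NZ : forall (r : R) x, N (r%:C *: x) = `|r| * N x.
Hypothesis pD : forall i x y, p i (x + y) <= p i x + p i y.
Hypothesis pZ : forall i (r : R) x, p i (r%:C *: x) = `|r| * p i x.
Hypothesis pN : forall i, exists k, forall x, p i x <= k * N x.

Let NN x : N (- x) = N x.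
Proof.
have := NZ (-1) x; rewrite normrN1 mul1r => <-; congr N.
by rewrite -scaleN1r rmorphN1.
Qed.

Let pNN i x : p i (- x) = p i x.
Proof.
have := pZ i (-1) x; rewrite normrN1 mul1r => <-; congr (p i).
by rewrite -scaleN1r rmorphN1.
Qed.

Let N0 : N 0 = 0.
Proof. by have := NZ 0 0; rewrite normr0 mul0r scaler0. Qed.

Let N_ge0 x : 0 <= N x.
Proof. by have := ND x (- x); rewrite subrr N0 NN; lra. Qed.

Let p0 i : p i 0 = 0.
Proof. by have := pZ i 0 0; rewrite normr0 mul0r scaler0. Qed.

Let p_ge0 i x : 0 <= p i x.
Proof. by have := pD i x (- x); rewrite subrr p0 pNN; lra. Qed.

(** [s] is the operator seminorm of [p i], attained by [h] up to a quarter. On null vectors of [N],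
    [p i] vanishes by [pN]. *)
Let almost_norming i (x : V) (K : R) : 0 <= K -> K * N x < p i x ->
  exists h s, [/\ N h <= 1, 3 / 4 * s <= p i h, K <= s & forall y, p i y <= s * N y].
Proof.
move=> K0 Kx; have [k kP] := pN i.
have nz y : N y = 0 -> p i y = 0.
  by move=> y0; apply/le_anti; rewrite p_ge0 andbT (le_trans (kP y)) // y0 mulr0.
have unit y : N y != 0 -> N ((N y)^-1%:C *: y) = 1 /\
    p i ((N y)^-1%:C *: y) = p i y / N y.
  move=> y0; rewrite NZ pZ ger0_norm ?invr_ge0 ?N_ge0 //.
  by rewrite mulVf // mulrC.
pose S := [set p i y | y in [set y | N y <= 1]].
have S0 : S !=set0 by exists (p i 0), 0 => //=; rewrite N0.
have Sub : has_ubound S.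
  exists `|k| => _ [y /= y1 <-]; rewrite (le_trans (kP y)) //.
  rewrite (le_trans (ler_wpM2r (N_ge0 y) (ler_norm k))) //.
  by rewrite ler_piMr.
pose s := sup S.
have sP y : N y <= 1 -> p i y <= s by move=> y1; apply: ub_le_sup => //; exists y.
have sN y : p i y <= s * N y.
  have [y0|y0] := eqVneq (N y) 0; first by rewrite nz // y0 mulr0.
  have yp : 0 < N y by rewrite lt_def y0 N_ge0.
  have [u1 u2] := unit y y0.
  have := sP ((N y)^-1%:C *: y); rewrite u1 u2 lexx => /(_ isT).
  by rewrite ler_pdivrMr.
have x0 : N x != 0.
  by apply/eqP => x0; move: Kx; rewrite nz // x0 mulr0 ltxx.
have xp : 0 < N x by rewrite lt_def x0 N_ge0.
have Ks : K < s.
  have := lt_le_trans Kx (sN x); by rewrite ltr_pM2r.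
have sp : 0 < s by rewrite (le_lt_trans K0).
have s4 : 0 < s / 4 by lra.
have [_ [h h1 <-] hs] := sup_adherent s4 (conj S0 Sub).
by exists h, s; split => //; [rewrite -/s in hs; lra|exact: ltW].
Qed.

(* Sokal's gliding hump proof of the uniform boundedness principle; completeness
   is only used along sequences with geometrically small increments. *)
Lemma gliding_hump :
  (forall u : nat -> V, (forall n k, N (u (n + k)%N - u n) <= 2 * 3^-1 ^+ n) ->
     exists K : R, forall i n, exists2 m, (n <= m)%N & p i (u m) <= K) ->
  exists2 K, 0 <= K & forall i x, p i x <= K * N x.
Proof.
move=> complete; apply: contrapT => unb.
(* With steps of size [3^-n], the hump yields [3/4 s 3^-n] and all later steps take back at most
   half of [s 3^-n]. A quarter remains, which the threshold makes at least [n]. *)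
have /choice[ihs ihsP] (n : nat) : exists t : I * V * R,
    [/\ N t.1.2 <= 1, 3 / 4 * t.2 <= p t.1.1 t.1.2, 4 * n%:R * 3 ^+ n <= t.2 &
        forall y, p t.1.1 y <= t.2 * N y].
  pose K : R := 4 * n%:R * 3 ^+ n.
  have K0 : 0 <= K by rewrite !mulr_ge0 // exprn_ge0.
  have [i [x Kx]] : exists i x, K * N x < p i x.
    apply: contrapT => h; apply: unb; exists K => // i x.
    by rewrite leNgt; apply/negP => hx; apply: h; exists i, x.
  have [h [s [h1 hs Ks sN]]] := almost_norming K0 Kx.
  by exists (i, h, s).
pose i n := (ihs n).1.1; pose h n := (ihs n).1.2; pose s n := (ihs n).2.
pose r n : R := 3^-1 ^+ n.
have r0 n : 0 < r n by rewrite exprn_gt0 // invr_gt0.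
(* Since [2 w] is the difference of [v + w] and [v - w], one of them has seminorm at least that of
   [w]. *)
pose step n v := let w := (r n)%:C *: h n in
  if r n * p (i n) (h n) <= p (i n) (v + w) then v + w else v - w.
pose u := fix u n := if n is m.+1 then step m (u m) else 0.
have uS n : u n.+1 = step n (u n) by [].
have uN n : N (u n.+1 - u n) <= r n.
  have hn : N ((r n)%:C *: h n) <= r n.
    by rewrite NZ ger0_norm ?(ltW (r0 n)) // ler_piMr ?(ltW (r0 n)) //; case: (ihsP n).
  rewrite uS /step; case: ifP => _; first by rewrite addrAC subrr add0r.
  by rewrite addrAC subrr add0r NN.
have up n : r n * p (i n) (h n) <= p (i n) (u n.+1).
  rewrite uS /step; case: ifP => // /negbT; rewrite -ltNge => lt1.
  set w := _ *: h n in lt1 *.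
  have := pD (i n) (u n + w) (- (u n - w)).
  rewrite pNN opprB addrC addrA subrK => h1.
  have : p (i n) (w + w) = 2 * (r n * p (i n) (h n)).
    have -> : w + w = (2 * r n)%:C *: h n.
      by rewrite /w -scalerDl -rmorphD; congr (_%:C *: _); ring.
    by rewrite pZ ger0_norm ?mulr_ge0 ?(ltW (r0 n)) // mulrA.
  by lra.
have rS n : r n.+1 = r n / 3 by rewrite /r exprSr.
have utail n k : N (u (n + k)%N - u n) <= 3 / 2 * (r n - r (n + k)%N).
  elim: k => [|k IH]; first by rewrite addn0 !subrr N0 mulr0.
  have := ND (u (n + k.+1)%N - u (n + k)%N) (u (n + k)%N - u n).
  rewrite addrA subrK addnS => h1; have := uN (n + k)%N; rewrite rS; lra.
have [|K hK] := complete u.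
  by move=> n k; have := utail n k; have := r0 (n + k)%N; have := r0 n; rewrite -/(r n); lra.
have [n Kn] : exists n : nat, K < n%:R.
  by exists (Num.truncn K).+1; rewrite Num.Theory.truncnS_gt.
have [m nm um] := hK (i n) n.+1.
have [h1 hs sn sN] := ihsP n; rewrite -/(h n) -/(i n) -/(s n) in h1 hs sn sN.
have e1 : p (i n) (u n.+1) <= p (i n) (u m) + p (i n) (u m - u n.+1).
  by have := pD (i n) (u m) (- (u m - u n.+1)); rewrite pNN opprB addrCA subrr addr0.
have e2 := sN (u m - u n.+1).
have e3 := utail n.+1 (m - n.+1)%N; rewrite subnKC // rS in e3.
have s0 : 0 <= s n by rewrite (le_trans _ sn) // !mulr_ge0 // exprn_ge0.
have e4 : s n * N (u m - u n.+1) <= s n * (r n / 2).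
  by apply: ler_wpM2l => //; have := r0 m; lra.
have e5 : r n * (3 / 4 * s n) <= r n * p (i n) (h n) by rewrite ler_wpM2l // ltW.
have e6 := up n.
have e7 : r n * (4 * n%:R * 3 ^+ n) <= r n * s n by rewrite ler_wpM2l // ltW.
have e8 : r n * (4 * n%:R * 3 ^+ n) = 4 * n%:R.
  by rewrite mulrCA /r exprVn mulVf ?mulr1 // expf_neq0.
by rewrite e8 in e7; lra.
Qed.

End GlidingHump.

(** * The form of a semibounded operator *)

Section Energy.
Context {R : realType} (V1 V2 : lmodType R[i]).
Local Notation C := R[i].
Local Notation Re := (@complex.Re R).
Variables (f1 : V1 -> V1 -> C) (f2 : V2 -> V2 -> C).
Hypotheses (fp1 : hilbert_sesq f1) (fp2 : hilbert_sesq f2).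
Variables (A : set (V1 * V1)) (B : set (V2 * V1)) (c : R).
Hypothesis As : selfadj f1 A.
Hypothesis Ac : forall x a, A (x, a) -> Re (f1 x x) <= Re (f1 a x) + c * Re (f1 x x).

(** The square of the form norm of [A] at [x], for [a = A x]. *)
Definition energy (x a : V1) : R := Re (f1 a x) + c * Re (f1 x x).

Let shift_energy x a : Re (f1 (a + c%:C *: x) x) = energy x a.
Proof. by rewrite (hermDl fp1) (hermZl fp1) ReD ReZ. Qed.

Let shift_bound x a : A (x, a) -> nm f1 x <= 1 * nm f1 (a + c%:C *: x).
Proof.
move=> /Ac h; rewrite mul1r -[nm f1 x]mul1r; apply: (form_lower_bound fp1).
by rewrite mul1r shift_energy.
Qed.

(** [Rs] is [(A + c)^-1]. The form [<Rs y, z>] gives [y] the form norm of [Rs y], so that the form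
    norm can be handled on all of [V1]. *)
Lemma positive_resolvent : exists Rs : V1 -> V1,
  [/\ forall z, A (Rs z, z - c%:C *: Rs z),
      forall x a, A (x, a) -> Rs (a + c%:C *: x) = x,
      nonneg_sesq (fun y z => f1 (Rs y) z) &
      forall y, nm f1 (Rs y) <= nm (fun y z => f1 (Rs y) z) y].
Proof.
pose F (x : V1) := (- c%:C) *: x.
have Fl a x y : F (a *: x + y) = a *: F x + F y.
  by rewrite /F scalerDr !scalerA mulrC.
have Fs x y : f1 (F x) y = f1 x (F y).
  by rewrite /F (hermZl fp1) (hermZr fp1) conjN conjR.
have Ts := sa_perturb fp1 As Fl Fs.
have Tb x y : A (x, y + F x) -> nm f1 x <= 1 * nm f1 y.
  by move=> /shift_bound; rewrite /F scaleNr subrK.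
have /choice[Rs RsP] := sa_onto fp1 Ts Tb.
have RsA z : A (Rs z, z - c%:C *: Rs z) by have := RsP z; rewrite /F /= scaleNr.
have Tu x z : A (x, z - c%:C *: x) -> Rs z = x.
  move=> h; have := subspace_sub (sa_subspace As) (RsA z) h.
  move=> h2; apply/eqP; rewrite -subr_eq0; have := shift_bound h2.
  have -> : z - c%:C *: Rs z - (z - c%:C *: x) + c%:C *: (Rs z - x) = 0.
    rewrite opprB [z - _ + _]addrC addrA subrK scalerBr.
    by rewrite addrA subrK subrr.
  rewrite (nm0 fp1) mulr0 => h3.
  apply/eqP/(hilbert_def fp1); rewrite -(nm_sqr fp1); apply/eqP; rewrite sqrf_eq0.
  by rewrite eq_le h3 nm_ge0.
have RsK x a : A (x, a) -> Rs (a + c%:C *: x) = x.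
  by move=> h; apply: Tu; rewrite addrK.
have Rsl a y z : Rs (a *: y + z) = a *: Rs y + Rs z.
  apply: Tu; have := subspace_lin (sa_subspace As) a (RsA y) (RsA z).
  congr (A (_, _)); rewrite !scalerDr scalerN !scalerA [a * _]mulrC opprD.
  by rewrite addrACA.
have Rss y z : f1 (Rs y) z = f1 y (Rs z).
  have := sa_sym As (RsA y) (RsA z).
  rewrite (hermBl fp1) (hermBr fp1) (hermZl fp1) (hermZr fp1) conjR.
  by move=> /addIr ->.
have Rh : hermitian_sesq (fun y z => f1 (Rs y) z).
  split=> [a x y z|x y]; first by rewrite Rsl (sesqP fp1).
  by rewrite Rss (sesqC fp1 (Rs x)).
have RE y : Re (f1 (Rs y) y) = energy (Rs y) (y - c%:C *: Rs y).
  by rewrite -shift_energy subrK Rss.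
have Rp y : nm f1 (Rs y) ^+ 2 <= Re (f1 (Rs y) y).
  by rewrite RE (nm_sqr fp1); exact: Ac.
have Rn : nonneg_sesq (fun y z => f1 (Rs y) z).
  by split=> // y; rewrite (le_trans _ (Rp y)) // sqr_ge0.
exists Rs; split => // y.
by rewrite -ler_sqr ?nnegrE ?nm_ge0 // (nm_sqr Rn).
Qed.

Hypothesis Bsub : Defs.subspace B.
Hypothesis Bd : forall x, adherent_in f2 (dom B) x.
Local Notation Bst := (adjoint f2 f1 B).
(** Closedness of the form of [A] and the inclusion of its domain in that of [B^*], merged so that
    the form itself does not appear. *)
Hypothesis form_closedness : forall (u a : nat -> V1) x,
  (forall n, A (u n, a n)) -> seq_cvg f1 u x ->
  (forall eps : R, 0 < eps -> exists N, forall m n, (N <= m)%N -> (N <= n)%N ->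
     `|Re (f1 (a m - a n) (u m - u n))| < eps) ->
  exists w, Bst (x, w).

Lemma dom_adjoint x a : A (x, a) -> exists w, Bst (x, w).
Proof.
move=> h; apply: (form_closedness (u := fun=> x) (a := fun=> a)) => //.
  by move=> eps e0; exists 0%N => n _; rewrite subrr (nm0 fp1).
by move=> eps e0; exists 0%N => m n _ _; rewrite !subrr (herm0l fp1) /= normr0.
Qed.

(** Uniform boundedness of the functionals [x |-> <x, B b>] with [|b| <= 1], which at each [x] in
    the domain of [B^*] are bounded by [|B^* x|]. *)
Lemma adjoint_energy_bound : exists2 K, 0 <= K & forall x a w,
  A (x, a) -> Bst (x, w) -> nm f2 w ^+ 2 <= K ^+ 2 * energy x a.
Proof.
have [Rs [RsA RsK Rn RsN]] := positive_resolvent.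
set r := fun y z => f1 (Rs y) z in Rn RsN.
pose I := {b : V2 * V1 | B b /\ nm f2 b.1 <= 1}.
pose p (i : I) (y : V1) : R := normc (f1 (Rs y) (sval i).2).
have pD (i : I) x y : p i (x + y) <= p i x + p i y.
  by rewrite /p -/(r (x + y) _) (hermDl Rn) normc_add.
have pZ (i : I) (s : R) x : p i (s%:C *: x) = `|s| * p i x.
  by rewrite /p -/(r (_ *: x) _) (hermZl Rn) normcM normc_real.
have NZ (s : R) x : nm r (s%:C *: x) = `|s| * nm r x by rewrite (nmZ Rn) normc_real.
have pN (i : I) : exists k, forall x, p i x <= k * nm r x.
  exists (nm f1 (sval i).2) => x; rewrite mulrC (le_trans (cauchy_schwarz fp1 _ _)) //.
  by rewrite ler_wpM2r ?nm_ge0.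
have [|K K0 Kp] := gliding_hump (nmD Rn) NZ pD pZ pN.
  move=> u ut; pose x n := Rs (u n); pose a n := u n - c%:C *: Rs (u n).
  have xa n : A (x n, a n) by exact: RsA.
  have Rsub m n : A (x m - x n, a m - a n).
    exact: (subspace_sub (sa_subspace As) (xa m) (xa n)).
  have umn m n : a m - a n + c%:C *: (x m - x n) = u m - u n.
    by rewrite /a scalerBr addrACA -opprD !subrK.
  have Rse m n : Rs (u m - u n) = x m - x n.
    by rewrite -(RsK _ _ (Rsub m n)) umn.
  have small (eps : R) : 0 < eps -> exists n0, forall m n, (n0 <= m)%N -> (n0 <= n)%N ->
      nm r (u m - u n) < eps.
    move=> e0.
    have [n0 hn0] : exists n0 : nat, 4 / eps < n0%:R.
      by exists (Num.truncn (4 / eps)).+1; rewrite Num.Theory.truncnS_gt.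
    have h3 : (3^-1 : R) ^+ n0 * n0%:R <= 1.
      rewrite exprVn mulrC ler_pdivrMr ?exprn_gt0 // mul1r -natrX ler_nat.
      by rewrite ltnW // ltn_expl.
    have h0 : 0 < (3^-1 : R) ^+ n0 by rewrite exprn_gt0 // invr_gt0.
    have h4 : 4 * 3^-1 ^+ n0 < eps.
      move: hn0; rewrite ltr_pdivrMr // => hn0.
      have n0p : 0 < n0%:R :> R.
        by rewrite ltNge; apply/negP => h; move: hn0; have := mulr_le0_ge0 h (ltW e0); lra.
      have := ler_wpM2l (ltW e0) h3; have : 4 * 3^-1 ^+ n0 < (n0%:R * eps) * 3^-1 ^+ n0.
        by rewrite ltr_pM2r.
      lra.
    exists n0 => m n mN nN; have := nm_triangle Rn (u m) (u n0) (u n).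
    have := ut n0 (m - n0)%N; have := ut n0 (n - n0)%N.
    by rewrite !subnKC // (nmB Rn (u n0)); lra.
  have xc m n : nm f1 (x m - x n) <= nm r (u m - u n) by rewrite -Rse.
  have [x0 xx0] : exists x0, seq_cvg f1 x x0.
    apply: (hilbert_complete fp1) => eps /small [n0 h]; exists n0 => m n hm hn.
    by rewrite (le_lt_trans (xc m n)) // h.
  have [|w x0w] := form_closedness xa xx0.
    move=> eps e0; have k0 : 0 < 1 + `|c| by rewrite ltr_wpDr.
    (* The form of [A] differs from the squared form norm by [c |x|^2]; both terms are controlled
       through [e1^2 <= e1]. *)
    pose e1 := Num.min 1 (eps / (1 + `|c|)).
    have e1p : 0 < e1 by rewrite lt_min ltr01 divr_gt0.
    have [n0 h] := small e1 e1p; exists n0 => m n hm hn.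
    have nr := h m n hm hn; have xr := xc m n.
    have e1_1 : e1 <= 1 by rewrite /e1 ge_min lexx.
    have e1_e : e1 * (1 + `|c|) <= eps.
      by rewrite -ler_pdivlMr // /e1 ge_min lexx orbT.
    have -> : Re (f1 (a m - a n) (x m - x n)) =
        nm r (u m - u n) ^+ 2 - c * nm f1 (x m - x n) ^+ 2.
      rewrite (nm_sqr Rn) (nm_sqr fp1) /r Rse (Re_hermC fp1 _ (u m - u n)).
      by rewrite -umn shift_energy /energy addrK.
    have p1 := nm_ge0 r (u m - u n); have p2 := nm_ge0 f1 (x m - x n).
    rewrite (le_lt_trans (ler_normB _ _)) // (normrM c) !(ger0_norm (sqr_ge0 _)).
    have q1 : nm r (u m - u n) ^+ 2 <= e1 * nm r (u m - u n).
      by rewrite expr2 ler_wpM2r // ltW.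
    have q2 : nm f1 (x m - x n) ^+ 2 <= nm r (u m - u n) ^+ 2.
      by rewrite ler_sqr ?nnegrE.
    have q3 : e1 * nm r (u m - u n) < e1 by rewrite gtr_pMr // (lt_le_trans nr).
    have := ler_wpM2l (normr_ge0 c) (le_trans q2 q1).
    have := ler_wpM2l (normr_ge0 c) (ltW q3); lra.
  (* The limit [x0] lies in the domain of [B^*], so [|<x0, B b>| <= |w|] for all [b] at once; the 1
     absorbs the convergence, whose speed depends on [b]. *)
  exists (nm f2 w + 1) => i n0.
  have [n1 h] := cvg_form fp1 (sval i).2 xx0 ltr01.
  exists (maxn n0 n1); first exact: leq_maxl.
  have [Bi i1] := svalP i; have hx := h _ (leq_maxr n0 n1).
  have := x0w (sval i).1 (sval i).2; rewrite -surjective_pairing => /(_ Bi) /= e1.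
  have : normc (f1 x0 (sval i).2) <= nm f2 w.
    rewrite (sesqC fp1 (sval i).2) normc_conj e1 (le_trans (cauchy_schwarz fp2 _ _)) //.
    by rewrite ler_piMl ?nm_ge0.
  have := normc_add (f1 (x (maxn n0 n1)) (sval i).2 - f1 x0 (sval i).2) (f1 x0 (sval i).2).
  rewrite subrK /p -/(x (maxn n0 n1)); move: hx; lra.
exists K => // x a w xa xw.
set y := a + c%:C *: x.
have yx : Rs y = x by exact: RsK.
have ye : nm r y ^+ 2 = energy x a.
  by rewrite (nm_sqr Rn) /r yx (Re_hermC fp1) shift_energy.
rewrite -ye -exprMn ler_sqr ?nnegrE ?nm_ge0 ?mulr_ge0 ?nm_ge0 //.
set L := K * nm r y; have L0 : 0 <= L by rewrite mulr_ge0 ?nm_ge0.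
have key b : dom B b -> normc (f2 b w) <= L * nm f2 b.
  move=> [[b0 b'] Bb /= bb]; subst b0.
  have [b0|b0] := eqVneq (nm f2 b) 0.
    by rewrite b0 mulr0 (le_trans (cauchy_schwarz fp2 _ _)) // b0 mul0r.
  have bp : 0 < nm f2 b by rewrite lt_def b0 nm_ge0.
  pose t := (nm f2 b)^-1.
  have Bt : B (t%:C *: b, t%:C *: b').
    have [B0 BD] := Bsub; have := BD t%:C _ _ Bb B0.
    by rewrite addr0.
  have tb : nm f2 (t%:C *: b) = 1.
    by rewrite (nmZ fp2) normc_real ger0_norm ?invr_ge0 ?nm_ge0 // mulVf.
  have ti : B (t%:C *: b, t%:C *: b') /\ nm f2 (t%:C *: b, t%:C *: b').1 <= 1.
    by rewrite /= tb.
  have := Kp (exist _ _ ti) y; rewrite /p /= yx -/L.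
  rewrite (sesqC fp1 (t%:C *: b')) normc_conj (xw _ _ Bt) (hermZl fp2) normcM normc_real.
  by rewrite ger0_norm ?invr_ge0 ?nm_ge0 // /t ler_pdivrMl // mulrC.
have : nm f2 w * (nm f2 w - L) <= 0.
  apply: (@small_le0 _ _ (L + nm f2 w)) => eps e0.
  have [b Bb wb] := Bd w e0.
  have h1 := key b Bb; have h2 := cauchy_schwarz fp2 (w - b) w.
  have h3 : nm f2 w ^+ 2 <= normc (f2 (w - b) w) + normc (f2 b w).
    rewrite (nm_sqr fp2) (le_trans _ (normc_add _ _)) // -(hermDl fp2) subrK.
    exact: Re_le_normc.
  have h4 := nm_sub_le fp2 b w; rewrite (nmB fp2) in h4.
  have h5 : nm f2 (w - b) * nm f2 w <= eps * nm f2 w by rewrite ler_wpM2r ?nm_ge0 ?ltW.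
  have h6 : L * nm f2 b <= L * (eps + nm f2 w) by rewrite ler_wpM2l //; lra.
  rewrite mulrBr -expr2; lra.
have w0 := nm_ge0 f2 w => h; rewrite leNgt; apply/negP => Lw.
have wp : 0 < nm f2 w by rewrite (le_lt_trans L0).
by move: h; rewrite pmulr_rle0 // subr_le0 leNgt Lw.
Qed.

(** * Compactness of the resolvent as a lower bound up to finite rank *)

Variables (S : V1 -> V1) (l : C).
Hypothesis SA : forall x z, S z = x <-> exists2 y, A (x, y) & z = y - l *: x.
Hypothesis SZ : forall a x, S (a *: x) = a *: S x.
Hypothesis Snet : forall eps : R, 0 < eps -> exists m (e : 'I_m -> V1),
  forall x, nm f1 x <= 1 -> exists i, nm f1 (S x - e i) < eps.

(** The underlying fact is that [A + c] has finitely many eigenvalues below [2 L]. A finite net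
    replaces the eigenvectors: if [|x|^2] exceeds [2 eps] times the energy, then [x] has a large
    inner product with some net point. *)
Lemma finite_rank_domination (L : R) : 0 < L -> exists m (e : 'I_m -> V1),
  forall x a, A (x, a) ->
    L * Re (f1 x x) <= energy x a / 2 + \sum_i normc (f1 x (e i)) ^+ 2.
Proof.
move=> L0; have [Rs [RsA RsK Rn RsN]] := positive_resolvent.
set r := fun y z => f1 (Rs y) z in Rn RsN.
pose k := 1 + normc (c%:C + l).
have k0 : 0 < k by rewrite /k; have := normc_ge0 (c%:C + l); lra.
(* Resolvent identity: the compact operator is [(A - l)^-1], while the estimate concerns
   [(A + c)^-1]; [k] bounds the factor between them. *)
have RS z : Rs z = S (z - (c%:C + l) *: Rs z).
  apply/esym/SA; exists (z - c%:C *: Rs z); first exact: RsA.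
  by rewrite scalerDl opprD addrA.
(* Now [|x|^2 <= 2 eps energy] says exactly [L |x|^2 <= energy / 2]; for the opposite case [t] is
   such that [(t k q)^2 = L (k q / eps)^2]. *)
pose eps := (4 * L)^-1.
have e0 : 0 < eps by rewrite invr_gt0 mulr_gt0.
have [m [e eP]] := Snet (divr_gt0 e0 k0).
pose t := Num.sqrt L / eps.
exists m, (fun i => (t * k)%:C *: e i) => x a xa.
have t0 : 0 <= t by rewrite divr_ge0 ?sqrtr_ge0 // ltW.
have sum0 : 0 <= \sum_i normc (f1 x ((t * k)%:C *: e i)) ^+ 2.
  by apply: sumr_ge0 => i _; exact: sqr_ge0.
have E0 : Re (f1 x x) <= energy x a by exact: Ac.
rewrite -(nm_sqr fp1) in E0 *.
have [x0|x0] := eqVneq (nm f1 x) 0.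
  by rewrite x0 expr0n mulr0 addr_ge0 // divr_ge0 // (le_trans _ E0) // sqr_ge0.
have xp : 0 < nm f1 x by rewrite lt_def x0 nm_ge0.
have Rx_le : nm f1 (Rs x) <= nm f1 x.
  have h1 : nm f1 (Rs x) ^+ 2 <= nm r x ^+ 2 by rewrite ler_sqr ?nnegrE ?nm_ge0.
  rewrite (nm_sqr Rn) in h1.
  have h2 := le_trans h1 (le_trans (Re_le_normc _) (cauchy_schwarz fp1 _ _)).
  have [R0|R0] := eqVneq (nm f1 (Rs x)) 0; first by rewrite R0 ltW.
  have Rp : 0 < nm f1 (Rs x) by rewrite lt_def R0 nm_ge0.
  by move: h2; rewrite expr2 ler_pM2l.
pose x' := ((nm f1 x * k)^-1)%:C *: (x - (c%:C + l) *: Rs x).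
have x'1 : nm f1 x' <= 1.
  rewrite (nmZ fp1) normc_real ger0_norm ?invr_ge0 ?mulr_ge0 ?(ltW k0) ?nm_ge0 //.
  rewrite ler_pdivrMl ?mulr_gt0 // mulr1 (le_trans (nmD fp1 _ _)) // (nmN fp1) (nmZ fp1).
  rewrite /k mulrDr mulr1 lerD2l mulrC ler_wpM2r ?normc_ge0 //.
have [i xi] := eP x' x'1.
pose u := (k * nm f1 x)%:C *: e i.
have Ru : nm f1 (Rs x - u) <= eps * nm f1 x.
  have -> : Rs x - u = (k * nm f1 x)%:C *: (S x' - e i).
    rewrite scalerBr; congr (_ - _); rewrite [LHS]RS -SZ; congr S.
    rewrite /x' scalerA -rmorphM [nm f1 x * k]mulrC mulfV ?scale1r //.
    by rewrite mulf_neq0 // gt_eqF.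
  rewrite (nmZ fp1) normc_real ger0_norm ?mulr_ge0 ?(ltW k0) ?nm_ge0 //.
  move: xi; rewrite ltr_pdivlMr // => xi.
  have := nm_ge0 f1 (S x' - e i); nra.
set q := normc (f1 x (e i)).
have Rxx : Re (f1 (Rs x) x) <= nm f1 x * (k * q) + eps * nm f1 x ^+ 2.
  have -> : f1 (Rs x) x = f1 u x + f1 (Rs x - u) x by rewrite -(hermDl fp1) addrC subrK.
  rewrite ReD lerD // (le_trans (Re_le_normc _)) //.
    rewrite (hermZl fp1) normcM normc_real ger0_norm ?mulr_ge0 ?(ltW k0) ?nm_ge0 //.
    by rewrite (sesqC fp1 x) normc_conj mulrA [nm f1 x * k]mulrC.
  rewrite (le_trans (cauchy_schwarz fp1 _ _)) // expr2 mulrA.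
  by rewrite ler_wpM2r ?nm_ge0.
have q0 : 0 <= q by exact: normc_ge0.
set y := a + c%:C *: x.
have yx : Rs y = x by exact: RsK.
have ye : nm r y ^+ 2 = energy x a.
  by rewrite (nm_sqr Rn) /r yx (Re_hermC fp1) shift_energy.
(* Cauchy-Schwarz for the form [r]: [|x|^4 = r(y, x)^2 <= r(y, y) r(x, x)]. *)
have cs : nm f1 x ^+ 3 <= energy x a * (k * q + eps * nm f1 x).
  have h1 : nm f1 x ^+ 2 <= nm r y * nm r x.
    rewrite (le_trans _ (cauchy_schwarz Rn y x)) // /r yx (nm_sqr fp1).
    exact: Re_le_normc.
  have h2 : (nm f1 x ^+ 2) ^+ 2 <= (nm r y * nm r x) ^+ 2.
    by rewrite ler_sqr ?nnegrE ?sqr_ge0 ?mulr_ge0 ?nm_ge0.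
  rewrite (exprMn _ (nm r y)) ye (nm_sqr Rn) in h2.
  have En : 0 <= energy x a by rewrite (le_trans _ E0) // sqr_ge0.
  have h3 := le_trans h2 (ler_wpM2l En Rxx).
  rewrite -(ler_pM2l xp); lra.
rewrite -lerBlDl; have [small|big] := leP (nm f1 x ^+ 2) (2 * eps * energy x a).
  rewrite (le_trans _ sum0) // subr_le0 -(ler_pM2l e0).
  have -> : eps * (L * nm f1 x ^+ 2) = nm f1 x ^+ 2 / 4.
    by rewrite /eps; field; rewrite gt_eqF.
  lra.
have xq : nm f1 x <= k * q / eps.
  rewrite ler_pdivlMr // leNgt; apply/negP => h.
  have En : 0 < energy x a by rewrite (lt_le_trans _ E0) // exprn_gt0.
  have h1 : energy x a * (k * q + eps * nm f1 x) < energy x a * (2 * (eps * nm f1 x)).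
    by rewrite ltr_pM2l //; lra.
  have h2 : nm f1 x * (2 * eps * energy x a) < nm f1 x * nm f1 x ^+ 2.
    by rewrite ltr_pM2l.
  lra.
have kq : 0 <= k * q / eps by exact: divr_ge0 (mulr_ge0 (ltW k0) q0) (ltW e0).
have h1 : nm f1 x ^+ 2 <= (k * q / eps) ^+ 2.
  by rewrite ler_sqr ?nnegrE ?nm_ge0.
have h2 : L * nm f1 x ^+ 2 <= normc (f1 x ((t * k)%:C *: e i)) ^+ 2.
  rewrite (hermZr fp1) conjR normcM normc_real (ger0_norm (mulr_ge0 t0 (ltW k0))).
  rewrite -/q /t.
  have -> : (Num.sqrt L / eps * k * q) ^+ 2 = L * (k * q / eps) ^+ 2.
    by rewrite -{2}[L]sqr_sqrtr ?ltW // -exprMn; congr (_ ^+ 2); ring.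
  by rewrite ler_pM2l.
have h3 : normc (f1 x ((t * k)%:C *: e i)) ^+ 2 <=
    \sum_j normc (f1 x ((t * k)%:C *: e j)) ^+ 2.
  rewrite (bigD1 i) //= lerDl; apply: sumr_ge0 => j _; exact: sqr_ge0.
have En : 0 <= energy x a by rewrite (le_trans _ E0) // sqr_ge0.
by move: h2 h3; lra.
Qed.

End Energy.

(** * The block operator *)

Section DirectSum.
Context {R : realType} (V1 V2 : lmodType R[i]).
Local Notation C := R[i].
Local Notation Re := (@complex.Re R).
Variables (f1 : V1 -> V1 -> C) (f2 : V2 -> V2 -> C).
Hypotheses (fp1 : hilbert_sesq f1) (fp2 : hilbert_sesq f2).

Definition dsum_sesq (x y : V1 * V2) : C := f1 x.1 y.1 + f2 x.2 y.2.
Definition sign_flip (x : V1 * V2) : V1 * V2 := (x.1, - x.2).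

Local Notation f := dsum_sesq.
Local Notation J := sign_flip.

Let fh : hermitian_sesq f.
Proof.
split=> [c x y z|x y]; rewrite /f /=.
  by rewrite (sesqP fp1) (sesqP fp2) mulrDr addrACA.
by rewrite conjD -(sesqC fp1) -(sesqC fp2).
Qed.

Let fn : nonneg_sesq f.
Proof. by split=> // x; rewrite /f ReD addr_ge0 ?(nonneg_ge0 fp1) ?(nonneg_ge0 fp2). Qed.

Lemma nm_dsum x : nm f x ^+ 2 = nm f1 x.1 ^+ 2 + nm f2 x.2 ^+ 2.
Proof. by rewrite (nm_sqr fn) (nm_sqr fp1) (nm_sqr fp2) -ReD. Qed.

Lemma nm_fst_le x : nm f1 x.1 <= nm f x.
Proof. by rewrite -ler_sqr ?nnegrE ?nm_ge0 // nm_dsum lerDl sqr_ge0. Qed.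

Lemma nm_snd_le x : nm f2 x.2 <= nm f x.
Proof. by rewrite -ler_sqr ?nnegrE ?nm_ge0 // nm_dsum lerDr sqr_ge0. Qed.

Lemma nm_dsum_le x : nm f x <= nm f1 x.1 + nm f2 x.2.
Proof.
rewrite -ler_sqr ?nnegrE ?nm_ge0 ?addr_ge0 ?nm_ge0 // nm_dsum sqrrD.
by rewrite lerD2r lerDl mulrn_wge0 // mulr_ge0 ?nm_ge0.
Qed.

Lemma dsum_hilbert : hilbert_sesq f.
Proof.
split=> // [x|u uc].
  rewrite /f ReD => /eqP; rewrite paddr_eq0 ?(nonneg_ge0 fp1) ?(nonneg_ge0 fp2) //.
  move=> /andP[/eqP/(hilbert_def fp1) x1 /eqP/(hilbert_def fp2) x2].
  by rewrite (surjective_pairing x) x1 x2.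
have [|x1 h1] := hilbert_complete fp1 (u := fst \o u).
  move=> eps /uc [N h]; exists N => m n hm hn.
  exact: le_lt_trans (nm_fst_le (u m - u n)) (h m n hm hn).
have [|x2 h2] := hilbert_complete fp2 (u := snd \o u).
  move=> eps /uc [N h]; exists N => m n hm hn.
  exact: le_lt_trans (nm_snd_le (u m - u n)) (h m n hm hn).
exists (x1, x2) => eps e0; have e2 : 0 < eps / 2 by lra.
have [N1 k1] := h1 _ e2; have [N2 k2] := h2 _ e2.
exists (maxn N1 N2) => n; rewrite geq_max => /andP[n1 n2].
have := nm_dsum_le (u n - (x1, x2)); have := k1 n n1; have := k2 n n2.
by rewrite /=; lra.
Qed.

Lemma sign_flip_lin c x y : J (c *: x + y) = c *: J x + J y.
Proof. by congr pair; rewrite /= opprD scalerN. Qed.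

Lemma sign_flipK x : J (J x) = x.
Proof. by rewrite /J /= opprK -surjective_pairing. Qed.

Lemma sign_flip_sym x y : f (J x) y = f x (J y).
Proof. by rewrite /f /= (hermNl fp2) (hermNr fp2). Qed.

End DirectSum.

(** * Passing to the closure of a graph *)

Section AdherentMaps.
Context {R : realType} (V : lmodType R[i]) (f : V -> V -> R[i]).
Hypothesis fp : hilbert_sesq f.
Local Notation Re := (@complex.Re R).

(** The map [(x, y) |-> (x, L y + N x)] is Lipschitz. It serves in both directions between [M0] and
    [J (M0 - l0) + F]. *)
Lemma adherent_map (T T' : set (V * V)) (L N : V -> V) (b c : R) :
  (forall x y, nm f (L x - L y) <= b * nm f (x - y)) ->
  (forall x y, nm f (N x - N y) <= c * nm f (x - y)) ->
  (forall x y, T (x, y) -> T' (x, L y + N x)) ->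
  forall x y, adherent f f T (x, y) -> adherent f f T' (x, L y + N x).
Proof.
move=> Ll Nl TT x y h eps e0.
have k0 : 0 < 1 + `|b| + `|c| by have := normr_ge0 b; have := normr_ge0 c; lra.
have [x' [y' [Txy /= xx yy]]] := h _ (divr_gt0 e0 k0).
exists x', (L y' + N x'); split => /=; first exact: TT.
  rewrite (lt_le_trans xx) // ler_pdivrMr // ler_peMr ?(ltW e0) //.
  by have := normr_ge0 b; have := normr_ge0 c; lra.
rewrite opprD addrACA (le_lt_trans (nmD fp _ _)) //.
move: xx yy; rewrite !ltr_pdivlMr // => xx yy.
have := Ll y y'; have := Nl x x'.
have p1 := nm_ge0 f (x - x'); have p2 := nm_ge0 f (y - y').
have := ler_wpM2r p1 (ler_norm c); have := ler_wpM2r p2 (ler_norm b).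
have [hxy|hxy] := leP (nm f (x - x')) (nm f (y - y')).
  have := ler_wpM2l (normr_ge0 c) hxy; lra.
have := ler_wpM2l (normr_ge0 b) (ltW hxy); lra.
Qed.

Lemma adherent_pos (T : set (V * V)) (delta : R) :
  (forall x y, T (x, y) -> delta * Re (f x x) <= Re (f y x)) ->
  forall x y, adherent f f T (x, y) -> delta * Re (f x x) <= Re (f y x).
Proof.
move=> Tp x y h; rewrite -subr_le0.
pose K := nm f y + nm f x + 1 + `|delta| * (2 * nm f x + 1).
have n1 := nm_ge0 f x; have n2 := nm_ge0 f y; have n3 := normr_ge0 delta.
suff key (eps : R) : 0 < eps -> eps <= 1 ->
    delta * Re (f x x) - Re (f y x) <= K * eps.
  apply: (@small_le0 _ _ K) => eps e0.
  have [e1|e1] := leP eps 1; first exact: key.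
  rewrite (le_trans (key 1 ltr01 (lexx _))) // mulr1 ler_peMr ?(ltW e1) //.
  by rewrite /K !addr_ge0 // mulr_ge0 // addr_ge0 // mulr_ge0.
move=> e0 e1; have [x' [y' [/Tp Txy /= xx yy]]] := h eps e0.
have p1 := nm_ge0 f (x - x'); have p2 := nm_ge0 f (y - y').
have fE u v u' v' : f u v = f u' v' + f (u - u') v + f u' (v - v').
  by rewrite (hermBl fp) (hermBr fp); ring.
have bd u v u' v' (r s : R) : nm f (u - u') <= r -> nm f (v - v') <= r -> 0 <= r ->
    nm f v + nm f u' <= s -> `|Re (f u v) - Re (f u' v')| <= r * s.
  move=> hu hv r0 hs.
  have -> : Re (f u v) - Re (f u' v') = Re (f (u - u') v) + Re (f u' (v - v')).
    by rewrite (fE u v u' v') !ReD; ring.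
  rewrite (le_trans (ler_normD _ _)) // (le_trans _ (ler_wpM2l r0 hs)) // mulrDr lerD //.
    rewrite (le_trans (normc_Re_le _)) // (le_trans (cauchy_schwarz fp _ _)) //.
    by rewrite ler_wpM2r ?nm_ge0.
  rewrite (le_trans (normc_Re_le _)) // (le_trans (cauchy_schwarz fp _ _)) //.
  by rewrite mulrC ler_wpM2r ?nm_ge0.
have xx' : nm f x' <= nm f x + eps.
  by have := nm_sub_le fp x' x; rewrite (nmB fp); lra.
have yy' : nm f y' <= nm f y + eps.
  by have := nm_sub_le fp y' y; rewrite (nmB fp); lra.
have h1 : `|Re (f y x) - Re (f y' x')| <= eps * (nm f y + nm f x + 1).
  apply: bd; try exact: ltW; lra.
have h2 : `|Re (f x x) - Re (f x' x')| <= eps * (2 * nm f x + 1).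
  apply: bd; try exact: ltW; lra.
move: h1; rewrite ler_norml => /andP[h1 _].
have h3 : delta * (Re (f x x) - Re (f x' x')) <= `|delta| * (eps * (2 * nm f x + 1)).
  by rewrite (le_trans (ler_norm _)) // normrM ler_wpM2l.
rewrite /K; lra.
Qed.

Lemma frank_lipschitz n (e : 'I_n -> V) x y :
  nm f (frank f e x - frank f e y) <= (\sum_i nm f (e i) ^+ 2) * nm f (x - y).
Proof.
have -> : frank f e x - frank f e y = frank f e (x - y).
  rewrite /frank -sumrB; apply: eq_bigr => i _.
  by rewrite (hermBl fp) scalerBl.
rewrite (le_trans (nm_sum fp _ _ _)) // mulr_suml; apply: ler_sum => i _.
have h := ler_wpM2r (nm_ge0 f (e i)) (cauchy_schwarz fp (x - y) (e i)).
by rewrite (nmZ fp) (le_trans h) // -mulrA mulrC -expr2.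
Qed.

End AdherentMaps.

Section BlockOperator.
Context {R : realType} (V1 V2 : lmodType R[i]).
Local Notation C := R[i].
Local Notation Re := (@complex.Re R).
Variables (f1 : V1 -> V1 -> C) (f2 : V2 -> V2 -> C).
Hypotheses (fp1 : hilbert_sesq f1) (fp2 : hilbert_sesq f2).
Variables (A : set (V1 * V1)) (B : set (V2 * V1)) (D : set (V2 * V2)) (c d0 : R).
Hypothesis As : selfadj f1 A.
Hypothesis Ac : forall x a, A (x, a) -> Re (f1 x x) <= Re (f1 a x) + c * Re (f1 x x).
Hypothesis Bsub : Defs.subspace B.
Hypothesis Bd : forall x, adherent_in f2 (dom B) x.
Hypothesis Ds : selfadj f2 D.
Hypothesis Dd : forall y z, D (y, z) -> Re (f2 z y) <= d0 * Re (f2 y y).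
Local Notation Bst := (adjoint f2 f1 B).
Hypothesis form_closedness : forall (u a : nat -> V1) x,
  (forall n, A (u n, a n)) -> seq_cvg f1 u x ->
  (forall eps : R, 0 < eps -> exists N, forall m n, (N <= m)%N -> (N <= n)%N ->
     `|Re (f1 (a m - a n) (u m - u n))| < eps) ->
  exists w, Bst (x, w).
Hypothesis Dcore : D `<=` adherent f2 f2 (Defs.restrict D (dom B)).
Variables (S : V1 -> V1) (l : C).
Hypothesis SA : forall x z, S z = x <-> exists2 y, A (x, y) & z = y - l *: x.
Hypothesis SZ : forall a x, S (a *: x) = a *: S x.
Hypothesis Snet : forall eps : R, 0 < eps -> exists m (e : 'I_m -> V1),
  forall x, nm f1 x <= 1 -> exists i, nm f1 (S x - e i) < eps.

Local Notation f := (dsum_sesq f1 f2).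
Local Notation J := (@sign_flip R V1 V2).
Local Notation M0 := (block_op A B (op_opp Bst) D).

Let fp : hilbert_sesq f. Proof. exact: dsum_hilbert. Qed.

Let Bst_lin k x w x' w' : Bst (x, w) -> Bst (x', w') -> Bst (k *: x + x', k *: w + w').
Proof.
move=> h h' y b Byb /=; rewrite !(hermDr fp1) !(hermDr fp2) !(hermZr fp1) !(hermZr fp2).
by rewrite (h _ _ Byb) (h' _ _ Byb).
Qed.

Let Bst0 : Bst (0, 0).
Proof. by move=> y b _ /=; rewrite (herm0r fp1) (herm0r fp2). Qed.

Let M0P x y m : M0 ((x, y), m) <-> exists a b w d,
  [/\ A (x, a), B (y, b), Bst (x, w), D (y, d) & m = (a + b, d - w)].
Proof.
split=> [[a [b [w [d [/= h1 h2 h3 h4 ->]]]]]|[a [b [w [d [h1 h2 h3 h4 ->]]]]]].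
  by exists a, b, (- w), d; split; rewrite // opprK [w + d]addrC.
exists a, b, (- w), d; split; rewrite //= ?[- w + d]addrC //.
by rewrite /op_opp /= opprK.
Qed.

Let M0_subspace : Defs.subspace M0.
Proof.
have [A0 AD] := sa_subspace As; have [B0 BD] := Bsub; have [D0 DD] := sa_subspace Ds.
split.
  apply/(M0P 0 0); exists 0, 0, 0, 0.
  by split; [exact: A0|exact: B0|exact: Bst0|exact: D0|rewrite addr0 subr0].
move=> k [[x y] m] [[x' y'] m'].
move=> /M0P [a [b [w [d [h1 h2 h3 h4 ->]]]]] /M0P [a' [b' [w' [d' [h1' h2' h3' h4' ->]]]]].
apply/M0P; exists (k *: a + a'), (k *: b + b'), (k *: w + w'), (k *: d + d').
split; [exact: (AD k _ _ h1 h1')|exact: (BD k _ _ h2 h2')|exact: Bst_lin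
  |exact: (DD k _ _ h4 h4')|].
congr pair; rewrite /= ?scalerDr ?scalerBr ?opprD; first by rewrite addrACA.
by rewrite scalerN addrACA.
Qed.

Let M0_form x y a b w d z : A (x, a) -> B (y, b) -> Bst (x, w) -> D (y, d) ->
  f (J (a + b, d - w)) z = f1 a z.1 + f1 b z.1 + f2 w z.2 - f2 d z.2.
Proof.
move=> _ _ _ _; rewrite /dsum_sesq /= (hermDl fp1) (hermNl fp2) (hermBl fp2).
by rewrite opprB addrA.
Qed.

Let M0_sym z m z' m' : M0 (z, m) -> M0 (z', m') -> f (J m) z' = f z (J m').
Proof.
case: z z' => x y [x' y'].
move=> /M0P [a [b [w [d [h1 h2 h3 h4 ->]]]]] /M0P [a' [b' [w' [d' [h1' h2' h3' h4' ->]]]]].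
rewrite (M0_form _ h1 h2 h3 h4) (sesqC (dsum_hilbert fp1 fp2) (J _)).
rewrite (M0_form _ h1' h2' h3' h4') /= !conjD conjN.
rewrite -!(sesqC fp1) -!(sesqC fp2) (sa_sym As h1 h1') (sa_sym Ds h4 h4').
rewrite (h3' _ _ h2) (sesqC fp1 b') (h3 _ _ h2') -(sesqC fp2).
by congr (_ - _); rewrite -!addrA; congr (_ + _); rewrite addrC.
Qed.

Section Perturbed.
Variables (K l0 : R) (n : nat) (e1 : 'I_n -> V1).
Hypothesis K0 : 0 <= K.
Hypothesis BK : forall x a w,
  A (x, a) -> Bst (x, w) -> nm f2 w ^+ 2 <= K ^+ 2 * energy f1 c x a.
Hypothesis l0d : d0 + 4 * K ^+ 2 + 1 <= l0.
Hypothesis e1P : forall x a, A (x, a) -> (l0 + c) * Re (f1 x x) <=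
  energy f1 c x a / 2 + \sum_i normc (f1 x (e1 i)) ^+ 2.

Let e (i : 'I_n) : V1 * V2 := (e1 i, 0).

Let frankE z : frank f e z = (frank f1 e1 z.1, 0).
Proof.
rewrite /frank; elim/big_rec2: _ => [//|i u v _ ->].
congr pair; rewrite /= ?scaler0 ?addr0 //.
by rewrite /dsum_sesq /= (herm0r fp2) addr0.
Qed.

(** The graph of [J (M0 - l0) + F], obtained by solving for the value of [M0]. *)
Let W0 : set ((V1 * V2) * (V1 * V2)) :=
  [set p | M0 (p.1, J (p.2 - frank f e p.1) + l0%:C *: p.1)].

Let W0P z t : W0 (z, t) <->
  exists2 m, M0 (z, m) & t = J (m - l0%:C *: z) + frank f e z.
Proof.
split=> [h|[m h ->]]; last by rewrite /W0 /= addrK sign_flipK subrK.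
by eexists; first exact: h; rewrite /= addrK sign_flipK subrK.
Qed.

Let W0_val x y a b w d : A (x, a) -> B (y, b) -> Bst (x, w) -> D (y, d) ->
  W0 ((x, y), (a + b - l0%:C *: x + frank f1 e1 x, w - d + l0%:C *: y)).
Proof.
move=> h1 h2 h3 h4; apply/W0P; exists (a + b, d - w); first by apply/M0P; exists a, b, w, d.
by rewrite frankE; congr pair; rewrite /= addr0 !opprB addrC addrA addrAC.
Qed.

Let form_bound x a w y : A (x, a) -> Bst (x, w) ->
  normc (f2 w y) <= K * Num.sqrt (energy f1 c x a) * nm f2 y.
Proof.
move=> h h'; rewrite (le_trans (cauchy_schwarz fp2 _ _)) // ler_wpM2r ?nm_ge0 //.
have E0 : 0 <= energy f1 c x a by rewrite (le_trans _ (Ac h)) // (nonneg_ge0 fp1).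
rewrite -ler_sqr ?nnegrE ?nm_ge0 //; last by rewrite mulr_ge0 ?sqrtr_ge0.
by rewrite exprMn (sqr_sqrtr E0); exact: (BK h h').
Qed.

Let A_pert x a : A (x, a) ->
  energy f1 c x a / 2 <= Re (f1 (a - l0%:C *: x + frank f1 e1 x) x).
Proof.
move=> h; rewrite (hermDl fp1) (hermBl fp1) (hermZl fp1) (frank_form fp1).
rewrite !ReD ReN ReZ Re_sum; have := e1P h; rewrite /energy.
under [X in _ -> _ <= _ + X]eq_bigr => i _ do rewrite mulcJ /=.
lra.
Qed.

Let energy_ge x a : A (x, a) -> nm f1 x ^+ 2 <= energy f1 c x a.
Proof. by move=> h; rewrite (nm_sqr fp1); exact: Ac. Qed.

(** With [E] the energy of [x], the value is at least [E / 2 - 2 K sqrt E |y| + (4 K^2 + 1) |y|^2].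
    Removing the square of [sqrt E / 2 - 2 K |y|] leaves [E / 4 + |y|^2]; hence the [4 K^2 + 1] in
    [l0d] and the constant [4^-1]. *)
Let W0_pos z t : W0 (z, t) -> 4^-1 * Re (f z z) <= Re (f t z).
Proof.
case: z => x y /W0P [m /M0P [a [b [w [d [h1 h2 h3 h4 ->]]]]] ->].
rewrite frankE /dsum_sesq /= addr0.
have -> : f1 (a + b - l0%:C *: x + frank f1 e1 x) x =
   f1 (a - l0%:C *: x + frank f1 e1 x) x + f1 b x.
  by rewrite -(hermDl fp1) [a + b - _]addrAC [X in f1 X _ = _]addrAC.
rewrite (h3 _ _ h2) !ReD opprB (hermBl fp2) (hermZl fp2) (hermBl fp2).
rewrite !(ReD, ReN) ReZ opprB.
rewrite (Re_hermC fp2 y w).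
have E1 := A_pert h1; have E2 := energy_ge h1; rewrite (nm_sqr fp1) in E2.
have E3 := Dd h4; have E4 := form_bound y h1 h3.
have E5 := normc_Re_le (f2 w y).
have E6 : - (K * Num.sqrt (energy f1 c x a) * nm f2 y) <= Re (f2 w y).
  by have := le_trans E5 E4; rewrite ler_norml => /andP[].
have s2 : Num.sqrt (energy f1 c x a) ^+ 2 = energy f1 c x a.
  by rewrite sqr_sqrtr // (le_trans _ E2) // (nonneg_ge0 fp1).
have y2 := nm_sqr fp2 y.
have E7 : (l0 - d0 - 4 * K ^+ 2 - 1) * Re (f2 y y) >= 0.
  by rewrite mulr_ge0 ?(nonneg_ge0 fp2) //; move: l0d; lra.
have E8 := sqr_ge0 (Num.sqrt (energy f1 c x a) / 2 - 2 * K * nm f2 y).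
have y0 := nonneg_ge0 fp2 y; have x0 := nonneg_ge0 fp1 x.
move: (Num.sqrt _) s2 E6 E8 => s s2 E6 E8.
nra.
Qed.

Let W0_sym z t z' t' : W0 (z, t) -> W0 (z', t') -> f t z' = f z t'.
Proof.
move=> /W0P [m h ->] /W0P [m' h' ->].
have Jb u v : J (u - v) = J u - J v by rewrite -scaleN1r addrC sign_flip_lin scaleN1r addrC.
have Jz k u : J (k *: u) = k *: J u.
  by rewrite -[k *: u]addr0 sign_flip_lin /sign_flip /= oppr0 addr0.
rewrite (hermDl fp) (hermDr fp) (frank_sym fp) !Jb (hermBl fp) (hermBr fp).
by rewrite (M0_sym h h') !Jz (hermZl fp) (hermZr fp) conjR sign_flip_sym.
Qed.

Let Apert_onto b : exists x a, A (x, a) /\ a - l0%:C *: x + frank f1 e1 x = b.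
Proof.
pose F x := l0%:C *: x - frank f1 e1 x.
have Fl k x y : F (k *: x + y) = k *: F x + F y.
  rewrite /F (frank_lin fp1) scalerDr scalerBr !scalerA [k * _]mulrC opprD.
  by rewrite addrACA.
have Fs x y : f1 (F x) y = f1 x (F y).
  by rewrite /F (hermBl fp1) (hermBr fp1) (hermZl fp1) (hermZr fp1) conjR (frank_sym fp1).
have Ts := sa_perturb fp1 As Fl Fs.
have Tb x y : A (x, y + F x) -> nm f1 x <= 2 * nm f1 y.
  move=> h; have E := A_pert h; have E2 := energy_ge h.
  have e2 : y + F x - l0%:C *: x + frank f1 e1 x = y.
    have eF : F x - l0%:C *: x = - frank f1 e1 x by rewrite /F addrAC subrr add0r.
    by rewrite -[y + _ - _]addrA eF subrK.
  rewrite e2 in E; rewrite (nm_sqr fp1) in E2.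
  have h1 : 2^-1 * Re (f1 x x) <= Re (f1 y x) by lra.
  by have := form_lower_bound fp1 h1; rewrite ler_pdivrMl.
have [x /= h] := sa_onto fp1 Ts Tb b.
have eF : F x - l0%:C *: x = - frank f1 e1 x by rewrite /F addrAC subrr add0r.
by exists x, (b + F x); split => //; rewrite -[b + _ - _]addrA eF subrK.
Qed.

Let D_onto s : exists y d, D (y, d) /\ l0%:C *: y - d = s.
Proof.
pose F (y : V2) := l0%:C *: y.
have Fl k x y : F (k *: x + y) = k *: F x + F y.
  by rewrite /F scalerDr !scalerA mulrC.
have Fs x y : f2 (F x) y = f2 x (F y).
  by rewrite /F (hermZl fp2) (hermZr fp2) conjR.
have Ts := sa_perturb fp2 Ds Fl Fs.
have Tb x y : D (x, y + F x) -> nm f2 x <= 1 * nm f2 y.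
  move=> /Dd; rewrite /F (hermDl fp2) (hermZl fp2) ReD ReZ => h.
  have h1 : Re (f2 x x) <= Re (f2 (- y) x).
    have : 0 <= (l0 - d0 - 1) * Re (f2 x x).
      by rewrite mulr_ge0 ?(nonneg_ge0 fp2) //; move: l0d (sqr_ge0 K); lra.
    rewrite (hermNl fp2) ReN; lra.
  rewrite mul1r -(nmN fp2 y) -[nm f2 x]mul1r; apply: (form_lower_bound fp2).
  by rewrite mul1r.
have [y /= h] := sa_onto fp2 Ts Tb (- s).
by exists y, (- s + F y); split => //; rewrite /F opprD opprK addrCA subrr addr0.
Qed.

(* Choosing [x] with [(A - l0 + F) x = - b] removes the first component of the
   value of [W0] at [(x, y)]. *)
Let W0_range p : (forall z t, W0 (z, t) -> f t p = 0) -> p = 0.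
Proof.
case: p => p s h.
have B0 : B (0, 0) by exact: Bsub.1.
have D0 : D (0, 0) by exact: (sa_subspace Ds).1.
have s0 : s = 0.
  apply: (hilbert_def fp2); rewrite -(nm_sqr fp2).
  suff : nm f2 s * nm f2 s <= 0.
    by rewrite -expr2 => h2; apply/le_anti; rewrite h2 sqr_ge0.
  apply: (@small_le0 _ _ (3 * nm f2 s)) => eps e0.
  (* [s] is approximated by [g = (l0 - D) y] with [y] in the domain of [B], thanks to the core
     property. Orthogonality will read [<w + g, s> = 0]. *)
  have [y0 [d [Dy0 sE]]] := D_onto s.
  have k0 : 0 < `|l0| + 1 by have := normr_ge0 l0; lra.
  have k1 : 0 < eps / (`|l0| + 1) by rewrite divr_gt0.
  have [y [dy [[Dy [[yb b] Bb /= yb_y]] y1 y2]]] := Dcore Dy0 k1; subst yb.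
  move: y1 y2; rewrite /= !ltr_pdivlMr // => y1 y2.
  pose g := l0%:C *: y - dy.
  have gs : nm f2 (s - g) <= eps.
    have -> : s - g = l0%:C *: (y0 - y) - (d - dy).
      rewrite /g -sE scalerBr !opprB addrACA [RHS]addrACA.
      by congr (_ + _); exact: addrC.
    rewrite (le_trans (nmD fp2 _ _)) // (nmN fp2) (nmZ fp2) normc_real.
    have := nm_ge0 f2 (y0 - y); have := nm_ge0 f2 (d - dy); have := normr_ge0 l0.
    nra.
  have [x [a [Axa xb]]] := Apert_onto (- b).
  have [w xw] := dom_adjoint fp1 form_closedness Axa.
  have := h _ _ (W0_val Axa Bb xw Dy).
  have -> : a + b - l0%:C *: x + frank f1 e1 x = 0.
    by rewrite addrAC addrAC [a + b + _]addrAC addrAC xb addNr.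
  rewrite /dsum_sesq /= (herm0l fp1) add0r.
  have -> : w - dy + l0%:C *: y = w + g by rewrite /g -addrA [- dy + _]addrC.
  rewrite (hermDl fp2) => /eqP; rewrite addrC addr_eq0 => /eqP gw.
  have E := A_pert Axa; rewrite xb (hermNl fp1) ReN (xw _ _ Bb) in E.
  have E0 : 0 <= energy f1 c x a by rewrite (le_trans _ (energy_ge Axa)) // sqr_ge0.
  set N := Num.sqrt (energy f1 c x a).
  have N2 : N ^+ 2 = energy f1 c x a by rewrite sqr_sqrtr.
  have N0 : 0 <= N by exact: sqrtr_ge0.
  have fb := form_bound y Axa xw; rewrite -/N in fb.
  have E1 : N ^+ 2 / 2 <= K * N * nm f2 y.
    rewrite N2 (le_trans E) // (le_trans _ fb) // (sesqC fp2 w) Re_conj.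
    by rewrite -normc_opp -ReN Re_le_normc.
  have y0' := nm_ge0 f2 y.
  have NK : N <= 2 * K * nm f2 y.
    have [N00|N00] := eqVneq N 0; first by rewrite N00 !mulr_ge0.
    have Np : 0 < N by rewrite lt_def N00.
    rewrite -(ler_pM2r Np); lra.
  have wN : nm f2 w <= K * N.
    rewrite -ler_sqr ?nnegrE ?nm_ge0 ?mulr_ge0 // exprMn N2.
    exact: BK Axa xw.
  have gy : (4 * K ^+ 2 + 1) * nm f2 y <= nm f2 g.
    have [y00|y00] := eqVneq (nm f2 y) 0; first by rewrite y00 mulr0 nm_ge0.
    have yp : 0 < nm f2 y by rewrite lt_def y00.
    rewrite -(ler_pM2r yp) (le_trans _ (cauchy_schwarz fp2 g y)) //.
    rewrite (le_trans _ (Re_le_normc _)) // -mulrA -expr2 (nm_sqr fp2).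
    rewrite /g (hermBl fp2) (hermZl fp2) ReD ReN ReZ; have := Dd Dy.
    have : 0 <= (l0 - d0 - 4 * K ^+ 2 - 1) * Re (f2 y y).
      by rewrite mulr_ge0 ?(nonneg_ge0 fp2) //; move: l0d; lra.
    lra.
  (* [|w| <= K N <= 2 K^2 |y|], while [(4 K^2 + 1) |y| <= |g|]: the Schur complement correction is
     dominated by [l0 - D]. *)
  have wg : nm f2 w <= nm f2 g / 2.
    rewrite (le_trans wN) // (le_trans (ler_wpM2l K0 NK)) //.
    lra.
  have h1 : nm f2 s ^+ 2 <= normc (f2 (s - g) s) + normc (f2 g s).
    rewrite (nm_sqr fp2) (le_trans _ (normc_add _ _)) // -(hermDl fp2) subrK.
    exact: Re_le_normc.
  rewrite gw normc_opp in h1.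
  have h2 := cauchy_schwarz fp2 (s - g) s; have h3 := cauchy_schwarz fp2 w s.
  have h4 := nm_sub_le fp2 g s; rewrite (nmB fp2 g s) in h4.
  have ns := nm_ge0 f2 s.
  have h5 := ler_wpM2r ns gs.
  have h6 : nm f2 w * nm f2 s <= (eps + nm f2 s) / 2 * nm f2 s.
    by rewrite ler_wpM2r //; lra.
  have h7 : nm f2 s ^+ 2 = nm f2 s * nm f2 s by rewrite expr2.
  lra.
suff -> : p = 0 by rewrite s0.
apply: (hilbert_def fp1).
have [x [a [Axa xp]]] := Apert_onto p.
have [w xw] := dom_adjoint fp1 form_closedness Axa.
have := h _ _ (W0_val Axa B0 xw D0).
by rewrite addr0 xp /dsum_sesq /= s0 (herm0r fp2) addr0 => ->.
Qed.

Let W0_dense z : adherent_in f (dom W0) z.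
Proof.
move=> eps e0; have e2 : 0 < eps / 2 by lra.
have [_ [[x a] Axa /= <-] hx] := sa_dense As z.1 e2.
have e4 : 0 < eps / 4 by lra.
have [_ [[y0 d] Dy /= <-] hy0] := sa_dense Ds z.2 e4.
have [y [dy [[Dyd [[yb b] Bb /= yb_y]] hy _]]] := Dcore Dy e4; subst yb.
have [w xw] := dom_adjoint fp1 form_closedness Axa.
exists (x, y).
  exists ((x, y), (a + b - l0%:C *: x + frank f1 e1 x, w - dy + l0%:C *: y)) => //.
  exact: W0_val.
have := nm_dsum_le fp1 fp2 (z - (x, y)).
by have := nm_triangle fp2 z.2 y0 y; rewrite /= in hx hy0 hy *; lra.
Qed.

(** [W] is the closure of [W0], which is symmetric, coercive and of dense range. As [J], [F] and the
    shift by [l0] are bounded, closing [W0] amounts to closing [M0]. *)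
Lemma perturbed_selfadj : exists W : set ((V1 * V2) * (V1 * V2)),
  [/\ selfadj f W, forall z t, W (z, t) -> 4^-1 * Re (f z z) <= Re (f t z) &
      adherent f f M0 = krein_op f J e W l0].
Proof.
exists (adherent f f W0).
have W0_sub : Defs.subspace W0.
  have [M00 MD] := M0_subspace; split.
    have F00 : frank f e 0 = 0.
      by rewrite /frank big1 // => i _; rewrite (herm0l fp) scale0r.
    apply/(W0P 0 0); exists 0; first exact: M00.
    by rewrite scaler0 subr0 F00 addr0 /sign_flip /= oppr0.
  move=> k [z t] [z' t'] /W0P [m h ->] /W0P [m' h' ->]; apply/W0P.
  exists (k *: m + m'); first exact: (MD k _ _ h h').
  rewrite (frank_lin fp) /= scalerDr addrACA -sign_flip_lin; congr (J _ + _).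
  by rewrite scalerBr scalerDr !scalerA [k * _]mulrC opprD addrACA.
have W0_bd z t : W0 (z, t) -> nm f z <= 4 * nm f t.
  by move=> /W0_pos/(form_lower_bound fp); rewrite ler_pdivrMl.
have [Ws _] := closure_selfadj fp W0_sub W0_dense W0_sym W0_bd W0_range.
split => //; first exact: (adherent_pos fp W0_pos).
have Jb u v : J (u - v) = J u - J v by rewrite -scaleN1r addrC sign_flip_lin scaleN1r addrC.
have Jz k u : J (k *: u) = k *: J u.
  by rewrite -[k *: u]addr0 sign_flip_lin /sign_flip /= oppr0 addr0.
have Jnm u v : nm f (J u - J v) <= 1 * nm f (u - v).
  by rewrite mul1r -Jb /nm sign_flip_sym // sign_flipK.
pose Ke := \sum_i nm f (e i) ^+ 2.
have FL := frank_lipschitz fp e.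
apply/seteqP; split => [[z m] h|[z m]]; rewrite /krein_op /=.
  have := @adherent_map _ _ _ fp M0 W0 J (fun z => frank f e z - l0%:C *: J z) 1
    (Ke + `|l0|) Jnm _ _ z m h.
  rewrite Jb Jz addrA addrAC; apply.
    move=> x y.
    have -> : frank f e x - l0%:C *: J x - (frank f e y - l0%:C *: J y) =
        (frank f e x - frank f e y) - l0%:C *: (J x - J y).
      by rewrite scalerBr !opprB addrACA [RHS]addrACA; congr (_ + _); exact: addrC.
    rewrite (le_trans (nmD fp _ _)) // mulrDl lerD ?FL // (nmN fp) (nmZ fp).
    by rewrite normc_real ler_wpM2l //; have := Jnm x y; rewrite mul1r.
  move=> x y hxy; apply/W0P; exists y => //; rewrite Jb Jz.
  by rewrite addrA addrAC.
move=> h.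
have h2 : adherent f f M0 (z, J (J (m - l0%:C *: z) + frank f e z)
    + (l0%:C *: z - J (frank f e z))).
  apply: (@adherent_map _ _ _ fp W0 M0 J (fun z => l0%:C *: z - J (frank f e z)) 1
    (`|l0| + Ke) Jnm _ _ _ _ h).
    move=> x y.
    have -> : l0%:C *: x - J (frank f e x) - (l0%:C *: y - J (frank f e y)) =
        l0%:C *: (x - y) - (J (frank f e x) - J (frank f e y)).
      by rewrite scalerBr !opprB addrACA [RHS]addrACA; congr (_ + _); exact: addrC.
    rewrite (le_trans (nmD fp _ _)) // mulrDl lerD //.
      by rewrite (nmZ fp) normc_real.
    by rewrite (nmN fp) (le_trans (Jnm _ _)) // mul1r FL.
  move=> x _ /W0P [y hxy ->]; have Jd u v : J (u + v) = J u + J v.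
    by rewrite -[u in LHS]scale1r sign_flip_lin scale1r.
  by rewrite Jd sign_flipK addrACA subrr addr0 subrK.
move: h2; have Jd u v : J (u + v) = J u + J v.
  by rewrite -[u in LHS]scale1r sign_flip_lin scale1r.
by rewrite Jd sign_flipK addrACA subrr addr0 subrK.
Qed.

End Perturbed.

Lemma block_krein : exists n (e : 'I_n -> V1 * V2) (W : set ((V1 * V2) * (V1 * V2)))
    (delta l0 : R),
  [/\ selfadj f W, 0 < delta, forall z t, W (z, t) -> delta * Re (f z z) <= Re (f t z) &
      adherent f f M0 = krein_op f J e W l0].
Proof.
have [K K0 BK] := adjoint_energy_bound fp1 fp2 As Ac Bsub Bd form_closedness.
(* The first bound gives coercivity in the second component; the second makes [l0 + c] positive, as
   [finite_rank_domination] requires. *)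
pose l0 := Num.max (d0 + 4 * K ^+ 2 + 1) (1 - c).
have l0d : d0 + 4 * K ^+ 2 + 1 <= l0 by rewrite le_max lexx.
have lc : 0 < l0 + c.
  have : 1 - c <= l0 by rewrite le_max lexx orbT.
  lra.
have [n [e1 e1P]] := finite_rank_domination fp1 As Ac SA SZ Snet lc.
have [W [Ws Wp WE]] := perturbed_selfadj K0 BK l0d e1P.
by exists n, (fun i => (e1 i, 0)), W, 4^-1, l0; split => //; rewrite invr_gt0.
Qed.

End BlockOperator.

(** * Topology of Hilbert spaces *)

Section Topology.
Context {R : realType}.
Local Notation C := R[i].
Local Notation Re := (@complex.Re R).

Definition nbhs_form (V : normedModType C) (f : V -> V -> C) : Prop :=
  forall (x : V) (P : set V), nbhs x P <->
    exists2 eps : R, 0 < eps & forall y, nm f (x - y) < eps -> P y.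

Section Bridge.
Variables (V W : normedModType C) (f : V -> V -> C) (g : W -> W -> C).
Hypotheses (fn : nbhs_form f) (gn : nbhs_form g).
Hypotheses (fp : nonneg_sesq f) (gp : nonneg_sesq g).

Lemma nbhs_form_ball x (eps : R) : 0 < eps -> nbhs x [set y | nm f (x - y) < eps].
Proof. by move=> e0; apply/fn; exists eps. Qed.

Lemma closure_adherent (T : set (V * W)) : closure T = adherent f g T.
Proof.
apply/seteqP; split => [[x y] h eps e0|[x y] h P].
  have [|[x' y'] [Txy [/= hx hy]]] := h
    [set q | nm f (x - q.1) < eps /\ nm g (y - q.2) < eps].
    exists ([set x' | nm f (x - x') < eps], [set y' | nm g (y - y') < eps]) => //=.
    by split; [apply/fn; exists eps|apply/gn; exists eps].
  by exists x', y'.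
move=> [[P1 P2] /= [/fn [e1 e10 h1] /gn [e2 e20 h2]] PP].
have [|x' [y' [Txy /= hx hy]]] := h (Num.min e1 e2); first by rewrite lt_min e10.
exists (x', y'); split => //; apply: PP; split => /=; [apply: h1|apply: h2].
  by rewrite (lt_le_trans hx) // ge_min lexx.
by rewrite (lt_le_trans hy) // ge_min lexx orbT.
Qed.

Lemma dense_adherent (E : set V) : dense E <-> forall x, adherent_in f E x.
Proof.
split=> [h x eps e0|h O [x Ox] Oo].
  have [||y [Oy Ey]] := h (interior [set y | nm f (x - y) < eps]).
  - by exists x; exact: nbhs_form_ball.
  - exact: open_interior.
  by exists y => //; exact: (interior_subset Oy).
have /fn [eps e0 hO] : nbhs x O by apply: open_nbhs_nbhs; split.
by have [y Ey xy] := h x eps e0; exists y; split => //; exact: hO.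
Qed.

Lemma linear_continuous_form (S : {linear V -> W}) c :
  (forall x, nm g (S x) <= c * nm f x) -> continuous S.
Proof.
move=> h x P /gn [eps e0 hP]; apply/fn.
have c0 : 0 < `|c| + 1 by rewrite ltr_wpDl.
exists (eps / (`|c| + 1)); first exact: divr_gt0.
move=> y; rewrite ltr_pdivlMr // => hy; apply: hP.
rewrite -linearB (le_lt_trans (h _)) // (le_lt_trans _ hy) // mulrC ler_wpM2l ?nm_ge0 //.
by rewrite (le_trans (ler_norm c)) // lerDl.
Qed.

End Bridge.

Lemma nbhs_form_dsum (V W : normedModType C) (f : V -> V -> C) (g : W -> W -> C) :
  hilbert_sesq f -> hilbert_sesq g -> nbhs_form f -> nbhs_form g ->
  nbhs_form (V := (V * W)%type) (dsum_sesq f g).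
Proof.
move=> fp gp fn gn [x y] P; split.
  move=> [[P1 P2] /= [/fn [e1 e10 h1] /gn [e2 e20 h2]] PP].
  exists (Num.min e1 e2) => [|[x' y'] h]; first by rewrite lt_min e10.
  apply: PP; split => /=.
    apply: h1; rewrite (le_lt_trans (nm_fst_le fp gp ((x, y) - (x', y')))) //.
    by rewrite (lt_le_trans h) // ge_min lexx.
  apply: h2; rewrite (le_lt_trans (nm_snd_le fp gp ((x, y) - (x', y')))) //.
  by rewrite (lt_le_trans h) // ge_min lexx orbT.
move=> [eps e0 h]; have e2 : 0 < eps / 2 by lra.
exists ([set x' | nm f (x - x') < eps / 2], [set y' | nm g (y - y') < eps / 2]) => /=.
  by split; [apply/fn; exists (eps / 2)|apply/gn; exists (eps / 2)].
move=> [x' y'] [/= hx hy]; apply: h.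
by have := nm_dsum_le fp gp ((x, y) - (x', y')); rewrite /=; lra.
Qed.

Section Dot.
Variables (H : completeNormedModType C) (dot : {dot H for (@Num.conj C)}).
Hypothesis hdot : hilbert_dot dot.

Lemma dot_nonneg : nonneg_sesq dot.
Proof.
split.
  split=> [c x y z|x y]; first by rewrite linearDl linearZl_LR.
  by rewrite [LHS]hermC expr0 mul1r.
move=> x; apply: le0c_Re; rewrite -(hdot x) exprn_ge0 //.
Qed.

Lemma norm_nm x : `|x| = (nm dot x)%:C.
Proof.
have e : `|x| = (Re `|x|)%:C by apply: complex_ge0.
have x0 : 0 <= Re `|x| by apply: le0c_Re.
rewrite e; congr (_%:C); apply/eqP; rewrite -(eqrXn2 (n := 2)) ?nm_ge0 //.
rewrite (nm_sqr dot_nonneg) -(hdot x) e -rmorphXn //.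
Qed.

Lemma dot_nbhs_form : nbhs_form dot.
Proof.
move=> x P; split=> [/nbhs_ballP [e /= e0 h]|[eps e0 h]].
  have ee : e = (Re e)%:C by apply: complex_ge0; exact: ltW.
  exists (Re e) => [|y hy]; first by rewrite -ltcR -ee.
  by apply: h; rewrite -ball_normE /ball_ /= norm_nm ee ltcR.
apply/nbhs_ballP; exists (eps%:C) => /=; first by rewrite ltcR.
by move=> y; rewrite -ball_normE /ball_ /= norm_nm ltcR; exact: h.
Qed.

Lemma dot_hilbert : hilbert_sesq dot.
Proof.
split; first exact: dot_nonneg.
  move=> x x0; apply/eqP; rewrite -normr_eq0 norm_nm /nm x0 sqrtr0 //.
move=> u uc; have uC : cauchy (u @ \oo).
  apply: cauchy_exP => e e0.
  have ee : e = (Re e)%:C by apply: complex_ge0; exact: ltW.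
  have [|N h] := uc (Re e); first by rewrite -ltcR -ee.
  exists (u N); exists N => // n /= Nn.
  by rewrite -ball_normE /ball_ /= norm_nm ee ltcR; exact: h.
have /cvg_ex [x ux] : cvg (u @ \oo) by exact: cauchy_cvg.
exists x => eps e0; have := ux _ (nbhs_form_ball dot_nbhs_form x e0).
move=> [N _ h]; exists N => n Nn.
by rewrite (nmB dot_nonneg); exact: (h n Nn).
Qed.

Lemma dot_cvg (u : nat -> H) x : seq_cvg dot u x -> u @ \oo --> x.
Proof.
move=> ux P /dot_nbhs_form [eps e0 hP]; have [N h] := ux eps e0.
by exists N => // n /= Nn; apply: hP; rewrite (nmB dot_nonneg); exact: h.
Qed.

Lemma self_adjoint_selfadj (T : set (H * H)) : self_adjoint dot T -> selfadj dot T.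
Proof.
move=> [[Ts _] Td Ta]; split => //.
  by apply/(dense_adherent dot_nbhs_form).
by move=> u v; rewrite -[in X in _ <-> X]Ta.
Qed.

Lemma compact_net (S : {linear H -> H}) : compact_op S ->
  forall eps : R, 0 < eps -> exists m (e : 'I_m -> H),
    forall x, nm dot x <= 1 -> exists i, nm dot (S x - e i) < eps.
Proof.
move=> Sc eps e0; move: Sc; rewrite /compact_op precompactE compact_cover.
move=> /(_ H setT (fun y => interior [set z | nm dot (y - z) < eps])) [].
- by move=> y _; exact: open_interior.
- by move=> y _; exists y => //; exact: (nbhs_form_ball dot_nbhs_form).
move=> D _ h; pose s : seq H := D.
exists (size s), (fun i => nth 0 s i) => x x1.
have [|y /= yD yx] := h (S x).
  by apply: subset_closure; exists x => //=; rewrite norm_nm lecR.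
have im : (index y s < size s)%N by rewrite index_mem.
exists (Ordinal im); rewrite /= nth_index // (nmB dot_nonneg).
exact: (interior_subset yx).
Qed.

End Dot.

(* On [dom T^2] one has [|P x| = |T x|] because [P^2 = T^2], and [dom T^2] is a
   core of [T]. *)
Lemma dom_modulus (V : lmodType C) (f : V -> V -> C) (T P : set (V * V)) (mu : R) :
  hilbert_sesq f -> selfadj f T -> selfadj f P ->
  op_comp P P = op_comp (adjoint f f T) T ->
  (forall x y, T (x, y) -> nm f x <= nm f (y - mu%:C *: x)) -> dom T `<=` dom P.
Proof.
move=> fp Ts Ps PT Tb _ [[x y] Txy /= <-].
pose F (x : V) := mu%:C *: x.
have Fl k a b : F (k *: a + b) = k *: F a + F b.
  by rewrite /F scalerDr !scalerA mulrC.
have Fs a b : f (F a) b = f a (F b) by rewrite /F (hermZl fp) (hermZr fp) conjR.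
have T's := sa_perturb fp Ts Fl Fs.
have T'b a b : T (a, b + F a) -> nm f a <= 1 * nm f b.
  by move=> /Tb; rewrite addrK mul1r.
have onto := sa_onto fp T's T'b.
have step (n : nat) : exists t : V * V * V,
    [/\ T (t.1.1, t.1.2), T (t.1.2, t.2), nm f (t.1.1 - x) < n.+1%:R^-1 &
        nm f (t.1.2 - y) < n.+1%:R^-1].
  (* [w = (T - mu) x] is approximated by [w'] in the domain of [T]. Then [x' = (T - mu)^-1 w'] is in
     the domain of [T^2], with [x'] close to [x] and [T x'] close to [y]. *)
  pose w := y - F x; pose k := `|mu| + 1.
  have k0 : 0 < k by rewrite ltr_wpDl.
  have n0 : 0 < n.+1%:R^-1 / k by rewrite divr_gt0 // invr_gt0.
  have [_ [[w' v'] Tw' /= <-] ww] := sa_dense Ts w n0.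
  have [x' /= Tx'] := onto w'.
  have Tx2 : T (w' + F x', v' + F (w' + F x')).
    have := subspace_lin (sa_subspace Ts) mu%:C Tx' Tw'.
    by rewrite ![_ + w']addrC ![_ + v']addrC.
  have e1 : w' + F x' - y = (w' - w) + F (x' - x).
    have -> : F (x' - x) = F x' - F x by rewrite /F scalerBr.
    by rewrite /w opprB -[RHS]addrA [F x - y + _]addrC (addrA (F x' - F x)) subrK addrA.
  have h1 : nm f (x' - x) <= nm f (w' - w).
    have := subspace_sub (sa_subspace Ts) Tx' Txy.
    by rewrite e1 => /T'b; rewrite mul1r.
  move: ww; rewrite ltr_pdivlMr // (nmB fp) => ww.
  have p1 := nm_ge0 f (w' - w); have p2 := normr_ge0 mu.
  exists (x', w' + F x', v' + F (w' + F x')); split => //=.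
    rewrite (le_lt_trans _ ww) // (le_trans h1) // ler_peMr //.
    by rewrite /k lerDr.
  rewrite e1 (le_lt_trans (nmD fp _ _)) // (le_lt_trans _ ww) // (nmZ fp) normc_real /k.
  have := ler_wpM2l p2 h1; lra.
have /choice[t tP] := step.
pose a n := (t n).1.1; pose b n := (t n).1.2.
have aT n : T (a n, b n) by case: (tP n).
have PP n : exists z, P (a n, z) /\ P (z, (t n).2).
  have [z h1 h2] : op_comp P P (a n, (t n).2).
    rewrite PT; exists (b n); first exact: aT.
    case: (tP n) => _ h _ _ u v Tuv.
    exact: (sa_sym Ts Tuv h).
  by exists z.
have /choice[z zP] := PP.
have bz m n : nm f (z m - z n) = nm f (b m - b n).
  have h1 := subspace_sub (sa_subspace Ps) (zP m).1 (zP n).1.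
  have h2 := subspace_sub (sa_subspace Ps) (zP m).2 (zP n).2.
  have h3 := subspace_sub (sa_subspace Ts) (aT m) (aT n).
  have [_ bm _ _] := tP m; have [_ bn _ _] := tP n.
  have h4 := subspace_sub (sa_subspace Ts) bm bn.
  by rewrite /nm (sa_sym Ps h1 h2) -(sa_sym Ts h3 h4).
have inv0 (eps : R) : 0 < eps -> exists N, forall n, (N <= n)%N -> n.+1%:R^-1 < eps.
  move=> e0; exists (Num.truncn eps^-1) => n Nn.
  rewrite -[eps]invrK ltf_pV2 ?posrE ?invr_gt0 //.
  by rewrite (lt_le_trans (Num.Theory.truncnS_gt _)) // ler_nat.
have ax : seq_cvg f a x.
  by move=> eps /inv0 [N h]; exists N => n /h; apply: lt_trans; case: (tP n).
have by_ : seq_cvg f b y.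
  by move=> eps /inv0 [N h]; exists N => n /h; apply: lt_trans; case: (tP n).
have [v zv] : exists v, seq_cvg f z v.
  apply: (hilbert_complete fp) => eps e0; have [N h] := cvg_cauchy fp by_ e0.
  by exists N => m n Nm Nn; rewrite bz; exact: h.
exists (x, v) => //; apply: (sa_closed fp Ps).
by apply: (adherent_cvg fp fp _ ax zv) => n; exact: (zP n).1.
Qed.

Lemma dom_sqrt_modulus (H : completeNormedModType C) (dot : {dot H for (@Num.conj C)})
    (T S : set (H * H)) (mu : R) :
  hilbert_dot dot -> self_adjoint dot T -> is_sqrt_modulus dot T S ->
  (forall x y, T (x, y) -> nm dot x <= nm dot (y - mu%:C *: x)) -> dom T `<=` dom S.
Proof.
move=> hd Ts [P [Ps _ PT] [Ss _ SP]] Tb; apply: (@subset_trans _ (dom P)).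
  apply: (dom_modulus (dot_hilbert hd) _ _ PT Tb); exact: self_adjoint_selfadj.
move=> _ [[x y] Pxy /= <-]; move: Pxy; rewrite -SP => -[z /= Sxz _].
by exists (x, z).
Qed.

End Topology.

(** * From the assumptions on forms to the theorem *)

Lemma exists_linear (K : pzRingType) (V W : lmodType K) (S : V -> W) :
  (forall a x y, S (a *: x + y) = a *: S x + S y) ->
  exists L : {linear V -> W}, forall x, L x = S x.
Proof.
move=> Sl; pose L : {linear V -> W} := HB.pack S (GRing.isLinear.Build K V W *:%R S Sl).
by exists L.
Qed.

(** On the domain of [A] the form is [<A x, x>], which is real, so the Cauchy condition is the one
    in the closedness of [a], and the limit lies in the domain of [a]. *)
Lemma form_closed_graph (R : realType) (H1 H2 : completeNormedModType R[i])
    (dot1 : {dot H1 for (@Num.conj R[i])}) (dot2 : {dot H2 for (@Num.conj R[i])})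
    (A : set (H1 * H1)) (B : set (H2 * H1)) (a : qform H1) :
  hilbert_dot dot1 -> hilbert_dot dot2 -> self_adjoint dot1 A ->
  (forall x y z, A (x, z) -> fdom a y -> a x y = dot1 z y) -> form_closed a ->
  dom A `<=` fdom a -> fdom a `<=` dom (adjoint dot2 dot1 B) ->
  forall (u z : nat -> H1) x,
  (forall n, A (u n, z n)) -> seq_cvg dot1 u x ->
  (forall eps : R, 0 < eps -> exists N, forall m n, (N <= m)%N -> (N <= n)%N ->
     `|complex.Re (dot1 (z m - z n) (u m - u n))| < eps) ->
  exists w, adjoint dot2 dot1 B (x, w).
Proof.
move=> hd1 hd2 As aA ac dA da u z x uz ux cau.
have Asa := self_adjoint_selfadj hd1 As.
have uzmn m n : A (u m - u n, z m - z n).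
  exact: (subspace_sub (sa_subspace Asa) (uz m) (uz n)).
have ud y w : A (y, w) -> fdom a y by move=> h; apply: dA; exists (y, w).
have [xd _] : fdom a x /\
    (fun n => a (u n - x) (u n - x) : R[i]^o) @ \oo --> (0 : R[i]^o).
  apply: ac => [n||P /nbhs_ballP [e /= e0 hP]].
  - exact: ud (uz n).
  - exact: (dot_cvg hd1 ux).
  have ee : e = (complex.Re e)%:C by apply: complex_ge0; exact: ltW.
  have [|N hN] := cau (complex.Re e); first by rewrite -ltcR -ee.
  exists ([set n | (N <= n)%N], [set n | (N <= n)%N]).
    by split; exists N.
  move=> [m n] [/= Nm Nn]; apply: hP; rewrite -ball_normE /ball_ /= sub0r normrN.
  rewrite (aA _ _ _ (uzmn m n) (ud _ _ (uzmn m n))).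
  have -> : dot1 (z m - z n) (u m - u n) =
      (complex.Re (dot1 (z m - z n) (u m - u n)))%:C.
    apply: conj_self; rewrite -(sesqC (dot_nonneg hd1)).
    by rewrite (sa_sym Asa (uzmn m n) (uzmn m n)).
  by rewrite normr_normc normc_real ee ltcR; exact: hN.
by have [[x' w] h /= <-] := da _ xd; exists w.
Qed.

Theorem theorem7p3 (R : realType)
    (H1 H2 : completeNormedModType R[i])
    (dot1 : {dot H1 for (@Num.conj R[i])})
    (dot2 : {dot H2 for (@Num.conj R[i])})
    (hdot1 : hilbert_dot dot1) (hdot2 : hilbert_dot dot2)
    (H1_neq0 : exists x : H1, x != 0) (H2_neq0 : exists x : H2, x != 0)
    (A : set (H1 * H1)) (B : set (H2 * H1)) (D : set (H2 * H2))
    (a : qform H1) (d : qform H2)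
    (A_sa : self_adjoint dot1 A) (A_below : op_bounded_below dot1 A)
    (B_op : is_operator B) (B_dense : densely_defined B)
    (B_closable : closable B)
    (D_sa : self_adjoint dot2 D) (D_above : op_bounded_above dot2 D)
    (A_form : associated_form dot1 A a) (D_form : associated_form dot2 D d)
    (a_dom : fdom a `<=` dom (adjoint dot2 dot1 B))
    (I_or_II : (dom B `<=` dom D /\ core D (dom B)) \/ fdom d `<=` dom B)
    (A_compact : compact_resolvent A) :
  let M0 := block_op A B (op_opp (adjoint dot2 dot1 B)) D in
  let M := closure M0 in
  definitisable dot1 dot2 M /\
  finite_set [set l | spectrum M l /\ complex.Im l != 0].
Proof.
move=> M0 M.
have h1 := dot_hilbert hdot1; have h2 := dot_hilbert hdot2.
have n1 := dot_nbhs_form hdot1; have n2 := dot_nbhs_form hdot2.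
have As := self_adjoint_selfadj hdot1 A_sa; have Ds := self_adjoint_selfadj hdot2 D_sa.
have [m Am] := A_below; have [d0 Dm] := D_above.
(* The shift [1 - m] turns the lower bound [m] of [A] into the lower bound 1. *)
have Ac x z : A (x, z) -> complex.Re (dot1 x x) <=
    complex.Re (dot1 z x) + (1 - m) * complex.Re (dot1 x x).
  by move=> /Am; rewrite lecE ReZ => /andP[_ h]; lra.
have Dd y z : D (y, z) -> complex.Re (dot2 z y) <= d0 * complex.Re (dot2 y y).
  by move=> /Dm; rewrite lecE ReZ => /andP[_ h].
have Bd : forall x, adherent_in dot2 (dom B) x.
  by apply/(dense_adherent n2).
have dA : dom A `<=` fdom a.
  have [_ _ _ [S AS ->] _] := A_form.
  apply: (dom_sqrt_modulus (mu := m - 1) hdot1 A_sa AS) => x z /Ac h.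
  rewrite -[nm dot1 x]mul1r; apply: (form_lower_bound h1).
  rewrite (hermBl h1) (hermZl h1) ReD ReN ReZ; lra.
(* Under (I) this is the core property. Under (II) the domain of [D] lies in that of [|D|^(1/2)],
   hence in that of [B], and the restriction is [D] itself. *)
have Dcore : D `<=` adherent dot2 dot2 (Defs.restrict D (dom B)).
  case: I_or_II => [[_ [_ DB]]|dB].
    by rewrite -(closure_adherent n2 n2) DB; exact: subset_closure.
  move=> [y z] Dyz; apply: (adherent_sub h2 h2); split => //=; apply: dB.
  have [_ _ _ [S DS ->] _] := D_form.
  apply: (dom_sqrt_modulus (mu := d0 + 1) hdot2 D_sa DS); last by exists (y, z).
  move=> x t /Dd h; rewrite (nmB h2) -[nm dot2 x]mul1r; apply: (form_lower_bound h2).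
  by rewrite (hermBl h2) (hermZl h2) ReD ReN ReZ; lra.
have [_ _ a_closed _ aA] := A_form.
have form_cl := form_closed_graph hdot1 hdot2 A_sa aA a_closed dA a_dom.
have [l [S [_ SA] /(compact_net hdot1) Snet]] := A_compact.
have SZ k x : S (k *: x) = k *: S x by rewrite linearZ.
have [n [e [W [delta [l0 [Ws delta0 Wp ME]]]]]] :=
  block_krein h1 h2 As Ac B_op.1 Bd Ds Dd form_cl Dcore SA SZ Snet.
set f := dsum_sesq dot1 dot2 in Ws Wp ME; set J := @sign_flip R H1 H2 in ME.
have fp : hilbert_sesq f by exact: dsum_hilbert.
have fn : nbhs_form f by exact: nbhs_form_dsum.
have {}ME : M = krein_op f J e W l0 by rewrite -ME -(closure_adherent fn fn).
have Jl k x y : J (k *: x + y) = k *: J x + J y by exact: sign_flip_lin.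
have JK x : J (J x) = x by exact: sign_flipK.
have Js x y : f (J x) y = f x (J y) by exact: sign_flip_sym.
have Ms := krein_subspace fp Jl e l0 Ws : Defs.subspace (krein_op f J e W l0).
have Mf := krein_functional fp Jl JK Ws : forall y, krein_op f J e W l0 (0, y) -> y = 0.
have Mfin := finite_nonreal_eigenvalues fp Jl JK Js e l0 Ws delta0 Wp :
  finite_set [set l | eigenvalue_of f J e W l0 l /\ complex.Im l != 0].
have res k : complex.Im k != 0 -> ~ eigenvalue_of f J e W l0 k -> resolvent_set M k.
  move=> k0 ke.
  have [T [[c c0 Tc] TM]] := nonreal_resolvent fp Jl JK Js Ws delta0 Wp k0 ke.
  have Tl b x y : T (b *: x + y) = b *: T x + T y.
    apply/TM; have [x' xx' xE] := (TM _ _).1 (erefl (T x)).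
    have [y' yy' yE] := (TM _ _).1 (erefl (T y)).
    exists (b *: x' + y'); first exact: (subspace_lin Ms b xx' yy').
    rewrite {1}xE {1}yE !scalerDr scalerN !scalerA [b * k]mulrC opprD.
    by rewrite addrACA.
  have [L LT] := exists_linear Tl.
  exists L; split; last by move=> x z; rewrite LT ME; exact: TM.
  by apply: (linear_continuous_form fn fn (c := c)) => x; rewrite LT.
have Msa : krein_self_adjoint dot1 dot2 M.
  (* [J M] is [W] minus this everywhere defined symmetric map, hence self-adjoint. *)
  pose F z := frank f e z - l0%:C *: J z.
  have Fl k x y : F (k *: x + y) = k *: F x + F y.
    rewrite /F (frank_lin fp) Jl scalerDr scalerBr !scalerA [l0%:C * k]mulrC opprD.
    by rewrite addrACA.
  have Fs x y : f (F x) y = f x (F y).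
    rewrite /F (hermBl fp) (hermBr fp) (hermZl fp) (hermZr fp) conjR (frank_sym fp).
    by rewrite Js.
  have JMs := sa_perturb fp Ws Fl Fs.
  have JE x y : J (J y - l0%:C *: x) + frank f e x = y + F x.
    rewrite [J y - _]addrC -scaleNr Jl JK scaleNr [- _ + y]addrC -addrA.
    by rewrite [- _ + frank f e x]addrC.
  have JME : fund_sym M = [set p | W (p.1, p.2 + F p.1)].
    by apply/seteqP; split => -[x y] /=; rewrite /fund_sym /= ME /krein_op /= -JE.
  rewrite /krein_self_adjoint JME; split.
  - split; first exact: (sa_subspace JMs).
    move=> x y y' h h'; apply/eqP; rewrite -subr_eq0; apply/eqP.
    apply: (sym_functional fp (sa_dense JMs) (sa_sym JMs)).
    by have := subspace_sub (sa_subspace JMs) h h'; rewrite subrr.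
  - by apply/(dense_adherent fn); exact: (sa_dense JMs).
  - by apply/seteqP; split => -[u v]; [move=> h; apply/(sa_adj JMs)|move=> /(sa_adj JMs)].
split; last first.
  apply: sub_finite_set Mfin => k [Mk k0]; split => //.
  by apply: contrapT => ke; apply: Mk; exact: res.
split => //.
(* The infinitely many points [i (j + 1)] cannot all be among the finitely many nonreal eigenvalues,
   so one of them is a resolvent point. *)
- apply: contrapT => no.
  have sub : range (fun j : nat => Complex 0 (j.+1%:R : R)) `<=`
      [set l | eigenvalue_of f J e W l0 l /\ complex.Im l != 0].
    move=> _ [j _ <-]; split; last by rewrite /= pnatr_eq0.
    apply: contrapT => ke; apply: no; exists (Complex 0 (j.+1%:R : R)).
    by apply: res => //=; rewrite pnatr_eq0.
  apply: infinite_nat; have := sub_finite_set sub Mfin.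
  move=> /(finite_preimage (f := fun j : nat => Complex 0 (j.+1%:R : R))).
  have inj : {in (fun j : nat => Complex 0 (j.+1%:R : R)) @^-1`
      range (fun j : nat => Complex 0 (j.+1%:R : R)) &,
      injective (fun j : nat => Complex 0 (j.+1%:R : R))}.
    by move=> i j _ _ [] /eqP; rewrite eqr_nat eqSS => /eqP.
  by move=> /(_ inj); apply: sub_finite_set => j _; exists j.
- have [p p0 pP] := krein_definitisable fp Jl JK Js e l0 Ws delta0 Wp.
  exists p => // x y; rewrite ME => /pP; rewrite /f /dsum_sesq /J /= /krein_dot.
  by rewrite (hermNl h2).
Qed.
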